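(* Let $\omega=(\alpha,\beta,\gamma)$ be such that there is a simple closed loop in $\mathbb C$ around $[-1,1]$ enclosing no zeros of $E^\omega$ (e.g. if $\beta_1<1$). Then the correlation functions of the point process $\widetilde{\mathcal X}^\omega$ are determinantal: for all $k\ge1$ and $z_1,\dots,z_k\in\mathbb Z_{\ge0}\times\mathbb Z_{>0}$, $$\mathbb P(\widetilde{\mathcal X}^\omega\supset\{z_1,\dots,z_k\})=\det[K^\omega(z_i,z_j)]_{i,j=1}^k,$$ where $$K^\omega((s,n),(t,m))=\frac{2^{\alpha_n+1/2}}{\pi}\frac{1}{2\pi i}\int_{-1}^1\oint\frac{E^\omega(x)}{E^\omega(u)}J_{s,\alpha_n}(x)J_{t,\alpha_m}(u)\frac{(1-x)^{r_n+\alpha_n}(1+x)^{1/2}}{(1-u)^{r_m}(x-u)}\,du\,dx$$ $$+1_{(n\ge m)}\frac{2^{\alpha_n+1/2}}{\pi}\int_{-1}^1J_{s,\alpha_n}(x)J_{t,\alpha_m}(x)(1-x)^{r_n-r_m+\alpha_n}(1+x)^{1/2}dx,$$ the $u$-contour being a positively oriented simple loop around $[-1,1]$ containing no zeros of $E^\omega$.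
   Context: For $n\ge1$ let $r_n=\lfloor(n+1)/2\rfloor$, $\alpha_n=1/2$ ($n$ even), $-1/2$ ($n$ odd). $\mathbb J_n$ is the set of partitions $\lambda=(\lambda_1\ge\dots\ge\lambda_{r_n}\ge0)$; for $\lambda\in\mathbb J_n$, $\widetilde\lambda_j=\lambda_j+r_n-j$. For $\lambda\in\mathbb J_n$, $\mu\in\mathbb J_{n+1}$ write $\lambda\prec\mu$ if $\mu_1\ge\lambda_1\ge\mu_2\ge\dots\ge\mu_{r_n}\ge\lambda_{r_n}\ge\mu_{r_n+1}$ (with $\mu_{r_n+1}:=0$ if $r_{n+1}=r_n$). Chebyshev polynomials: $J_{0,\pm1/2}=1$, $J_{1,1/2}(x)=2x$, $J_{1,-1/2}(x)=2x-1$, both satisfying $xp_k=\frac12p_{k+1}+\frac12p_{k-1}$, $k\ge1$. $\langle f,g\rangle_\alpha=\frac{2^{\alpha+1/2}}{\pi}\int_{-1}^1fg(1-x)^\alpha(1+x)^{1/2}dx$. $\omega=(\alpha,\beta,\gamma)$: $\alpha,\beta$ nonincreasing summable nonnegative sequences, $\gamma\ge0$; $E^\omega(x)=e^{\frac\gamma2(z+z^{-1}-2)}\prod_{i}\frac{(1+\frac{\beta_i}{2}(z-1))(1+\frac{\beta_i}{2}(z^{-1}-1))}{(1-\frac{\alpha_i}{2}(z-1))(1-\frac{\alpha_i}{2}(z^{-1}-1))}$ for $x=(z+z^{-1})/2$ (a function of $x$, extended analytically). Plancherel measure on paths: $P^\omega$ is the probability measure on sequences $(u^1,u^2,\dots)$,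 $u^m\in\mathbb J_m$, such that for each $n$ and $u^1,\dots,u^n$, $$P^\omega(\text{first $n$ terms are }u^1,\dots,u^n)=\prod_{m=1}^{n-1}1_{(u^m\prec u^{m+1})}\cdot2^{\binom{r_n}{2}}\det\big[\langle J_{\widetilde{u^n_j},\alpha_n},(x-1)^{r_n-i}E^\omega\rangle_{\alpha_n}\big]_{i,j=1}^{r_n}$$ ($\binom12:=0$); this equals $P^\omega_n(u^n)/\dim_nu^n$ times the interlacing indicator, where $P^\omega_n$ are the Plancherel measures of $Sp(\infty)$. The point process is $\widetilde{\mathcal X}^\omega=\{(\widetilde{u^m_k},m):m\ge1,1\le k\le r_m\}\subset\mathbb Z_{\ge0}\times\mathbb Z_{>0}$ with $(u^m)\sim P^\omega$. *)

(* Defs.v *)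
From HB Require Import structures.
From mathcomp Require Import all_boot all_order all_algebra.
From mathcomp Require Import all_classical all_reals all_analysis.
From mathcomp Require Export complex.
Set Implicit Arguments. Unset Strict Implicit. Unset Printing Implicit Defensive.
Import Order.TTheory GRing.Theory Num.Theory.
Import numFieldNormedType.Exports.
Local Open Scope ring_scope.
Local Open Scope classical_set_scope.
Local Open Scope complex_scope.

Section Defs.
Variable R : realType.
Local Notation C := R[i].

Definition rr (n : nat) : nat := n.+1./2.

Definition alph (n : nat) : R := if odd n then - (1/2) else 1/2.

(* J_n : partitions lambda_1 >= ... >= lambda_{r_n} >= 0, stored as the
   sequence [:: lambda_1; ...; lambda_{r_n}] *)
Definition partJ (n : nat) (l : seq nat) : bool :=
  (size l == rr n) && sorted geq l.

(* tilde lambda_{j+1} = lambda_{j+1} + r_n - (j+1)   (0-based index j) *)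
Definition tl (n : nat) (l : seq nat) (j : nat) : nat :=
  (nth 0 l j + rr n - j.+1)%N.

(* lambda ≺ mu : mu_1 >= lambda_1 >= mu_2 >= ... >= mu_{r_n} >= lambda_{r_n}
   >= mu_{r_n+1}  (mu_{r_n+1} := 0 when absent, via the default of nth) *)
Definition interlace (lam mu : seq nat) : bool :=
  all (fun j => (nth 0 lam j <= nth 0 mu j)%N && (nth 0 mu j.+1 <= nth 0 lam j)%N)
      (iota 0 (size lam)).

(* Jpair o k = (J_k, J_{k+1}); o = true  <-> alpha = -1/2 *)
Fixpoint Jpair (o : bool) (k : nat) : {poly R} * {poly R} :=
  match k with
  | 0 => (1, 2%:P * 'X - (if o then 1 else 0))
  | k'.+1 => let pq := Jpair o k' in (pq.2, 2%:P * 'X * pq.2 - pq.1)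
  end.

Definition Jpoly (n k : nat) : {poly R} := (Jpair (odd n) k).1.

Definition Jc (n k : nat) (u : C) : C :=
  (map_poly (fun c : R => c%:C) (Jpoly n k)).[u].

Definition cexp (w : C) : C :=
  (expR (complex.Re w))%:C * (cos (complex.Im w) +i* sin (complex.Im w)).

Definition climit (u : nat -> C) : C :=
  limn (fun N => complex.Re (u N)) +i* limn (fun N => complex.Im (u N)).

Definition cint (D : set R) (f : R -> C) : C :=
  Rintegral lebesgue_measure D (fun x => complex.Re (f x))
  +i* Rintegral lebesgue_measure D (fun x => complex.Im (f x)).

Definition Efac (al be : R) (z : C) : C :=
  ((1 + (be / 2)%:C * (z - 1)) * (1 + (be / 2)%:C * (z^-1 - 1))) /
  ((1 - (al / 2)%:C * (z - 1)) * (1 - (al / 2)%:C * (z^-1 - 1))).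

Definition Ez (a b : nat -> R) (g : R) (z : C) : C :=
  cexp ((g / 2)%:C * (z + z^-1 - 2)) *
  climit (fun N => \prod_(i < N) Efac (a i) (b i) z).

(* E^omega as a function of x = (z + z^-1)/2 : take z = x + sqrt(x^2 - 1),
   a root of z^2 - 2 x z + 1 = 0 (the other root being z^-1, and Ez is
   invariant under z <-> z^-1) *)
Definition Ex (a b : nat -> R) (g : R) (x : C) : C :=
  Ez a b g (x + sqrtC (x ^+ 2 - 1)).

Definition zeroE (a b : nat -> R) (g : R) (w : C) : Prop :=
  forall eps : R, 0 < eps -> exists2 delta : R, 0 < delta &
    forall x : C, 0 < `|x - w| < delta%:C -> `|Ex a b g x| < eps%:C.

Definition gam (gx gy : R -> R) (t : R) : C := gx t +i* gy t.
Definition dgam (gx gy : R -> R) (t : R) : C := gx^`() t +i* gy^`() t.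

Definition contour_int (gx gy : R -> R) (f : C -> C) : C :=
  cint `[0, 1] (fun t => f (gam gx gy t) * dgam gx gy t).

Definition winding (gx gy : R -> R) (w : C) : C :=
  (2%:C * pi%:C * 'i)^-1 * contour_int gx gy (fun u => (u - w)^-1).

Definition admissible_loop (a b : nat -> R) (g : R) (gx gy : R -> R) : Prop :=
  [/\ {within `[0, 1], continuous gx} /\ {within `[0, 1], continuous gy},
      gam gx gy 0 = gam gx gy 1,
      (forall s t : R, 0 <= s < 1 -> 0 <= t < 1 ->
          gam gx gy s = gam gx gy t -> s = t),
      (exists S : seq R,
          (forall t : R, 0 < t < 1 -> t \notin S ->
              derivable gx t 1 /\ derivable gy t 1) /\
          exists M : R, forall t : R, 0 < t < 1 -> t \notin S ->
              `|gx^`() t| <= M /\ `|gy^`() t| <= M) &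
      [/\ (forall t : R, 0 <= t <= 1 ->
              (forall x : R, -1 <= x <= 1 -> gam gx gy t <> x%:C) /\
              ~ zeroE a b g (gam gx gy t)),
          (forall x : R, -1 <= x <= 1 -> winding gx gy x%:C = 1) &
          (forall w : C, zeroE a b g w -> winding gx gy w = 0)]].

Definition cst (n : nat) : R := 2 `^ (alph n + 1/2) / pi.

Definition innerp (n : nat) (f h : R -> C) : C :=
  (cst n)%:C * cint `[-1, 1]
    (fun x => f x * h x * ((1 - x) `^ alph n * (1 + x) `^ (1/2))%:C).

(* the right-hand side of the defining formula of P^omega for the cylinder
   {first n terms are u 1, ..., u n} *)
Definition cylw (a b : nat -> R) (g : R) (n : nat) (u : nat -> seq nat) : C :=
  (\prod_(1 <= m < n) (interlace (u m) (u m.+1))%:R) *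
  2 ^+ 'C(rr n, 2) *
  \det (\matrix_(i < rr n, j < rr n)
          innerp n (fun x => ((Jpoly n (tl n (u n) j)).[x])%:C)
                   (fun x => ((x - 1) ^+ (rr n - i.+1))%:C * Ex a b g x%:C)).

Definition cyl (T : Type) (U : nat -> T -> seq nat) (n : nat)
  (u : nat -> seq nat) : set T :=
  [set w | forall m, (1 <= m <= n)%N -> U m w = u m].

Definition inX (V : nat -> seq nat) (p : nat * nat) : Prop :=
  (1 <= p.2)%N /\ exists2 k, (k < rr p.2)%N & tl p.2 (V p.2) k = p.1.

Definition Kern (a b : nat -> R) (g : R) (gx gy : R -> R)
  (p q : nat * nat) : C :=
  let s := p.1 in let n := p.2 in let t := q.1 in let m := q.2 in
  (cst n)%:C * (2%:C * pi%:C * 'i)^-1 *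
    cint `[-1, 1] (fun x : R =>
      contour_int gx gy (fun u : C =>
        Ex a b g x%:C / Ex a b g u * ((Jpoly n s).[x])%:C * Jc m t u *
        ((1 - x) `^ ((rr n)%:R + alph n) * (1 + x) `^ (1/2))%:C /
        ((1 - u) ^+ rr m * (x%:C - u))))
  + (if (m <= n)%N then
       (cst n)%:C * cint `[-1, 1] (fun x : R =>
         ((Jpoly n s).[x] * (Jpoly m t).[x] *
          (1 - x) `^ ((rr n)%:R - (rr m)%:R + alph n) * (1 + x) `^ (1/2))%:C)
     else 0).

End Defs.

(* Main.v *)
(** The probability of a path is a determinant whose row for a particle at [s] holds the Chebyshev
coefficients of order [s] of some functions. To sum over the last level with the previous one
fixed, note that interlacing confines each particle to an interval, and that on each interval
the coefficients telescope to those of the same functions one level down. The boundary terms at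
infinity vanish by Bessel's inequality, and one row becomes constant when the number of
particles drops. Requiring particles at given points borders the determinant with one row and
one column per point. Descending to level 0 leaves a determinant indexed by the points alone.
At the top level the columns may be chosen to be the functions (2(x-1))^(r-j) E(x) t_j(x), with t_j the
Taylor polynomial of 1/E at 1, which are unitriangular combinations of the (x-1)^(r-j) E(x).
With this choice the entries at level 0 are conjugate to the kernel: Cauchy's formula
evaluates its inner integral from the Taylor expansion of J_t at 1. Cauchy's formula for 1/E
follows by approximating 1/E boundedly on the loop by rational functions whose poles have
winding number zero. *)
Require Import Defs.
From HB Require Import structures.
From mathcomp Require Import all_boot all_order all_algebra.
From mathcomp Require Import all_classical all_reals all_analysis.
From mathcomp Require Import complex.
From mathcomp Require Import perm measurable_realfun.
From mathcomp Require Import ring lra zify.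
Import Order.TTheory GRing.Theory Num.Theory.
Import numFieldNormedType.Exports.
Local Open Scope ring_scope.
Local Open Scope classical_set_scope.
Local Open Scope complex_scope.
Set Implicit Arguments. Unset Strict Implicit. Unset Printing Implicit Defensive.

(** * Bounded measurable functions and weighted integrals *)

(** The border makes hitting the given points a matter of linear algebra: if a particle sits at a
    point, a row operation turns the row of the point into a unit vector; if none does, the column
    of the point vanishes. The sum over a level then runs over all interlacing positions, and
    multilinearity applies. The determinant keeps its size although the number of particles drops,
    because rows without a particle stay as virtual rows of constants. The choice of columns at the
    top is dictated by these rows. Going down subtracts a constant and divides by 2(x-1); with
    Taylor polynomials of 1/E as factors the constants form an identity matrix, so the final
    elimination inverts nothing. On the analytic side the loop has only a bounded derivative off
    finitely many parameters, and at a pole the value of E is set by the convention for division by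
    zero. So contours are never deformed: rational functions are integrated by partial fractions,
    and the rest follows by dominated convergence off finitely many parameters, finitely many
    because the loop is simple. *)

Lemma countable_seq (T : choiceType) (S : seq T) : countable [set` S].
Proof. by apply: finite_set_countable; exact: finite_seq. Qed.

Section BoundedMeasurable.
Variable R : realType.
Local Notation mu := (@lebesgue_measure R).
Local Notation C := R[i].

(** An algebra of functions, each integrable against any integrable weight on a measurable [D], so
    that products under integrals need no separate integrability argument. *)
Definition bmr (D : set R) (f : R -> R) :=
  measurable_fun D f /\ exists M : R, forall x, D x -> `|f x| <= M.

Definition bmc (D : set R) (f : R -> C) :=
  bmr D (fun x => complex.Re (f x)) /\ bmr D (fun x => complex.Im (f x)).

Lemma bmr_cst D c : bmr D (fun=> c).
Proof. by split; [exact: measurable_cst|exists `|c|]. Qed.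

Lemma bmrD D f g : bmr D f -> bmr D g -> bmr D (fun x => f x + g x).
Proof.
move=> [mf [M Mf]] [mg [N Ng]]; split; first exact: measurable_funD.
by exists (M + N) => x Dx; rewrite (le_trans (ler_normD _ _))// lerD ?Mf ?Ng.
Qed.

Lemma bmrM D f g : bmr D f -> bmr D g -> bmr D (fun x => f x * g x).
Proof.
move=> [mf [M Mf]] [mg [N Ng]]; split; first exact: measurable_funM.
by exists (M * N) => x Dx; rewrite normrM ler_pM ?Mf ?Ng.
Qed.

Lemma bmrN D f : bmr D f -> bmr D (fun x => - f x).
Proof.
move=> bf; rewrite (_ : (fun x => - f x) = (fun x => (-1) * f x)).
  by apply: bmrM => //; exact: bmr_cst.
by apply/funext => x; rewrite mulN1r.
Qed.

Lemma bmrB D f g : bmr D f -> bmr D g -> bmr D (fun x => f x - g x).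
Proof. by move=> bf bg; apply: bmrD => //; exact: bmrN. Qed.

Lemma eq_bmr D f g : (forall x, D x -> f x = g x) -> bmr D f -> bmr D g.
Proof.
move=> fg [mf [M Mf]]; split.
  by apply: eq_measurable_fun mf => x; rewrite inE; exact: fg.
by exists M => x Dx; rewrite -fg ?Mf.
Qed.

(** One exceptional point is repaired at a time; on a singleton measurability is automatic. This
    absorbs points where a derivative is missing or a denominator vanishes. *)
Lemma measurable_fun_off (D : set R) (S : seq R) (f g : R -> R) :
  measurable D -> (forall x, D x -> x \notin S -> f x = g x) ->
  measurable_fun D g -> measurable_fun D f.
Proof.
elim: S f => [|s S IH] f mD fg mg.
  by apply: eq_measurable_fun mg => x; rewrite inE => Dx; rewrite fg.
pose f' x := if x == s then g x else f x.
have mf' : measurable_fun D f'.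
  apply: IH => // x Dx xS; rewrite /f'; case: eqP => // /eqP xs.
  by apply: fg => //; rewrite in_cons negb_or xs.
have -> : D = (D `\ s) `|` (D `&` [set s]).
  by rewrite setDE setUC -setIUr setUv setIT.
have m1 : measurable ([set s] : set R) by [].
apply/measurable_funU; [exact: measurableD|exact: measurableI|split].
  apply: (@eq_measurable_fun _ _ _ _ _ f').
    by move=> x; rewrite inE => -[_ /eqP/negPf xs]; rewrite /f' xs.
  by apply: measurable_funS mf' => //; exact: subDsetl.
by apply: (measurable_funS (E := [set s])) => //; exact: measurable_fun_set1.
Qed.

Lemma bmr_off D (S : seq R) f g : measurable D ->
  (forall x, D x -> x \notin S -> f x = g x) -> bmr D g -> bmr D f.
Proof.
move=> mD fg [mg [M Mg]]; split; first exact: measurable_fun_off fg mg.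
exists (Num.max M (\big[Num.max/0]_(s <- S) `|f s|)) => x Dx.
have [xS|xS] := boolP (x \in S); last by rewrite fg// le_max Mg.
rewrite le_max; apply/orP; right.
elim: S xS {fg} => // s S IH; rewrite in_cons big_cons le_max.
by move=> /predU1P[->|/IH ->]; rewrite ?lexx ?orbT.
Qed.

Section Weighted.
Variables (D : set R) (w : R -> R).
Hypotheses (mD : measurable D) (iw : mu.-integrable D (EFin \o w)).

Let mw : measurable_fun D w.
Proof. by apply/measurable_EFinP; exact: (measurable_int mu). Qed.

Definition Iw (f : R -> R) : R := Rintegral mu D (fun x => f x * w x).

Lemma bmr_int f : bmr D f -> mu.-integrable D (EFin \o (fun x => f x * w x)).
Proof.
move=> [mf [M Mf]].
apply: (@le_integrable _ _ _ mu D mD (EFin \o (fun x => f x * w x)) (EFin \o (fun x => M * w x))).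
- by apply/measurable_EFinP; exact: measurable_funM.
- move=> x Dx /=; rewrite lee_fin !normrM ler_wpM2r//.
  by rewrite (le_trans (Mf _ Dx))// ler_norm.
- rewrite (_ : EFin \o _ = (fun x => M%:E * (EFin \o w) x)%E); last first.
    by apply/funext => x /=; rewrite EFinM.
  exact: integrableZl.
Qed.

Lemma IwD f g : bmr D f -> bmr D g -> Iw (fun x => f x + g x) = Iw f + Iw g.
Proof.
move=> bf bg; rewrite /Iw -RintegralD//; [|exact: bmr_int|exact: bmr_int].
by apply: eq_Rintegral => x _; rewrite mulrDl.
Qed.

Lemma IwZ c f : bmr D f -> Iw (fun x => c * f x) = c * Iw f.
Proof.
move=> bf; rewrite /Iw -RintegralZl//; last exact: bmr_int.
by apply: eq_Rintegral => x _; rewrite mulrA.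
Qed.

Lemma IwB f g : bmr D f -> bmr D g -> Iw (fun x => f x - g x) = Iw f - Iw g.
Proof.
move=> bf bg; rewrite /Iw -RintegralB//; [|exact: bmr_int|exact: bmr_int].
by apply: eq_Rintegral => x _; rewrite mulrBl.
Qed.

(** Dominated convergence with majorant [|M * w|]. Measurability and boundedness of the limit belong
    to the conclusion, since limits such as derivatives or [1/E] are not known to be measurable
    beforehand. *)
Lemma Iw_lim (S : seq R) (M : R) (f_ : nat -> R -> R) (f : R -> R) :
  (forall n, bmr D (f_ n)) ->
  (forall n x, D x -> `|f_ n x| <= M) ->
  (forall x, D x -> x \notin S -> f_ ^~ x @ \oo --> f x) ->
  bmr D f /\ (fun n => Iw (f_ n)) @ \oo --> Iw f.
Proof.
move=> bf Mf cf.
have mset : measurable [set` S].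
  by apply: countable_measurable => //; exact: countable_seq.
have mDS : measurable (D `\` [set` S]) by exact: measurableD.
pose f' x := if x \in S then 0 else f x.
pose f'_ n x := if x \in S then 0 else f_ n x.
have b'_ n : bmr D (f'_ n).
  by apply: (bmr_off (S := S) mD _ (bf n)) => x _ /negPf xS; rewrite /f'_ xS.
have cf' x : D x -> f'_ ^~ x @ \oo --> f' x.
  rewrite /f'_ /f' => Dx; case: ifPn => xS; first exact: cvg_cst.
  exact: cf.
have bf' : bmr D f'.
  split; first by apply: (measurable_fun_cvg _ cf') => n; have [] := b'_ n.
  exists `|M| => x Dx; rewrite /f'; case: ifPn => xS; first by rewrite normr0.
  have cn : (fun n => `|f_ n x|) @ \oo --> `|f x| by apply: cvg_norm; exact: cf.
  rewrite -(cvg_lim _ cn)//; apply: limr_le; first by apply/cvg_ex; eexists; exact: cn.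
  by apply: nearW => n; rewrite (le_trans (Mf n x Dx))// ler_norm.
have bff : bmr D f.
  by apply: (bmr_off (S := S) mD _ bf') => x _ /negPf xS; rewrite /f' xS.
split=> //.
have [] := @dominated_convergence _ _ _ mu D mD (fun n => EFin \o (fun x => f_ n x * w x))
   (EFin \o (fun x => f x * w x)) (EFin \o (fun x => `|M * w x|)).
- by move=> n; have /integrableP[] := bmr_int (bf n).
- by have /integrableP[] := bmr_int bff.
- have S0 : mu [set` S] = 0%E.
    by apply: countable_lebesgue_measure0; exact: countable_seq.
  exists [set` S]; split => // x /= /not_implyP[Dx nc].
  apply: contrapT => /negP xS; apply: nc.
  apply/fine_cvgP; split; first by apply: nearW => n.
  by apply: cvgM; [exact: cf|exact: cvg_cst].
- have := @bmr_int (fun=> M) (bmr_cst _ _) => /integrable_abse; exact.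
- apply: aeW => x n Dx /=; rewrite lee_fin !normrM ler_wpM2r//.
  by rewrite (le_trans (Mf n x Dx))// ler_norm.
move=> intf _.
have {intf} fin : (\int[mu]_(x in D) (f x * w x)%:E)%E \is a fin_num.
  by apply: integrable_fin_num intf.
rewrite -(fineK fin).
by move=> /fine_cvgP[_].
Qed.

Lemma Iw_off (S : seq R) f g : bmr D g ->
  (forall x, D x -> x \notin S -> f x = g x) -> Iw f = Iw g.
Proof.
move=> bg fg.
have [|||_] := @Iw_lim S (xget 0 [set M | forall x, D x -> `|g x| <= M]) (fun=> g) f.
- by [].
- move=> _ x Dx; have [_ [M gM]] := bg.
  by case: xgetP => [N -> /(_ x Dx)//|/(_ M)/(_ gM)].
- by move=> x Dx xS; rewrite fg//; exact: cvg_cst.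
by move/(cvg_unique _ (cvg_cst (Iw g))) => ->.
Qed.

End Weighted.

(** * Complex-valued functions, through real and imaginary parts *)

Local Notation normc := Normc.normc.

Lemma normcE (z : C) : `|z| = (normc z)%:C.
Proof. by []. Qed.

Lemma ReM (x y : C) :
  complex.Re (x * y) = complex.Re x * complex.Re y - complex.Im x * complex.Im y.
Proof. by case: x => a b; case: y. Qed.

Lemma ImM (x y : C) :
  complex.Im (x * y) = complex.Re x * complex.Im y + complex.Im x * complex.Re y.
Proof. by case: x => a b; case: y. Qed.

Lemma ReD (x y : C) : complex.Re (x + y) = complex.Re x + complex.Re y.
Proof. by case: x => a b; case: y. Qed.

Lemma ImD (x y : C) : complex.Im (x + y) = complex.Im x + complex.Im y.
Proof. by case: x => a b; case: y. Qed.

Lemma ReN (x : C) : complex.Re (- x) = - complex.Re x.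
Proof. by case: x. Qed.

Lemma ImN (x : C) : complex.Im (- x) = - complex.Im x.
Proof. by case: x. Qed.

Lemma normc_ge0 (z : C) : 0 <= normc z.
Proof. by case: z => a b /=; exact: sqrtr_ge0. Qed.

Lemma normcD (x y : C) : normc (x + y) <= normc x + normc y.
Proof. exact: le_normcD. Qed.

Lemma normcB (x y : C) : normc (x - y) <= normc x + normc y.
Proof. by rewrite -(normcN y); exact: normcD. Qed.

Lemma normc_Re (z : C) : `|complex.Re z| <= normc z.
Proof.
by case: z => a b /=; rewrite -sqrtr_sqr ler_wsqrtr// lerDl sqr_ge0.
Qed.

Lemma normc_Im (z : C) : `|complex.Im z| <= normc z.
Proof. by case: z => a b /=; rewrite -sqrtr_sqr ler_wsqrtr// lerDr sqr_ge0. Qed.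

Lemma normc_le (z : C) : normc z <= `|complex.Re z| + `|complex.Im z|.
Proof.
case: z => a b /=; rewrite -[leRHS]ger0_norm ?addr_ge0// -sqrtr_sqr ler_wsqrtr//.
by rewrite sqrrD !real_normK ?num_real// lerD2r lerDl mulrn_wge0// mulr_ge0.
Qed.

Lemma normcR (x : R) : normc x%:C = `|x|.
Proof. by rewrite /normc /= expr0n addr0 sqrtr_sqr. Qed.

Lemma normc_eq0 (z : C) : (normc z == 0) = (z == 0).
Proof. by apply/eqP/eqP => [/Normc.eq0_normc//|->]; rewrite Normc.normc0. Qed.

Lemma normc_gt0 (z : C) : (0 < normc z) = (z != 0).
Proof. by rewrite lt_def normc_ge0 andbT normc_eq0. Qed.

Lemma normcX (z : C) n : normc (z ^+ n) = normc z ^+ n.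
Proof. by elim: n => [|n IH]; rewrite ?expr0 ?Normc.normc1// !exprS Normc.normcM IH. Qed.

Lemma bmcP D (f : R -> C) : measurable_fun D (fun x => complex.Re (f x)) ->
  measurable_fun D (fun x => complex.Im (f x)) ->
  (exists M : R, forall x, D x -> normc (f x) <= M) -> bmc D f.
Proof.
move=> m1 m2 [M hM]; split; split=> //; exists M => x Dx;
  by rewrite (le_trans _ (hM x Dx))// (normc_Re, normc_Im).
Qed.

Lemma bmc_bound D (f : R -> C) : bmc D f -> exists M : R, forall x, D x -> normc (f x) <= M.
Proof.
move=> [[_ [M hM]] [_ [N hN]]]; exists (M + N) => x Dx.
by rewrite (le_trans (normc_le _))// lerD ?hM ?hN.
Qed.

Lemma bmc_cst D (c : C) : bmc D (fun=> c).
Proof. by split; exact: bmr_cst. Qed.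

Lemma bmc_real D f : bmr D f -> bmc D (fun x => (f x)%:C).
Proof. by move=> bf; split => //; exact: bmr_cst. Qed.

Lemma eq_bmc D (f g : R -> C) : (forall x, D x -> f x = g x) -> bmc D f -> bmc D g.
Proof. by move=> fg [bf1 bf2]; split; [apply: eq_bmr bf1|apply: eq_bmr bf2] => x Dx; rewrite fg. Qed.

Lemma bmcD D (f g : R -> C) : bmc D f -> bmc D g -> bmc D (fun x => f x + g x).
Proof.
move=> [f1 f2] [g1 g2]; split.
  by apply: (eq_bmr _ (bmrD f1 g1)) => x _; rewrite ReD.
by apply: (eq_bmr _ (bmrD f2 g2)) => x _; rewrite ImD.
Qed.

Lemma bmcM D (f g : R -> C) : bmc D f -> bmc D g -> bmc D (fun x => f x * g x).
Proof.
move=> [f1 f2] [g1 g2]; split.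
  by apply: (eq_bmr _ (bmrB (bmrM f1 g1) (bmrM f2 g2))) => x _; rewrite ReM.
by apply: (eq_bmr _ (bmrD (bmrM f1 g2) (bmrM f2 g1))) => x _; rewrite ImM.
Qed.

Lemma bmcN D (f : R -> C) : bmc D f -> bmc D (fun x => - f x).
Proof.
move=> [f1 f2]; split.
  by apply: (eq_bmr _ (bmrN f1)) => x _; rewrite ReN.
by apply: (eq_bmr _ (bmrN f2)) => x _; rewrite ImN.
Qed.

Lemma bmcB D (f g : R -> C) : bmc D f -> bmc D g -> bmc D (fun x => f x - g x).
Proof. by move=> bf bg; apply: bmcD => //; exact: bmcN. Qed.

Lemma bmcX D (f : R -> C) n : bmc D f -> bmc D (fun x => f x ^+ n).
Proof.
move=> bf; elim: n => [|n IH]; first exact: bmc_cst.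
by apply: (eq_bmc _ (bmcM bf IH)) => x _; rewrite exprS.
Qed.

Lemma bmc_sum D (I : Type) (r : seq I) (P : pred I) (F : I -> R -> C) :
  (forall i, P i -> bmc D (F i)) -> bmc D (fun x => \sum_(i <- r | P i) F i x).
Proof.
move=> bF; elim: r => [|i r IH].
  by apply: eq_bmc (bmc_cst D 0) => x _; rewrite big_nil.
have [Pi|nPi] := boolP (P i).
  by apply: eq_bmc (bmcD (bF i Pi) IH) => x _; rewrite big_cons Pi.
by apply: eq_bmc IH => x _; rewrite big_cons (negPf nPi).
Qed.

Definition ccvg (u : nat -> C) (l : C) :=
  (fun n => complex.Re (u n)) @ \oo --> complex.Re l /\ (fun n => complex.Im (u n)) @ \oo --> complex.Im l.

Lemma ccvg_cst (c : C) : ccvg (fun=> c) c.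
Proof. by split; exact: cvg_cst. Qed.

Lemma ccvgD u v l m : ccvg u l -> ccvg v m -> ccvg (fun n => u n + v n) (l + m).
Proof.
move=> [u1 u2] [v1 v2]; split.
  by rewrite ReD; under eq_fun do rewrite ReD; exact: cvgD.
by rewrite ImD; under eq_fun do rewrite ImD; exact: cvgD.
Qed.

Lemma ccvgM u v l m : ccvg u l -> ccvg v m -> ccvg (fun n => u n * v n) (l * m).
Proof.
move=> [u1 u2] [v1 v2]; split.
  by rewrite ReM; under eq_fun do rewrite ReM; apply: cvgB; exact: cvgM.
by rewrite ImM; under eq_fun do rewrite ImM; apply: cvgD; exact: cvgM.
Qed.

Lemma eq_ccvg u v l : u =1 v -> ccvg u l -> ccvg v l.
Proof. by move=> /funext ->. Qed.

Lemma ccvgN u l : ccvg u l -> ccvg (fun n => - u n) (- l).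
Proof.
move=> cu; apply: (eq_ccvg (u := fun n => -1 * u n)) => [n|]; first by rewrite mulN1r.
by rewrite -(mulN1r l); exact: (ccvgM (ccvg_cst (-1)) cu).
Qed.

Lemma ccvgB u v l m : ccvg u l -> ccvg v m -> ccvg (fun n => u n - v n) (l - m).
Proof. by move=> cu cv; apply: ccvgD => //; exact: ccvgN. Qed.

Lemma ccvg_sum (I : Type) (r : seq I) (P : pred I) (F : I -> nat -> C) (l : I -> C) :
  (forall i, P i -> ccvg (F i) (l i)) ->
  ccvg (fun n => \sum_(i <- r | P i) F i n) (\sum_(i <- r | P i) l i).
Proof.
move=> cF; elim: r => [|i r IH].
  by rewrite big_nil; under eq_fun do rewrite big_nil; exact: ccvg_cst.
rewrite big_cons; under eq_fun do rewrite big_cons.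
by have [Pi|nPi] := boolP (P i); rewrite ?Pi ?(negPf nPi)//; apply: ccvgD => //; exact: cF.
Qed.

Lemma ccvg_prod (I : Type) (r : seq I) (P : pred I) (F : I -> nat -> C) (l : I -> C) :
  (forall i, P i -> ccvg (F i) (l i)) ->
  ccvg (fun n => \prod_(i <- r | P i) F i n) (\prod_(i <- r | P i) l i).
Proof.
move=> cF; elim: r => [|i r IH].
  by rewrite big_nil; under eq_fun do rewrite big_nil; exact: ccvg_cst.
rewrite big_cons; under eq_fun do rewrite big_cons.
by have [Pi|nPi] := boolP (P i); rewrite ?Pi ?(negPf nPi)//; apply: ccvgM => //; exact: cF.
Qed.

Lemma ccvg_unique u l m : ccvg u l -> ccvg u m -> l = m.
Proof.
case: l m => [l1 l2] [m1 m2] [/= u1 u2] [/= v1 v2].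
by rewrite (cvg_unique _ u1 v1)// (cvg_unique _ u2 v2).
Qed.

Lemma ccvgR (u : nat -> R) (l : R) : u @ \oo --> l -> ccvg (fun n => (u n)%:C) l%:C.
Proof. by move=> cu; split => //=; exact: cvg_cst. Qed.

Lemma ccvg_shift u l N : ccvg (fun n => u (n + N)%N) l <-> ccvg u l.
Proof.
split=> -[u1 u2]; split.
- by rewrite -(cvg_shiftn N).
- by rewrite -(cvg_shiftn N).
- by rewrite (cvg_shiftn N (fun n => complex.Re (u n))).
- by rewrite (cvg_shiftn N (fun n => complex.Im (u n))).
Qed.

Lemma ccvg_norm u l : ccvg u l -> (fun n => normc (u n)) @ \oo --> normc l.
Proof.
move=> [u1 u2].
have -> : (fun n => normc (u n)) =
    Num.sqrt \o (fun n => complex.Re (u n) ^+ 2 + complex.Im (u n) ^+ 2).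
  by apply/funext => n /=; case: (u n).
rewrite (_ : normc l = Num.sqrt (complex.Re l ^+ 2 + complex.Im l ^+ 2)); last by case: (l).
have h : (fun n => complex.Re (u n) ^+ 2 + complex.Im (u n) ^+ 2) @ \oo -->
    complex.Re l ^+ 2 + complex.Im l ^+ 2.
  by apply: cvgD; rewrite expr2; under eq_fun do rewrite expr2; exact: cvgM.
exact: cvg_comp h (@sqrt_continuous R _).
Qed.

Lemma ccvg_bound u l M : ccvg u l -> (forall n, normc (u n) <= M) -> normc l <= M.
Proof.
move=> /ccvg_norm cu hM; rewrite -(cvg_lim _ cu)//; apply: limr_le.
  by apply/cvg_ex; eexists; exact: cu.
exact: nearW.
Qed.

Section WeightedComplex.
Variables (D : set R) (w : R -> R).
Hypotheses (mD : measurable D) (iw : mu.-integrable D (EFin \o w)).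

Definition Cw (f : R -> C) : C := cint D (fun x => f x * (w x)%:C).

Lemma CwE f : Cw f = Iw D w (fun x => complex.Re (f x)) +i* Iw D w (fun x => complex.Im (f x)).
Proof.
rewrite /Cw /cint /Iw; congr (_ +i* _); apply: eq_Rintegral => x _.
  by rewrite ReM/= mulr0 subr0.
by rewrite ImM/= mulr0 add0r.
Qed.

Lemma CwD f g : bmc D f -> bmc D g -> Cw (fun x => f x + g x) = Cw f + Cw g.
Proof.
move=> [f1 f2] [g1 g2]; rewrite !CwE; simpc; congr (_ +i* _).
  by rewrite -IwD//; congr Iw; apply/funext => x; rewrite ReD.
by rewrite -IwD//; congr Iw; apply/funext => x; rewrite ImD.
Qed.

Lemma CwZ c f : bmc D f -> Cw (fun x => c * f x) = c * Cw f.
Proof.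
case: c => a b [f1 f2]; rewrite !CwE; simpc; congr (_ +i* _).
  rewrite -!IwZ// -IwB//; [|exact: bmrM (bmr_cst _ _) f1|exact: bmrM (bmr_cst _ _) f2].
  by congr Iw; apply/funext => x; rewrite ReM.
rewrite -!IwZ// -IwD//; [|exact: bmrM (bmr_cst _ _) f2|exact: bmrM (bmr_cst _ _) f1].
by congr Iw; apply/funext => x; rewrite ImM.
Qed.

Lemma CwN f : bmc D f -> Cw (fun x => - f x) = - Cw f.
Proof.
move=> bf; rewrite -mulN1r -CwZ//; congr Cw; apply/funext => x.
by rewrite mulN1r.
Qed.

Lemma CwB f g : bmc D f -> bmc D g -> Cw (fun x => f x - g x) = Cw f - Cw g.
Proof. by move=> bf bg; rewrite CwD ?CwN//; exact: bmcN. Qed.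

Lemma Cw_sum (I : Type) (r : seq I) (P : pred I) (F : I -> R -> C) :
  (forall i, P i -> bmc D (F i)) ->
  Cw (fun x => \sum_(i <- r | P i) F i x) = \sum_(i <- r | P i) Cw (F i).
Proof.
move=> bF; elim: r => [|i r IH].
  rewrite big_nil (_ : (fun x => _) = (fun x => 0 * 0)); last first.
    by apply/funext => x; rewrite big_nil mul0r.
  by rewrite CwZ ?mul0r//; exact: bmc_cst.
have bs := bmc_sum r bF.
rewrite big_cons; under eq_fun do rewrite big_cons.
by have [Pi|nPi] := boolP (P i); rewrite ?Pi ?(negPf nPi)// CwD ?IH//; exact: bF.
Qed.

Lemma Cw_off (S : seq R) f g : bmc D g ->
  (forall x, D x -> x \notin S -> f x = g x) -> Cw f = Cw g.
Proof.
move=> [g1 g2] fg; rewrite !CwE; congr (_ +i* _).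
  by apply: (Iw_off mD iw (S := S)) => // x Dx xS; rewrite fg.
by apply: (Iw_off mD iw (S := S)) => // x Dx xS; rewrite fg.
Qed.

Lemma Cw_lim (S : seq R) (M : R) (f_ : nat -> R -> C) (f : R -> C) :
  (forall n, bmc D (f_ n)) ->
  (forall n x, D x -> normc (f_ n x) <= M) ->
  (forall x, D x -> x \notin S -> ccvg (f_ ^~ x) (f x)) ->
  bmc D f /\ ccvg (fun n => Cw (f_ n)) (Cw f).
Proof.
move=> bf Mf cf.
have [|||b1 c1] := @Iw_lim D w mD iw S M (fun n x => complex.Re (f_ n x)) (fun x => complex.Re (f x)).
- by move=> n; have [] := bf n.
- by move=> n x Dx; rewrite (le_trans _ (Mf n x Dx))// normc_Re.
- by move=> x Dx xS; have [] := cf x Dx xS.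
have [|||b2 c2] := @Iw_lim D w mD iw S M (fun n x => complex.Im (f_ n x)) (fun x => complex.Im (f x)).
- by move=> n; have [] := bf n.
- by move=> n x Dx; rewrite (le_trans _ (Mf n x Dx))// normc_Im.
- by move=> x Dx xS; have [] := cf x Dx xS.
split=> //; rewrite /ccvg.
by split; [under eq_fun do rewrite CwE|under eq_fun do rewrite CwE]; rewrite CwE.
Qed.

Lemma Cw_bound f M : bmc D f -> (forall x, D x -> normc (f x) <= M) ->
  normc (Cw f) <= 2 * M * Rintegral mu D (fun x => `|w x|).
Proof.
move=> [f1 f2] hM; rewrite CwE (le_trans (normc_le _))//=.
rewrite (_ : 2 * M * _ = Rintegral mu D (fun x => `|w x|) * M + Rintegral mu D (fun x => `|w x|) * M); last by ring.
have H (h : R -> R) : bmr D h -> (forall x, D x -> `|h x| <= M) ->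
    `|Iw D w h| <= Rintegral mu D (fun x => `|w x|) * M.
  move=> bh hh; rewrite (le_trans (le_normr_Rintegral _ _))//; first exact: bmr_int.
  have iaw : mu.-integrable D (EFin \o (fun x => `|w x|)).
    by have /integrable_abse := iw.
  rewrite -RintegralZr//; apply: le_Rintegral => //.
  - by have /integrable_abse := bmr_int mD iw bh.
  - rewrite (_ : EFin \o _ = (fun x => (`|w x|)%:E * M%:E)%E).
      exact: integrableZr.
    by apply/funext => x /=; rewrite EFinM.
  - by move=> x Dx; rewrite normrM mulrC ler_wpM2l ?hh.
by apply: lerD; apply: H => // x Dx; rewrite (le_trans _ (hM x Dx))// (normc_Re, normc_Im).
Qed.

End WeightedComplex.
End BoundedMeasurable.

(** * The fundamental theorem of calculus on [0, 1] *)

Section FTC.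
Variable R : realType.
Local Notation mu := (@lebesgue_measure R).

Let h_ (n : nat) : R := n.+1%:R^-1.

Let h_gt0 n : 0 < h_ n. Proof. by rewrite invr_gt0. Qed.

Let h_le1 n : h_ n <= 1. Proof. by rewrite invf_le1// ler1n. Qed.

Let h_cvg : h_ @ \oo --> 0^'.
Proof.
move=> A /= A0; have : h_ @ \oo --> (0 : R) by exact: cvg_harmonic.
move/(_ _ A0) => [N _ NA]; exists N => // n Nn; apply: (NA n Nn).
by rewrite gt_eqF.
Qed.

Lemma is_derive_seq (f : R -> R) (a d : R) : is_derive a 1 f d ->
  (fun n => (h_ n)^-1 * (f (a + h_ n) - f a)) @ \oo --> d.
Proof.
move=> [df <-].
have := cvg_comp _ _ h_cvg df.
rewrite (_ : _ \o h_ = (fun n => (h_ n)^-1 * (f (a + h_ n) - f a)))//.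
by apply/funext => n /=; rewrite [_%:A]mulr1 [_ + a]addrC.
Qed.

(** Mean value inequality with finitely many exceptions: an exceptional point inside the interval
    splits it, and the two bounds add up. *)
Lemma lipschitz_off (S : seq R) (f df : R -> R) (M a b : R) : a <= b ->
  {within `[a, b], continuous f} ->
  (forall t, a < t < b -> t \notin S -> is_derive t 1 f (df t)) ->
  (forall t, a < t < b -> t \notin S -> `|df t| <= M) ->
  `|f b - f a| <= M * (b - a).
Proof.
elim: S a b => [|c S IH] a b.
  rewrite le_eqVlt => /predU1P[->|ab] cf df' hM; first by rewrite !subrr normr0 mulr0.
  have [c cab ->] : exists2 c, c \in `]a, b[%R & f b - f a = df c * (b - a).
    by apply: MVT ab _ cf => x; rewrite in_itv/= => xab; exact: df'.
  rewrite normrM (gtr0_norm (x := b - a)) ?subr_gt0// ler_wpM2r//; first by rewrite subr_ge0 ltW.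
  move: cab; rewrite in_itv/= => cab.
  exact: hM.
move=> ab cf df' hM.
have [/andP[ac cb]|ncab] := boolP (a < c < b); last first.
  apply: IH => // t tab tS; [apply: df' => //|apply: hM => //]; rewrite in_cons negb_or tS andbT;
    by apply: contra ncab => /eqP <-.
rewrite -(subrKA (f c)) (le_trans (ler_normD _ _))//.
rewrite [X in _ <= X](_ : _ = M * (b - c) + M * (c - a)); last by ring.
apply: lerD; apply: IH; rewrite ?ltW//.
- by apply: continuous_subspaceW cf => x /=; rewrite !in_itv/= => /andP[? ?]; lra.
- move=> t /andP[ct tb] tS; apply: df'; first by rewrite (lt_trans ac).
  by rewrite in_cons negb_or tS gt_eqF.
- move=> t /andP[ct tb] tS; apply: hM; first by rewrite (lt_trans ac).
  by rewrite in_cons negb_or tS gt_eqF.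
- by apply: continuous_subspaceW cf => x /=; rewrite !in_itv/= => /andP[? ?]; lra.
- move=> t /andP[ct tb] tS; apply: df'; first by rewrite ct (lt_trans _ cb).
  by rewrite in_cons negb_or tS lt_eqF.
- move=> t /andP[ct tb] tS; apply: hM; first by rewrite ct (lt_trans _ cb).
  by rewrite in_cons negb_or tS lt_eqF.
Qed.

(** Composition with [clamp] extends a function on [[0, 1]] by its end values, so that shifts
    [t + h] keep a meaning and continuity on [[0, 1]] becomes continuity on the line. *)
Definition clamp (t : R) : R := Num.min (Num.max t 0) 1.

Lemma clampP t : 0 <= clamp t <= 1.
Proof. by rewrite /clamp /Order.max /Order.min; case: (ltP t 0) => ?; case: ltP => ?; lra. Qed.

Lemma clamp_id t : 0 <= t <= 1 -> clamp t = t.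
Proof. by rewrite /clamp /Order.max /Order.min; case: (ltP t 0) => ?; case: ltP => ?; lra. Qed.

Lemma clamp_lip s t : s <= t -> 0 <= clamp t - clamp s <= t - s.
Proof.
by rewrite /clamp /Order.max /Order.min; case: (ltP t 0) => ?; case: (ltP s 0) => ?;
  case: ltP => ?; case: ltP => ?; lra.
Qed.

Lemma clamp_continuous : continuous clamp.
Proof.
move=> t; apply/cvgrPdist_lt => e e0; near=> s.
have : `|t - s| < e by near: s; exact: cvgr_dist_lt.
apply: le_lt_trans; have [st|ts] := leP s t.
  by have /andP[? ?] := clamp_lip st; rewrite !ger0_norm// subr_ge0.
by have /andP[? ?] := clamp_lip (ltW ts); rewrite distrC [leRHS]distrC !ger0_norm// subr_ge0 ltW.
Unshelve. all: by end_near. Qed.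

Lemma continuous_clamp (f : R -> R) : {within `[0, 1], continuous f} ->
  continuous (f \o clamp).
Proof.
move=> cf t.
have ct : (`[0, 1]%classic : set R) (clamp t) by rewrite /= in_itv/= clampP.
apply: (@cvg_comp _ _ _ clamp f (nbhs t) (nbhs (clamp t : subspace `[0, 1]))); last exact: cf.
move=> A nA; move: (nA : nbhs_subspace (clamp t : subspace `[0, 1]) A); rewrite -nbhs_subspace_in//=.
rewrite /within/= => nA'.
have nC : nbhs t (fun s => (`[0, 1]%classic : set R) (clamp s) -> A (clamp s)).
  exact: (clamp_continuous nA').
by apply: filterS nC => s; apply; rewrite /= in_itv/= clampP.
Qed.

(** The difference quotient of a primitive of [psi] is a primitive of the difference quotient of
    [psi]. As [h] tends to 0 the right-hand side tends to [psi 1 - psi 0]. *)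
Lemma integral_shift (psi : R -> R) (h : R) : continuous psi -> 0 < h -> h <= 1 ->
  let Phi (x : R) := Rintegral mu `[-1, x] psi in
  Rintegral mu `[0, 1] (fun t => h^-1 * (psi (t + h) - psi t)) =
  h^-1 * (Phi (1 + h) - Phi 1) - h^-1 * (Phi (0 + h) - Phi 0).
Proof.
move=> cpsi h0 h1 Phi.
(* The bounds -1 and 3 leave room around [[0, 2]], where the points [x] and [x + h] lie. *)
have dPhi (x : R) : -1 < x < 3 -> is_derive x 1 Phi (psi x).
  move=> /andP[x1 x3].
  have [] := @continuous_FTC1_closed _ psi (-1) x 3 x3 _ x1 (cpsi x).
    apply: continuous_compact_integrable; first exact: segment_compact.
    exact: continuous_subspaceT.
  by move=> d1 d2; apply: DeriveDef; [exact: d1|rewrite -derive1E; exact: d2].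
pose F t := h^-1 * (Phi (t + h) - Phi t).
have dF (x : R) : -1 < x < 2 -> is_derive x 1 F (h^-1 * (psi (x + h) - psi x)).
  move=> /andP[x1 x2].
  have d1 := dPhi x; have d2 := dPhi (x + h).
  have {}d1 := d1 ltac:(lra); have {}d2 := d2 ltac:(lra).
  have d3 : is_derive x 1 (fun t => Phi (t + h)) (psi (x + h)).
    have d4 : is_derive x 1 (fun t => t + h) (1 + 0) by exact: is_deriveD.
    have := @is_derive1_comp _ Phi (fun t => t + h) x _ _ d2 d4.
    by rewrite addr0 mulr1.
  rewrite /F.
  have := @is_deriveZ _ _ _ (fun t => Phi (t + h) - Phi t) h^-1 x 1 _ (is_deriveB d3 d1).
  by [].
have cF (x : R) : -1 < x < 2 -> {for x, continuous F}.
  move=> hx; have [dd _] := dF x hx; exact/differentiable_continuous/derivable1_diffP.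
rewrite /Rintegral (@continuous_FTC2 _ (fun t => h^-1 * (psi (t + h) - psi t)) F)//=.
- apply: continuous_subspaceT => x; apply: cvgM; first exact: cvg_cst.
  apply: cvgB; last exact: cpsi.
  apply: (@continuous_comp _ _ _ (fun t => t + h) psi); last exact: cpsi.
  by apply: cvgD; [exact: cvg_id|exact: cvg_cst].
- split.
  + move=> x; rewrite in_itv/= => hx; have [|dd _] := dF x; first lra.
    exact: dd.
  + by apply: cvg_at_right_filter; apply: cF; lra.
  + by apply: cvg_at_left_filter; apply: cF; lra.
- move=> x; rewrite in_itv/= => hx; rewrite derive1E; have [|_ ->//] := dF x; lra.
Qed.

(** The derivative is bounded but perhaps discontinuous, so difference quotients take its place:
    they are bounded by the Lipschitz constant, converge to [df] off finitely many points, and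
    [integral_shift] computes their integrals. *)
Lemma FTC_bounded (S : seq R) (f df : R -> R) (M : R) :
  {within `[0, 1], continuous f} ->
  (forall t, 0 < t < 1 -> t \notin S -> is_derive t 1 f (df t)) ->
  (forall t, 0 < t < 1 -> t \notin S -> `|df t| <= M) ->
  bmr `[0, 1] df /\ Rintegral mu `[0, 1] df = f 1 - f 0.
Proof.
move=> cf fd hM.
pose psi := f \o clamp.
have cpsi : continuous psi by exact: continuous_clamp.
have lip0 s t : s <= t -> `|psi t - psi s| <= `|M| * (t - s).
  move=> st; have /andP[c0 cts] := clamp_lip st.
  have /andP[cs0 cs1] := clampP s; have /andP[ct0 ct1] := clampP t.
  rewrite /psi/= (@le_trans _ _ (`|M| * (clamp t - clamp s)))//; last by rewrite ler_wpM2l.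
  apply: (@lipschitz_off S f df) => //; first by rewrite -subr_ge0.
  - by apply: continuous_subspaceW cf => x /=; rewrite !in_itv/=; lra.
  - by move=> x hx xS; apply: fd => //; lra.
  - by move=> x hx xS; rewrite (le_trans _ (ler_norm M))//; apply: hM => //; lra.
pose dq n t := (h_ n)^-1 * (psi (t + h_ n) - psi t).
have i1 : mu.-integrable (`[0, 1] : set R) (EFin \o (fun=> 1)).
  apply: continuous_compact_integrable; first exact: segment_compact.
  by apply: continuous_subspaceT => x; exact: cvg_cst.
have m01 : measurable (`[0, 1] : set R) by [].
have hle n t : `|dq n t| <= `|M|.
  rewrite /dq normrM gtr0_norm ?invr_gt0// mulrC ler_pdivrMr//.
  have := @lip0 t (t + h_ n); rewrite (_ : t + h_ n - t = h_ n); [by apply; rewrite lerDl ltW|ring].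
have [m|m u _|u|bdf] := @Iw_lim R `[0, 1] (fun=> 1) m01 i1 [:: 0, 1 & S] `|M| dq df.
- split; last by exists `|M| => u _; exact: hle.
  apply: measurable_funTS; apply: continuous_measurable_fun => y.
  apply: cvgM; first exact: cvg_cst.
  apply: cvgB; last exact: cpsi.
  apply: (@continuous_comp _ _ _ (fun t => t + h_ m) psi); last exact: cpsi.
  by apply: cvgD; [exact: cvg_id|exact: cvg_cst].
- exact: hle.
- rewrite /= in_itv/= => /andP[t0 t1]; rewrite !in_cons !negb_or => /and3P[tn0 tn1 tS].
  have t01 : 0 < u < 1 by rewrite !lt_def t0 t1 tn0 eq_sym tn1.
  have dpsi : is_derive u 1 psi (df u).
    apply: (near_eq_is_derive _ (fd u t01 tS)).
    near=> x; rewrite /psi/= clamp_id//.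
    have : x \in `]0, 1[%R by near: x; apply: near_in_itvoo; rewrite in_itv/=.
    by rewrite in_itv/= => /andP[? ?]; rewrite !ltW.
  exact: is_derive_seq dpsi.
have -> : (fun n => Iw `[0, 1] (fun=> 1) (dq n)) =
   (fun n => (h_ n)^-1 * (Rintegral mu `[-1, 1 + h_ n] psi - Rintegral mu `[-1, 1] psi)
     - (h_ n)^-1 * (Rintegral mu `[-1, 0 + h_ n] psi - Rintegral mu `[-1, 0] psi)).
  apply/funext => n; rewrite -integral_shift ?h_gt0 ?h_le1//.
  by rewrite /Iw; apply: eq_Rintegral => x _; rewrite mulr1.
have dPhi (x : R) : -1 < x < 3 -> is_derive x 1 (fun y => Rintegral mu `[-1, y] psi) (psi x).
  move=> /andP[x1 x3].
  have [] := @continuous_FTC1_closed _ psi (-1) x 3 x3 _ x1 (cpsi x).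
    apply: continuous_compact_integrable; first exact: segment_compact.
    exact: continuous_subspaceT.
  by move=> d1 d2; apply: DeriveDef; [exact: d1|rewrite -derive1E; exact: d2].
move=> cv; split=> //.
have d1 := dPhi 1 ltac:(lra); have d0 := dPhi 0 ltac:(lra).
have H := cvg_unique _ cv (cvgB (is_derive_seq d1) (is_derive_seq d0)).
have -> : f 1 - f 0 = psi 1 - psi 0 by rewrite /psi/= !clamp_id//; lra.
rewrite -H; first by rewrite /Iw; apply: eq_Rintegral => x _; rewrite mulr1.
Unshelve. all: by end_near. Qed.

End FTC.

(** * Continuous and differentiable complex functions of a parameter in [[0, 1]] *)

Section Contour.
Variable R : realType.
Local Notation mu := (@lebesgue_measure R).
Local Notation C := R[i].
Local Notation D := (`[0, 1]%classic : set R).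
Local Notation normc := Normc.normc.

Lemma ccvg_squeeze0 (u : nat -> C) (e : nat -> R) : (forall n, normc (u n) <= e n) ->
  e @ \oo --> 0 -> ccvg u 0.
Proof.
move=> ue e0; split.
  apply/norm_cvg0P; apply: (squeeze_cvgr _ (cvg_cst 0) e0); apply: nearW => n.
  by rewrite normr_ge0 (le_trans (normc_Re _)).
apply/norm_cvg0P; apply: (squeeze_cvgr _ (cvg_cst 0) e0); apply: nearW => n.
by rewrite normr_ge0 (le_trans (normc_Im _)).
Qed.

Lemma ccvg_geometric (z : C) : normc z < 1 -> ccvg (fun n => z ^+ n) 0.
Proof.
move=> z1; apply: (@ccvg_squeeze0 _ (fun n => normc z ^+ n)) => [n|]; first by rewrite normcX.
by apply: cvg_expr; rewrite ger0_norm// normc_ge0.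
Qed.

Definition cont01 (G : R -> C) :=
  continuous (fun t => complex.Re (G (clamp t))) /\
  continuous (fun t => complex.Im (G (clamp t))).

Lemma cc_cst c : cont01 (fun=> c).
Proof. by split=> t; exact: cvg_cst. Qed.

Lemma ccD G H : cont01 G -> cont01 H -> cont01 (fun t => G t + H t).
Proof.
move=> [g1 g2] [h1 h2]; split=> t.
  by under eq_fun do rewrite ReD; apply: cvgD; [exact: g1|exact: h1].
by under eq_fun do rewrite ImD; apply: cvgD; [exact: g2|exact: h2].
Qed.

Lemma ccM G H : cont01 G -> cont01 H -> cont01 (fun t => G t * H t).
Proof.
move=> [g1 g2] [h1 h2]; split=> t.
  under eq_fun do rewrite ReM; apply: cvgB; apply: cvgM;
  by [exact: g1|exact: h1|exact: g2|exact: h2].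
under eq_fun do rewrite ImM; apply: cvgD; apply: cvgM;
by [exact: g1|exact: h1|exact: g2|exact: h2].
Qed.

Lemma ccN G : cont01 G -> cont01 (fun t => - G t).
Proof.
move=> [g1 g2]; split=> t.
  by under eq_fun do rewrite ReN; apply: cvgN; exact: g1.
by under eq_fun do rewrite ImN; apply: cvgN; exact: g2.
Qed.

Lemma complex_normc2 (z : C) : normc z ^+ 2 = complex.Re z ^+ 2 + complex.Im z ^+ 2.
Proof. by case: z => a b /=; rewrite sqr_sqrtr// addr_ge0 ?sqr_ge0. Qed.

Lemma ReV (z : C) : complex.Re z^-1 = complex.Re z / (normc z ^+ 2).
Proof. by rewrite complex_normc2; case: z. Qed.

Lemma ImV (z : C) : complex.Im z^-1 = - complex.Im z / (normc z ^+ 2).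
Proof. by rewrite complex_normc2; case: z => a b /=; rewrite mulNr. Qed.

Lemma ccV G : (forall t, 0 <= t <= 1 -> G t != 0) -> cont01 G -> cont01 (fun t => (G t)^-1).
Proof.
move=> G0 [g1 g2].
have n0 t : normc (G (clamp t)) ^+ 2 != 0 by rewrite expf_eq0/= normc_eq0 G0// clampP.
have cn : continuous (fun t => (normc (G (clamp t)) ^+ 2)^-1).
  move=> t; apply: cvgV; first exact: n0.
  under eq_fun do rewrite complex_normc2; rewrite ?complex_normc2.
  by apply: cvgD; rewrite expr2; under eq_fun do rewrite expr2; apply: cvgM; (exact: g1 || exact: g2).
split=> t.
  by under eq_fun do rewrite ReV; rewrite ?ReV; apply: cvgM; [exact: g1|exact: cn].
under eq_fun do rewrite ImV; rewrite ?ImV; apply: cvgM; last exact: cn.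
by apply: cvgN; exact: g2.
Qed.

Lemma ccX G n : cont01 G -> cont01 (fun t => G t ^+ n).
Proof.
move=> cG; elim: n => [|n IH]; first exact: cc_cst.
by under eq_fun do rewrite exprS; exact: ccM.
Qed.

Lemma cc_horner (p : {poly C}) G : cont01 G -> cont01 (fun t => p.[G t]).
Proof.
move=> cG; elim/poly_ind: p => [|p c IH].
  by under eq_fun do rewrite horner0; exact: cc_cst.
under eq_fun do rewrite hornerMXaddC.
by apply: ccD; [exact: ccM|exact: cc_cst].
Qed.

Lemma cc_bmc G : cont01 G -> bmc D G.
Proof.
have H (f : R -> R) : continuous (f \o @clamp R) -> bmr D f.
  move=> cf; apply: (@eq_bmr _ _ (f \o @clamp R)).
    by move=> x /=; rewrite in_itv/= => hx; rewrite clamp_id.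
  split; first by apply: measurable_funTS; exact: continuous_measurable_fun.
  have : compact [set (f \o @clamp R) x | x in `[0, 1]].
    apply: continuous_compact; last exact: segment_compact.
    exact: continuous_subspaceT.
  move/compact_bounded => [M [_ /(_ (`|M| + 1))]] hM.
  exists (`|M| + 1) => x Dx; apply: hM; last by exists x.
  by rewrite ltr_pwDr// ler_norm.
by move=> [g1 g2]; split; exact: H.
Qed.

Definition cder (G : R -> C) (d : C) (t : R) :=
  is_derive t 1 (fun s => complex.Re (G s)) (complex.Re d) /\
  is_derive t 1 (fun s => complex.Im (G s)) (complex.Im d).

Lemma cder_cst c t : cder (fun=> c) 0 t.
Proof. by split; exact: is_derive_cst. Qed.

Lemma cderD G H d e t : cder G d t -> cder H e t -> cder (fun s => G s + H s) (d + e) t.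
Proof.
move=> [g1 g2] [h1 h2]; split.
  by rewrite ReD; under eq_fun do rewrite ReD; exact: is_deriveD.
by rewrite ImD; under eq_fun do rewrite ImD; exact: is_deriveD.
Qed.

Lemma cderM G H d e t : cder G d t -> cder H e t ->
  cder (fun s => G s * H s) (d * H t + G t * e) t.
Proof.
move=> [g1 g2] [h1 h2]; split.
  under eq_fun do rewrite ReM.
  apply: (is_derive_eq (is_deriveB (is_deriveM g1 h1) (is_deriveM g2 h2))).
  by rewrite ReD !ReM /GRing.scale/=; ring.
under eq_fun do rewrite ImM.
apply: (is_derive_eq (is_deriveD (is_deriveM g1 h2) (is_deriveM g2 h1))).
by rewrite ImD !ImM /GRing.scale/=; ring.
Qed.

Lemma cderV G d t : G t != 0 -> cder G d t -> cder (fun s => (G s)^-1) (- d / (G t) ^+ 2) t.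
Proof.
move=> G0 [g1 g2].
have n0 : complex.Re (G t) ^+ 2 + complex.Im (G t) ^+ 2 != 0.
  by rewrite -complex_normc2 expf_eq0/= normc_eq0.
have dn : is_derive t 1 (fun s => (complex.Re (G s) ^+ 2 + complex.Im (G s) ^+ 2)^-1)
  (- (complex.Re (G t) ^+ 2 + complex.Im (G t) ^+ 2) ^- 2 *
   (2 * complex.Re (G t) * complex.Re d + 2 * complex.Im (G t) * complex.Im d)).
  under eq_fun do rewrite !expr2.
  rewrite !expr2 in n0 *.
  have ds : is_derive t 1 (fun s => complex.Re (G s) * complex.Re (G s) + complex.Im (G s) * complex.Im (G s)) _ :=
    is_deriveD (is_deriveM g1 g1) (is_deriveM g2 g2).
  apply: (is_derive_eq (@is_deriveV R _ t _ 1 n0 ds)).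
  by rewrite /GRing.scale/=; ring.
have E1 : complex.Re (G t ^+ 2) = complex.Re (G t) ^+ 2 - complex.Im (G t) ^+ 2.
  by rewrite expr2 ReM.
have E2 : complex.Im (G t ^+ 2) = 2 * complex.Re (G t) * complex.Im (G t).
  by rewrite expr2 ImM; ring.
have E3 : normc (G t ^+ 2) ^+ 2 = (complex.Re (G t) ^+ 2 + complex.Im (G t) ^+ 2) ^+ 2.
  by rewrite normcX complex_normc2.
split.
  under eq_fun do rewrite ReV complex_normc2.
  apply: (is_derive_eq (is_deriveM g1 dn)).
  rewrite ReM ReN ImN ReV ImV E1 E2 E3 /GRing.scale/=.
  by field.
under eq_fun do rewrite ImV complex_normc2.
apply: (is_derive_eq (is_deriveM (is_deriveN g2) dn)).
rewrite ImM ReN ImN ReV ImV E1 E2 E3 /GRing.scale/=.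

by rewrite !fctE; field.
Qed.

Lemma cder_FTC (S : seq R) (G d : R -> C) (M : R) : cont01 G ->
  (forall t, 0 < t < 1 -> t \notin S -> cder G (d t) t) ->
  (forall t, 0 < t < 1 -> t \notin S -> normc (d t) <= M) ->
  bmc D d /\ Cw D (fun=> 1) d = G 1 - G 0.
Proof.
move=> [g1 g2] dG hM.
have W (f : R -> R) : continuous (fun t => f (clamp t)) -> {within D, continuous f}.
  move=> cf; have cf' : {within D, continuous (f \o @clamp R)} by exact: continuous_subspaceT.
  apply: (subspace_eq_continuous _ cf').
  move=> x; rewrite inE /= in_itv/= => hx.
  by rewrite /from_subspace/= clamp_id.
have [||b1 e1] := @FTC_bounded R S (fun s => complex.Re (G s)) (fun s => complex.Re (d s)) M (W _ g1).
- by move=> t t01 tS; have [] := dG t t01 tS.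
- by move=> t t01 tS; rewrite (le_trans (normc_Re _))// hM.
have [||b2 e2] := @FTC_bounded R S (fun s => complex.Im (G s)) (fun s => complex.Im (d s)) M (W _ g2).
- by move=> t t01 tS; have [] := dG t t01 tS.
- by move=> t t01 tS; rewrite (le_trans (normc_Im _))// hM.
split=> //; rewrite CwE /Iw.
under eq_Rintegral do rewrite mulr1; rewrite e1.
under eq_Rintegral do rewrite mulr1; rewrite e2.
by case: (G 1) => x y; case: (G 0).
Qed.

End Contour.

(** * Contour integrals *)

Section Loop.
Variable R : realType.
Local Notation mu := (@lebesgue_measure R).
Local Notation C := R[i].
Local Notation D := (`[0, 1]%classic : set R).
Local Notation normc := Normc.normc.

Variables (gx gy : R -> R).
Hypotheses (cgx : {within `[0, 1], continuous gx}) (cgy : {within `[0, 1], continuous gy}).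
Hypothesis closed_gam : gam gx gy 0 = gam gx gy 1.
Variables (S : seq R) (M : R).
Hypothesis dgxy : forall t : R, 0 < t < 1 -> t \notin S ->
  derivable gx t 1 /\ derivable gy t 1.
Hypothesis bgxy : forall t : R, 0 < t < 1 -> t \notin S ->
  `|gx^`() t| <= M /\ `|gy^`() t| <= M.

Local Notation gm := (gam gx gy).
Local Notation dg := (dgam gx gy).
Local Notation Ci f := (contour_int gx gy f).
Local Notation one := (fun _ : R => 1 : R).

Lemma contourE (f : C -> C) : Ci f = Cw D one (fun t => f (gm t) * dg t).
Proof. by rewrite /contour_int /Cw; congr cint; apply/funext => t; rewrite mulr1. Qed.

Lemma cc_gam : cont01 gm.
Proof. by split; exact: continuous_clamp. Qed.

Lemma cder_gam t : 0 < t < 1 -> t \notin S -> cder gm (dg t) t.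
Proof.
move=> t01 tS; have [d1 d2] := dgxy t01 tS.
by split => /=; rewrite derive1E; apply: DeriveDef; (exact: d1 || exact: d2 || reflexivity).
Qed.

Lemma normc_dgam t : 0 < t < 1 -> t \notin S -> normc (dg t) <= M + M.
Proof.
by move=> t01 tS; have [d1 d2] := bgxy t01 tS; rewrite (le_trans (normc_le _))// lerD.
Qed.

Lemma bmc_dgam : bmc D dg.
Proof. by have [] := cder_FTC cc_gam cder_gam normc_dgam. Qed.

Let m01 : measurable D. Proof. by []. Qed.

Let i1 : mu.-integrable D (EFin \o one).
Proof.
apply: continuous_compact_integrable; first exact: segment_compact.
by apply: continuous_subspaceT => x; exact: cvg_cst.
Qed.

Definition bounded_on_loop (f : C -> C) := bmc D (fun t => f (gm t)).

Lemma cc_bl (f : C -> C) : cont01 (fun t => f (gm t)) -> bounded_on_loop f.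
Proof. exact: cc_bmc. Qed.

Lemma contourD f g : bounded_on_loop f -> bounded_on_loop g -> Ci (fun u => f u + g u) = Ci f + Ci g.
Proof.
move=> bf bg; rewrite !contourE -CwD//; [|exact: bmcM bf bmc_dgam|exact: bmcM bg bmc_dgam].
by congr Cw; apply/funext => t; rewrite mulrDl.
Qed.

Lemma contourZ c f : bounded_on_loop f -> Ci (fun u => c * f u) = c * Ci f.
Proof.
move=> bf; rewrite !contourE -CwZ//; last exact: bmcM bf bmc_dgam.
by congr Cw; apply/funext => t; rewrite mulrA.
Qed.

Lemma contourB f g : bounded_on_loop f -> bounded_on_loop g -> Ci (fun u => f u - g u) = Ci f - Ci g.
Proof.
move=> bf bg; rewrite !contourE -CwB//; [|exact: bmcM bf bmc_dgam|exact: bmcM bg bmc_dgam].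
by congr Cw; apply/funext => t; rewrite mulrBl.
Qed.

Lemma contour_off (S' : seq R) f g : bounded_on_loop g ->
  (forall t, D t -> t \notin S' -> f (gm t) = g (gm t)) -> Ci f = Ci g.
Proof.
move=> bg fg; rewrite !contourE; apply: (Cw_off m01 i1 (S := S')).
  exact: bmcM bg bmc_dgam.
by move=> t Dt tS; rewrite fg.
Qed.

Lemma contour_eq f g : bounded_on_loop g -> (forall t, D t -> f (gm t) = g (gm t)) -> Ci f = Ci g.
Proof. by move=> bg fg; apply: (contour_off (S' := [::])) => // t Dt _; exact: fg. Qed.

Lemma contour_lim (S' : seq R) (N : R) (f_ : nat -> C -> C) (f : C -> C) :
  (forall n, bounded_on_loop (f_ n)) ->
  (forall n t, D t -> normc (f_ n (gm t)) <= N) ->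
  (forall t, D t -> t \notin S' -> ccvg (fun n => f_ n (gm t)) (f (gm t))) ->
  bounded_on_loop f /\ ccvg (fun n => Ci (f_ n)) (Ci f).
Proof.
move=> bf hN cf.
have [b1 _] := @Cw_lim R D one m01 i1 S' N (fun n t => f_ n (gm t)) (fun t => f (gm t)) bf hN cf.
split=> //; have [K hK] := bmc_bound bmc_dgam.
have [||t Dt tS|_] := @Cw_lim R D one m01 i1 S' (N * K) (fun n t => f_ n (gm t) * dg t) (fun t => f (gm t) * dg t).
- by move=> n; exact: bmcM (bf n) bmc_dgam.
- by move=> n t Dt; rewrite Normc.normcM ler_pM ?normc_ge0// ?hN ?hK.
- by apply: ccvgM; [exact: cf|exact: ccvg_cst].
by rewrite -contourE; apply: eq_ccvg => n; rewrite contourE.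
Qed.

Lemma contour_bound : exists2 K : R, 0 <= K & forall f (N : R), bounded_on_loop f ->
  (forall t, D t -> normc (f (gm t)) <= N) -> normc (Ci f) <= N * K.
Proof.
have [K hK] := bmc_bound bmc_dgam.
exists (2 * `|K| * Rintegral mu D (fun x => `|one x|)).
  by rewrite !mulr_ge0//; apply: Rintegral_ge0.
move=> f N bf hN; rewrite contourE.
apply: (le_trans (@Cw_bound _ _ _ m01 i1 _ (N * `|K|) (bmcM bf bmc_dgam) _)).
  move=> t Dt; rewrite Normc.normcM ler_pM ?normc_ge0// ?hN//.
  by rewrite (le_trans (hK t Dt))// ler_norm.
by rewrite le_eqVlt; apply/orP; left; apply/eqP; ring.
Qed.

Lemma contour_FTC (G : R -> C) (f : C -> C) : cont01 G -> G 0 = G 1 ->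
  bounded_on_loop f ->
  (forall t, 0 < t < 1 -> t \notin S -> cder G (f (gm t) * dg t) t) -> Ci f = 0.
Proof.
move=> cG G01 bf dG; rewrite contourE.
have [N hN] := bmc_bound (bmcM bf bmc_dgam).
have [|_ ->] := @cder_FTC R S G (fun t => f (gm t) * dg t) N cG dG.
  by move=> t /andP[t0 t1] _; apply: hN; rewrite /= in_itv/= !ltW.
by rewrite G01 subrr.
Qed.

Lemma cder_horner (p : {poly C}) t : 0 < t < 1 -> t \notin S ->
  cder (fun s => p.[gm s]) (p^`().[gm t] * dg t) t.
Proof.
move=> t01 tS; elim/poly_ind: p => [|p c IH].
  rewrite deriv0 horner0 mul0r; under eq_fun do rewrite horner0; exact: cder_cst.
under eq_fun do rewrite hornerMXaddC.
rewrite (_ : _ * _ = (p^`().[gm t] * dg t * gm t + p.[gm t] * dg t) + 0).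
  by apply: cderD (cder_cst _ _); apply: cderM IH (cder_gam t01 tS).
rewrite derivD derivM derivX derivC !hornerE; ring.
Qed.

Lemma bl_horner (p : {poly C}) : bounded_on_loop (fun u => p.[u]).
Proof. by apply: cc_bl; exact: cc_horner cc_gam. Qed.

Lemma contour_poly (p : {poly C}) : Ci (fun u => p.[u]) = 0.
Proof.
pose q := \poly_(i < (size p).+1) (p`_i.-1 / i%:R).
have dq : deriv q = p.
  apply/polyP => i; rewrite coef_deriv coef_poly ltnS/=.
  case: ltnP => ip; last by rewrite mul0rn nth_default.
  by rewrite -(mulr_natr (p`_i / i.+1%:R)) -mulrA mulVf ?mulr1// pnatr_eq0.
apply: (contour_FTC (G := fun t => q.[gm t])).
- exact: cc_horner cc_gam.
- by rewrite closed_gam.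
- exact: bl_horner.
- by move=> t t01 tS; rewrite -[p in p.[_]]dq; exact: cder_horner.
Qed.

Definition offloop (w : C) := forall t : R, 0 <= t <= 1 -> gm t != w.

Lemma cc_subV w : offloop w -> cont01 (fun t => (gm t - w)^-1).
Proof.
move=> ow; apply: ccV; first by move=> t t01; rewrite subr_eq0 ow.
by apply: ccD cc_gam _; exact: cc_cst.
Qed.

Lemma bl_subV w : offloop w -> bounded_on_loop (fun u => (u - w)^-1).
Proof. by move=> ow; apply: cc_bl; exact: cc_subV. Qed.

(** From order two on, a pole has a single-valued primitive, a multiple of the next lower power;
    only simple poles see the winding number. *)
Lemma contour_subV_pow w n : offloop w -> Ci (fun u => (u - w)^-1 ^+ n.+2) = 0.
Proof.
move=> ow.
have b k : bounded_on_loop (fun u => (u - w)^-1 ^+ k) by apply: cc_bl; apply: ccX; exact: cc_subV.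
apply: (contour_FTC (G := fun t => - n.+1%:R^-1 * (gm t - w)^-1 ^+ n.+1)).
- by apply: ccM; [exact: cc_cst|apply: ccX; exact: cc_subV].
- by rewrite closed_gam.
- exact: b.
move=> t t01 tS.
have g0 : gm t - w != 0 by rewrite subr_eq0 ow//; have /andP[? ?] := t01; rewrite !ltW.
have d1 : cder (fun s => (gm s - w)^-1) (- dg t * (gm t - w)^-1 ^+ 2) t.
  rewrite exprVn; have /= := @cderV R (fun s => gm s - w) (dg t) t g0; apply.
  by rewrite -[dg t]addr0; apply: cderD (cder_gam t01 tS) (cder_cst _ _).
have dk k : cder (fun s => (gm s - w)^-1 ^+ k) (k%:R * (gm t - w)^-1 ^+ k.+1 * - dg t) t.
  elim: k => [|k IH]; first by rewrite !mul0r; exact: cder_cst.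
  under eq_fun do rewrite exprS.
  rewrite (_ : _ * - _ = (- dg t * (gm t - w)^-1 ^+ 2) * (gm t - w)^-1 ^+ k +
    (gm t - w)^-1 * (k%:R * (gm t - w)^-1 ^+ k.+1 * - dg t)); first exact: cderM d1 IH.
  rewrite -natr1 [in LHS]exprS [in LHS]exprS [in RHS](exprS _ k); ring.
have := cderM (cder_cst (- n.+1%:R^-1) t) (dk n.+1).
rewrite mul0r add0r (_ : _ * (_ * _ * _) = (gm t - w)^-1 ^+ n.+2 * dg t)//.
rewrite mulrN mulrNN mulrA mulrA mulVf ?mul1r// pnatr_eq0//.
Qed.

Definition unwound (w : C) := offloop w /\ winding gx gy w = 0.

Let twopii : (2%:C * pi%:C * 'i)%C != 0 :> C.
Proof. by rewrite !mulf_neq0// ?complexiE ?neq0Ci// eq_complex/= eqxx andbT gt_eqF ?pi_gt0. Qed.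

Lemma wz_contour w : unwound w -> Ci (fun u => (u - w)^-1) = 0.
Proof.
by move=> [_ /eqP]; rewrite /winding mulf_eq0 invr_eq0 (negPf twopii) => /eqP.
Qed.

Lemma cc_prodV (ws : seq C) : (forall w, w \in ws -> offloop w) ->
  cont01 (fun t => (\prod_(w <- ws) (gm t - w))^-1).
Proof.
elim: ws => [|w ws IH] ow.
  by under eq_fun do rewrite big_nil; exact: cc_cst.
under eq_fun do rewrite big_cons invfM.
apply: ccM; first by apply: cc_subV; apply: ow; rewrite in_cons eqxx.
by apply: IH => v vws; apply: ow; rewrite in_cons vws orbT.
Qed.

(** Partial fractions, by induction on the number of poles. Subtracting the value of the numerator
    at a pole cancels that pole and leaves a constant numerator. Two distinct poles are then
    separated, and a single repeated pole is settled by its primitive or its winding number. *)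
Lemma contour_rational (ws : seq C) (p : {poly C}) : (forall w, w \in ws -> unwound w) ->
  Ci (fun u => p.[u] * (\prod_(w <- ws) (u - w))^-1) = 0.
Proof.
have [n] := ubnP (size ws); elim: n ws p => // n IH ws p; rewrite ltnS => sws hw.
have cV (vs : seq C) : (forall w, w \in vs -> unwound w) -> cont01 (fun t => (\prod_(w <- vs) (gm t - w))^-1).
  by move=> hv; apply: cc_prodV => w /hv[].
have bV (vs : seq C) : (forall w, w \in vs -> unwound w) -> bounded_on_loop (fun u => (\prod_(w <- vs) (u - w))^-1).
  by move=> hv; apply: cc_bl; exact: cV.
case: ws sws hw => [|w ws] sws hw.
  rewrite -(contour_poly p); apply: contour_eq; first exact: bl_horner.
  by move=> t _; rewrite big_nil invr1 mulr1.
have hw0 : unwound w by apply: hw; rewrite in_cons eqxx.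
have hws v : v \in ws -> unwound v by move=> vws; apply: hw; rewrite in_cons vws orbT.
have g0 v t : unwound v -> D t -> gm t - v != 0.
  by rewrite /= in_itv/= => -[ov _] t01; rewrite subr_eq0 ov.
have key : Ci (fun u => (\prod_(v <- w :: ws) (u - v))^-1) = 0.
  have [ww|] := boolP (all (pred1 w) ws).
    have -> : (fun u => (\prod_(v <- w :: ws) (u - v))^-1) = (fun u => (u - w)^-1 ^+ (size ws).+1).
      apply/funext => u; rewrite exprVn; congr (_^-1); rewrite big_cons exprS; congr (_ * _).
      move/all_pred1P: ww => ->; rewrite size_nseq; elim: (size ws) => [|k IHk].
        by rewrite big_nil.
      by rewrite big_cons IHk exprS.
    case: (size ws) => [|k]; last by apply: contour_subV_pow; case: hw0.
    exact: (wz_contour hw0).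
  move=> /allPn[v vws /= vw].
  have hv := hws v vws.
  have pw := perm_to_rem vws.
  set vs := rem v ws in pw.
  have hvs x : x \in vs -> unwound x by move=> /mem_rem; exact: hws.
  have svs : size ws = (size vs).+1 by rewrite (perm_size pw).
  have wv0 : w - v != 0 by rewrite subr_eq0 eq_sym.
  have h1 : forall x, x \in w :: vs -> unwound x by move=> x; rewrite in_cons => /predU1P[->|/hvs].
  have h2 : forall x, x \in v :: vs -> unwound x by move=> x; rewrite in_cons => /predU1P[->|/hvs].
  (* [1/((u - w)(u - v)) = (1/(u - w) - 1/(u - v))/(w - v)]: each term has one pole fewer. *)
  transitivity (Ci (fun u => (w - v)^-1 * (1.[u] * (\prod_(x <- w :: vs) (u - x))^-1 -
      1.[u] * (\prod_(x <- v :: vs) (u - x))^-1))).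
    apply: contour_eq.
      apply: cc_bl; apply: ccM; first exact: cc_cst.
      apply: ccD; [|apply: ccN]; (apply: ccM; [exact: cc_horner cc_gam|exact: cV]).
    move=> t Dt; rewrite big_cons (perm_big _ pw)/= !big_cons !hornerC !mul1r !invfM.
    have := g0 w t hw0 Dt; have := g0 v t hv Dt; move: wv0.
    set Y := (\prod_(_ <- _) _)^-1.
    by move=> n1 n2 n3; field; rewrite n1 n2 n3.
  rewrite contourZ.
    rewrite contourB ?IH ?subrr ?mulr0//.
    - by rewrite /= -svs.
    - by rewrite /= -svs.
    - by apply: cc_bl; apply: ccM; [exact: cc_horner cc_gam|exact: cV].
    - by apply: cc_bl; apply: ccM; [exact: cc_horner cc_gam|exact: cV].
  apply: cc_bl; apply: ccD; [|apply: ccN]; (apply: ccM; [exact: cc_horner cc_gam|exact: cV]).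
have [q qE] : exists q, p - p.[w]%:P = q * ('X - w%:P).
  by apply/factor_theorem; rewrite /root !hornerE subrr.
transitivity (Ci (fun u => q.[u] * (\prod_(v <- ws) (u - v))^-1 + p.[w] * (\prod_(v <- w :: ws) (u - v))^-1)).
  apply: contour_eq.
    apply: cc_bl; apply: ccD; apply: ccM; [exact: cc_horner cc_gam|exact: cV|exact: cc_cst|exact: cV].
  move=> t Dt.
  have -> : p.[gm t] = q.[gm t] * (gm t - w) + p.[w].
    by rewrite -[p in LHS](subrK (p.[w]%:P)) qE !hornerE.
  rewrite big_cons !invfM; have := g0 w t hw0 Dt; set Y := (\prod_(_ <- _) _)^-1 => ?.
  by field.
rewrite contourD.
- rewrite contourZ ?key ?mulr0 ?addr0; last exact: bV.
  by apply: IH.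
- by apply: cc_bl; apply: ccM; [exact: cc_horner cc_gam|exact: cV].
- by apply: cc_bl; apply: ccM; [exact: cc_cst|exact: cV].
Qed.

(** For [w] outside a disc containing the loop, [1/(u - w)] is a polynomial [p K] plus the remainder
    [f K] of the geometric expansion about [c]. The polynomial integrates to 0 and the remainder
    tends to 0 boundedly. *)
Lemma winding_far (c w : C) (rho : R) : (forall t, 0 <= t <= 1 -> normc (gm t - c) <= rho) ->
  rho < normc (w - c) -> unwound w.
Proof.
move=> hg hw.
have ow : offloop w.
  by move=> t t01; apply: contraTneq hw => <-; rewrite -leNgt hg.
split=> //.
have w0 : w - c != 0.
  apply: contraTneq hw => ->; rewrite Normc.normc0 -leNgt.
  by rewrite (le_trans (normc_ge0 _) (hg 0 _))// lexx ler01.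
suff e : Ci (fun u => (u - w)^-1) = 0 by rewrite /winding e mulr0.
pose p K : {poly C} := \sum_(k < K) (- (w - c)^-1 ^+ k.+1) *: ('X - c%:P) ^+ k.
pose f K u := ((u - c) / (w - c)) ^+ K * (u - w)^-1.
have fK K : Ci (f K) = Ci (fun u => (u - w)^-1).
  rewrite -[RHS]subr0 -(contour_poly (p K)) -contourB; [|exact: bl_subV|exact: bl_horner].
  apply: contour_eq.
    by apply: cc_bl; apply: ccD; [exact: cc_subV|apply: ccN; exact: cc_horner cc_gam].
  move=> t; rewrite /= in_itv/= => t01; rewrite /f.
  have gw : gm t - w != 0 by rewrite subr_eq0 ow.
  elim: K => [|K IHK]; first by rewrite /p big_ord0 horner0 subr0 expr0 mul1r.
  have -> : (p K.+1).[gm t] = (p K).[gm t] - (w - c)^-1 ^+ K.+1 * (gm t - c) ^+ K.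
    by rewrite /p big_ord_recr/= hornerD hornerZ horner_exp !hornerE mulNr.
  rewrite opprD addrA -IHK opprK !exprMn !exprS.
  by field; rewrite gw w0.
have rho0 : 0 <= rho by rewrite (le_trans (normc_ge0 _) (hg 0 _))// lexx ler01.
have [B hB] := bmc_bound (bl_subV ow).
have r1 : rho / normc (w - c) < 1 by rewrite ltr_pdivrMr ?mul1r// normc_gt0.
have nr t : 0 <= t <= 1 -> normc ((gm t - c) / (w - c)) <= rho / normc (w - c).
  by move=> t01; rewrite Normc.normcM Normc.normcV ler_wpM2r ?invr_ge0 ?normc_ge0// hg.
have [n|n t|t|_ lim0] := @contour_lim [::] `|B| f (fun=> 0).
- by apply: cc_bl; apply: ccM; [apply: ccX; apply: ccM (cc_cst _); apply: ccD cc_gam _; exact: cc_cst|exact: cc_subV].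
- move=> Dt; have := Dt; rewrite /= in_itv/= => t01.
  rewrite Normc.normcM normcX -[leRHS]mul1r ler_pM ?exprn_ge0 ?normc_ge0//.
    by rewrite exprn_ile1 ?normc_ge0// (le_trans (nr t t01))// ltW.
  by rewrite (le_trans (hB t Dt))// ler_norm.
- move=> Dt _; rewrite -(mul0r (gm t - w)^-1); apply: ccvgM; last exact: ccvg_cst.
  apply: ccvg_geometric; rewrite (le_lt_trans _ r1)// nr//.
have z0 : Ci (fun=> 0) = 0.
  by rewrite -[RHS](contour_poly 0); congr contour_int; apply/funext => u; rewrite horner0.
rewrite z0 in lim0.
apply: (ccvg_unique _ lim0); apply: (eq_ccvg _ (ccvg_cst _)) => n.
by rewrite fK.
Qed.

End Loop.

(** * The generating function *)

Section Products.
Variable R : realType.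
Local Notation C := R[i].
Local Notation normc := Normc.normc.

Lemma cvg_series_near (u v : nat -> R) N : (forall n, 0 <= u n) -> (forall n, 0 <= v n) ->
  (forall n, (N <= n)%N -> u n <= v n) -> cvgn (series v) -> cvgn (series u).
Proof.
move=> u0 v0 uv cv; pose c n := if (n < N)%N then u n else 0.
have cont01 : cvgn (series c).
  rewrite -(is_cvg_series_restrict N).
  rewrite (_ : [sequence _]_n = (fun=> 0)); first exact: is_cvg_cst.
  apply/funext => n /=; rewrite big_nat_cond big1// => i /andP[/andP[Ni _] _].
  by rewrite /c ltnNge Ni.
have c0 n : 0 <= c n by rewrite /c; case: ifP.
apply: (@series_le_cvg _ u (fun n => v n + c n)) => //.
- by move=> n; rewrite addr_ge0.
- by move=> n; rewrite /c; case: ltnP => nN; rewrite ?addr0 ?lerDr ?uv ?v0//.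
- exact: is_cvg_seriesD.
Qed.

(** [|f i| <= 1 + e i <= exp (e i)]. *)
Lemma normc_prod_le (I : eqType) (r : seq I) (f : I -> C) (e : I -> R) :
  (forall i, i \in r -> normc (f i - 1) <= e i) ->
  normc (\prod_(i <- r) f i) <= expR (\sum_(i <- r) e i).
Proof.
elim: r => [|i r IH] h; first by rewrite !big_nil expR0 Normc.normc1.
rewrite !big_cons Normc.normcM expRD ler_pM ?normc_ge0//; last first.
  by apply: IH => j jr; apply: h; rewrite in_cons jr orbT.
rewrite (le_trans _ (expR_ge1Dx _))// -[f i](subrK 1) addrC (le_trans (normcD _ _))//.
by rewrite Normc.normc1 lerD2l h// in_cons eqxx.
Qed.

Lemma series_le_lim (e : nat -> R) n : (forall i, 0 <= e i) -> cvgn (series e) ->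
  \sum_(0 <= i < n) e i <= limn (series e).
Proof.
move=> e0 ce; apply: (@nondecreasing_cvgn_le _ (series e)) => //.
exact: nondecreasing_series.
Qed.

(** The partial products are bounded by [K], so their increments are at most [K * e n] and sum to an
    absolutely convergent series in each coordinate. This argument allows factors equal to 0. *)
Lemma cprod_cvg (f : nat -> C) : cvgn (series (fun i => normc (f i - 1))) ->
  exists l, ccvg (fun n => \prod_(0 <= i < n) f i) l.
Proof.
move=> ce; set e := (fun i => _) in ce.
have e0 i : 0 <= e i by exact: normc_ge0.
pose K := expR (limn (series e)).
pose P n := \prod_(0 <= i < n) f i.
have PK n : normc (P n) <= K.
  rewrite (le_trans (normc_prod_le (e := e) _))//.
  by rewrite ler_expR series_le_lim.
have dP n : normc (P n.+1 - P n) <= K * e n.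
  rewrite /P big_nat_recr//= -[X in _ - X]mulr1 -mulrBr Normc.normcM.
  by apply: ler_wpM2r; [exact: normc_ge0|exact: PK].
have cK : cvgn (series (fun n => K * e n)) by exact: (is_cvg_seriesZ (k := K) ce).
have key (g : C -> R) : (forall x y, g (x - y) = g x - g y) -> (forall x, `|g x| <= normc x) ->
    exists l : R, (fun n => g (P n)) @ \oo --> l.
  move=> gB gn; pose u n := g (P n).
  have : cvgn (series (telescope u)).
    apply: normed_cvg; apply: (@series_le_cvg _ _ (fun n => K * e n)) => [n|n|n|//].
    - exact: normr_ge0.
    - exact: mulr_ge0 (expR_ge0 _) (e0 n).
    - by rewrite /telescope/= -gB (le_trans (gn _)).
  rewrite telescopeK => /cvg_ex[l hl]; exists (l + u 0%N).
  rewrite (_ : (fun n => g (P n)) = (fun n => [sequence u n - u 0%N]_n n + u 0%N)).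
    exact: cvgD hl (cvg_cst (u 0%N)).
  by apply/funext => n; rewrite /= subrK.
have [l1 c1] := key (@complex.Re R) (fun x y => ltac:(by rewrite ReD ReN)) (@normc_Re R).
have [l2 c2] := key (@complex.Im R) (fun x y => ltac:(by rewrite ImD ImN)) (@normc_Im R).
by exists (l1 +i* l2); split.
Qed.

Lemma climitE (u : nat -> C) l : ccvg u l -> climit u = l.
Proof.
by case: l => x y [/= c1 c2]; rewrite /climit (cvg_lim _ c1)// (cvg_lim _ c2).
Qed.

Lemma cexpD (x y : C) : cexp (x + y) = cexp x * cexp y.
Proof.
case: x => a b; case: y => c d; rewrite /cexp /= expRD cosD sinD; simpc.
by congr (_ +i* _); ring.
Qed.

Lemma cexp0 : cexp (0 : C) = 1.
Proof. by rewrite /cexp /= expR0 cos0 sin0 mul1r. Qed.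

Lemma cexpX (x : C) n : cexp (n%:R * x) = cexp x ^+ n.
Proof.
elim: n => [|n IH]; first by rewrite mul0r cexp0.
by rewrite -natr1 mulrDl mul1r cexpD IH exprSr.
Qed.

Lemma normc_cexp (w : C) : normc (cexp w) = expR (complex.Re w).
Proof.
rewrite /cexp Normc.normcM normcR ger0_norm ?expR_ge0//= cos2Dsin2 sqrtr1 mulr1//.
Qed.

Lemma normc_subX (a b : C) K n : normc a <= K -> normc b <= K ->
  normc (a ^+ n - b ^+ n) <= n%:R * K ^+ n.-1 * normc (a - b).
Proof.
move=> aK bK; have K0 : 0 <= K := le_trans (normc_ge0 _) aK.
elim: n => [|n IH]; first by rewrite subrr Normc.normc0 mul0r mul0r.
have -> : a ^+ n.+1 - b ^+ n.+1 = a * (a ^+ n - b ^+ n) + b ^+ n * (a - b).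
  by rewrite !exprS; ring.
rewrite (le_trans (normcD _ _))// !Normc.normcM normcX.
have -> : n.+1%:R * K ^+ n.+1.-1 * normc (a - b) =
    n%:R * K ^+ n * normc (a - b) + K ^+ n * normc (a - b) by rewrite -natr1/=; ring.
apply: lerD.
  case: n IH => [|n] IH; first by rewrite !expr0 subrr Normc.normc0 mulr0 !mul0r.
  rewrite (le_trans (ler_pM _ _ aK IH)) ?normc_ge0//= exprS.
  by rewrite le_eqVlt; apply/orP; left; apply/eqP; ring.
by rewrite ler_wpM2r ?normc_ge0// lerXn2r// nnegrE normc_ge0.
Qed.

Lemma normc_nat n : normc (n%:R : C) = n%:R.
Proof. by rewrite -(rmorph_nat (real_complex R)) normcR ger0_norm. Qed.

(** Makes the exponential a limit of polynomials, so that [1/E] becomes a limit of rational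
    functions. The derivative of [cexp (t w)] in [t] at 0 shows that [n (cexp (w/n) - 1)] tends to
    [w], and [normc_subX] compares the n-th powers. *)
Lemma cexp_lim (w : C) : ccvg (fun n => (1 + w / n.+1%:R) ^+ n.+1) (cexp w).
Proof.
pose h n : R := n.+1%:R^-1.
have dw : cder (fun t : R => cexp (t%:C * w)) w 0.
  case: w => a b; rewrite /cexp /cder /=.
  have dl (c : R) : is_derive (0 : R) 1 (fun t : R => t * c) c.
    have := is_deriveM (is_derive_id (0 : R) (1 : R)) (is_derive_cst c (0 : R) (1 : R)).
    by rewrite /GRing.scale/= mulr0 add0r mulr1.
  have E1 (s c d : R) : s * c - 0 * d = s * c by ring.
  have E2 (s c d : R) : s * d + 0 * c = s * d by ring.
  have de : is_derive (0 : R) 1 (fun t : R => expR (t * a)) a.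
    have := @is_derive1_comp _ expR (fun t : R => t * a) 0 _ _ (is_derive_expR _) (dl a).
    by rewrite mul0r expR0 mul1r.
  have dc : is_derive (0 : R) 1 (fun t : R => cos (t * b)) 0.
    have := @is_derive1_comp _ cos (fun t : R => t * b) 0 _ _ (is_derive_cos _) (dl b).
    by rewrite mul0r sin0 oppr0 mul0r.
  have ds : is_derive (0 : R) 1 (fun t : R => sin (t * b)) b.
    have := @is_derive1_comp _ sin (fun t : R => t * b) 0 _ _ (is_derive_sin _) (dl b).
    by rewrite mul0r cos0 mul1r.
  split.
    under eq_fun do rewrite !(E1, E2).
    have := is_deriveM de dc.
    by rewrite /GRing.scale/= !mul0r expR0 cos0 mulr0 add0r mul1r.
  under eq_fun do rewrite !(E1, E2).
  have := is_deriveM de ds.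
  by rewrite /GRing.scale/= !mul0r expR0 sin0 mul0r addr0 mul1r.
have lim1 : ccvg (fun n => n.+1%:R * (cexp (w / n.+1%:R) - 1)) w.
  have [d1 d2] := dw.
  have c1 := is_derive_seq d1; have c2 := is_derive_seq d2.
  have E n : n.+1%:R * (cexp (w / n.+1%:R) - 1) =
      (n.+1%:R * (complex.Re (cexp ((0 + h n)%:C * w)) - complex.Re (cexp (0%:C * w)))) +i*
      (n.+1%:R * (complex.Im (cexp ((0 + h n)%:C * w)) - complex.Im (cexp (0%:C * w)))).
    rewrite add0r mul0r cexp0 /h.
    have -> : (n.+1%:R^-1)%:C * w = w / n.+1%:R.
      by rewrite mulrC fmorphV rmorph_nat.
    case: (cexp _) => x y; rewrite -[n.+1%:R in LHS](rmorph_nat (real_complex R)); simpc.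
    by congr (_ +i* _); ring.
  split.
    apply: cvg_trans c1; apply: near_eq_cvg; apply: nearW => n /=.
    by rewrite E /= invrK.
  apply: cvg_trans c2; apply: near_eq_cvg; apply: nearW => n /=.
  by rewrite E /= invrK.
have nw n : normc (w / n.+1%:R) = normc w / n.+1%:R.
  by rewrite Normc.normcM Normc.normcV normc_nat.
have lim0 : ccvg (fun n => cexp w - (1 + w / n.+1%:R) ^+ n.+1) 0.
  (* A common bound of [cexp (w / n.+1)] and [1 + w / n.+1] whose n-th power stays below
     [expR (normc w)]. *)
  pose K n := expR (normc w / n.+1%:R).
  apply: (@ccvg_squeeze0 _ _ (fun n => expR (normc w) * normc (n.+1%:R * (cexp (w / n.+1%:R) - 1) - w))).
    move=> n; have wE : w = n.+1%:R * (w / n.+1%:R) by rewrite mulrC divfK// pnatr_eq0.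
    rewrite {1}wE cexpX.
    have aK : normc (cexp (w / n.+1%:R)) <= K n.
      by rewrite normc_cexp ler_expR (le_trans (ler_norm _))// (le_trans (normc_Re _))// nw.
    have bK : normc (1 + w / n.+1%:R) <= K n.
      by rewrite (le_trans (normcD _ _))// Normc.normc1 nw expR_ge1Dx.
    apply: (le_trans (normc_subX _ aK bK)).
    have Kn : K n ^+ n.+1.-1 <= expR (normc w).
      rewrite /K -expRM_natl ler_expR/= mulrCA ler_piMr ?normc_ge0// ler_pdivrMr// mul1r ler_nat//.
    have -> : n.+1%:R * (cexp (w / n.+1%:R) - 1) - w = n.+1%:R * (cexp (w / n.+1%:R) - (1 + w / n.+1%:R)).
      by rewrite {2}wE; ring.
    rewrite Normc.normcM normc_nat.
    rewrite [leRHS]mulrA; apply: ler_wpM2r; first exact: normc_ge0.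
    by rewrite mulrC; apply: ler_wpM2r.
  rewrite -(mulr0 (expR (normc w))); apply: cvgM; first exact: cvg_cst.
  have := ccvg_norm (ccvgB lim1 (ccvg_cst w)).
  by rewrite subrr Normc.normc0.
have := ccvgB (ccvg_cst (cexp w)) lim0; rewrite subr0; apply: eq_ccvg => n.
by rewrite opprB addrC subrK.
Qed.

End Products.

(** * [E] as a convergent product in [x - 1] *)

Section GeneratingFunction.
Variable R : realType.
Local Notation C := R[i].
Local Notation normc := Normc.normc.
Variables (a b : nat -> R) (g : R).

(* With [x = (z + 1/z)/2], the factor of index [i] is [(1 + p_i (x - 1)) / (1 - q_i (x - 1))]. *)
Definition pcoef (i : nat) : R := b i - b i ^+ 2 / 2.
Definition qcoef (i : nat) : R := a i + a i ^+ 2 / 2.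
Local Notation p i := (pcoef i)%:C.
Local Notation q i := (qcoef i)%:C.

(** Since [(z - 1)(z^-1 - 1) = 2 - (z + z^-1)], numerator and denominator are affine in [u]. *)
Lemma Efac_eq i (z u : C) : z != 0 -> z + z^-1 = 2 * u ->
  Efac (a i) (b i) z = (1 + p i * (u - 1)) / (1 - q i * (u - 1)).
Proof.
move=> z0 zu; have uE : u = (z + z^-1) / 2 by rewrite zu mulrC mulKf// pnatr_eq0.
have h (x : R) : (x / 2)%:C = x%:C / 2 :> C by rewrite rmorphM fmorphV rmorph_nat.
rewrite /Efac /pcoef /qcoef uE !h rmorphB rmorphD/= !h !rmorphXn/=.
have two : (2 : C) != 0 by rewrite pnatr_eq0.
congr (_ / _); field; by rewrite ?z0 ?two.
Qed.

(** Only [s ^+ 2 = u ^+ 2 - 1] is used, hence the branch of the square root is immaterial. *)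
Lemma Ex_eq (u : C) : Ex a b g u = cexp (g%:C * (u - 1)) *
  climit (fun n => \prod_(0 <= i < n) ((1 + p i * (u - 1)) / (1 - q i * (u - 1)))).
Proof.
rewrite /Ex; set s := sqrtC _; have s2 : s ^+ 2 = u ^+ 2 - 1 by exact: sqrtCK.
have zz : (u + s) * (u - s) = 1 by rewrite mulrC -subr_sqr s2; ring.
have z0 : u + s != 0 by apply: contraPneq zz => ->; rewrite mul0r => /eqP; rewrite eq_sym oner_eq0.
have zV : (u + s)^-1 = u - s by apply: (mulfI z0); rewrite mulfV.
have zu : (u + s) + (u + s)^-1 = 2 * u by rewrite zV; ring.
rewrite /Ez zu; congr (_ * _).
  by congr cexp; rewrite rmorphM fmorphV rmorph_nat; field.
congr climit; apply/funext => n; rewrite big_mkord; apply: eq_bigr => i _.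
exact: Efac_eq.
Qed.

Hypothesis ha0 : forall i, 0 <= a i.
Hypothesis ha1 : forall i, a i.+1 <= a i.
Hypothesis ha2 : cvgn (series a).
Hypothesis hb0 : forall i, 0 <= b i.
Hypothesis hb1 : forall i, b i.+1 <= b i.
Hypothesis hb2 : cvgn (series b).
Hypothesis hg : 0 <= g.

Definition scoef (i : nat) : R := `|pcoef i| + `|qcoef i|.

Lemma scoef_ge0 i : 0 <= scoef i. Proof. exact: addr_ge0. Qed.

Lemma qcoef_ge0 i : 0 <= qcoef i.
Proof. by rewrite addr_ge0// mulr_ge0// ?exprn_ge0. Qed.

(** Monotonicity bounds both sequences by their first terms, so the quadratic parts of the
    coefficients are dominated by the linear ones. *)
Lemma cvg_scoef : cvgn (series scoef).
Proof.
have le0 (c : nat -> R) : (forall i, c i.+1 <= c i) -> forall i, c i <= c 0%N.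
  by move=> c1; elim=> // i IH; rewrite (le_trans (c1 i)).
have la := le0 _ ha1; have lb := le0 _ hb1.
apply: (@series_le_cvg _ _ (fun i => (1 + b 0%N) * b i + (1 + a 0%N) * a i)) => [i|i|i|].
- exact: scoef_ge0.
- by rewrite addr_ge0// mulr_ge0// addr_ge0.
- rewrite /scoef lerD//.
    rewrite /pcoef (le_trans (ler_normB _ _))// !ger0_norm ?mulr_ge0 ?exprn_ge0//.
    have := lb i; have := hb0 i; nra.
  rewrite ger0_norm ?qcoef_ge0// /qcoef.
  have := la i; have := ha0 i; nra.
- by apply: is_cvg_seriesD; [exact: (is_cvg_seriesZ (k := 1 + b 0%N) hb2)|exact: (is_cvg_seriesZ (k := 1 + a 0%N) ha2)].
Qed.

Lemma scoef_small (r : R) : 0 < r -> exists N, forall i, (N <= i)%N -> scoef i * r <= 1 / 2.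
Proof.
move=> r0; have /cvgrPdist_le/(_ (1 / 2 / r)) := cvg_series_cvg_0 cvg_scoef.
have -> : 0 < 1 / 2 / r by rewrite divr_gt0.
move=> /(_ isT)[N _ hN]; exists N => i Ni.
have := hN i Ni; rewrite /= sub0r normrN ger0_norm ?scoef_ge0//.
by rewrite ler_pdivlMr.
Qed.

Section Tail.
Variables (r : R) (N : nat).
Hypothesis r0 : 0 < r.
Hypothesis hN : forall i, (N <= i)%N -> scoef i * r <= 1 / 2.

(** From index [N] on, no factor vanishes on the disc of radius [r] about 1, so only the first [N]
    factors can contribute zeros or poles there. *)
Lemma tail_small (c : R) i (v : C) : (N <= i)%N -> `|c| <= scoef i -> normc v <= r ->
  1 / 2 <= normc (1 + c%:C * v).
Proof.
move=> Ni cs vr.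
have : normc (c%:C * v) <= 1 / 2.
  by rewrite Normc.normcM normcR (le_trans (ler_pM _ _ cs vr)) ?normc_ge0// hN.
have := normcB (1 + c%:C * v) (c%:C * v); rewrite addrK Normc.normc1.
by move=> ? ?; lra.
Qed.

Lemma tail_p i v : (N <= i)%N -> normc v <= r -> 1 / 2 <= normc (1 + p i * v).
Proof. by move=> Ni vr; apply: (@tail_small _ i) => //; rewrite lerDl. Qed.

Lemma tail_q i v : (N <= i)%N -> normc v <= r -> 1 / 2 <= normc (1 - q i * v).
Proof.
move=> Ni vr; rewrite -mulNr -rmorphN; apply: (@tail_small _ i) => //.
by rewrite normrN lerDr.
Qed.

Let half_neq0 (x : C) : 1 / 2 <= normc x -> x != 0.
Proof. by move=> h; rewrite -normc_gt0; apply: lt_le_trans h; rewrite divr_gt0. Qed.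

Lemma tail_p0 i v : (N <= i)%N -> normc v <= r -> 1 + p i * v != 0.
Proof. by move=> Ni vr; apply: half_neq0; exact: tail_p. Qed.

Lemma tail_q0 i v : (N <= i)%N -> normc v <= r -> 1 - q i * v != 0.
Proof. by move=> Ni vr; apply: half_neq0; exact: tail_q. Qed.

Lemma tail_num i v : normc v <= r -> normc ((p i + q i) * v) <= scoef i * r.
Proof.
move=> vr; rewrite Normc.normcM ler_pM ?normc_ge0//.
by rewrite (le_trans (normcD _ _))// !normcR.
Qed.

Lemma tail_ratio i v : (N <= i)%N -> normc v <= r ->
  normc ((1 + p i * v) / (1 - q i * v) - 1) <= 2 * r * scoef i.
Proof.
move=> Ni vr; have q0 := tail_q0 Ni vr; have q1 := tail_q Ni vr.
have -> : (1 + p i * v) / (1 - q i * v) - 1 = ((p i + q i) * v) / (1 - q i * v) by field.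
rewrite Normc.normcM Normc.normcV ler_pdivrMr; last by rewrite normc_gt0.
have := tail_num i vr; have := mulr_ge0 (scoef_ge0 i) (ltW r0).
move: (normc _) (normc _) q1 => x y; nra.
Qed.

Lemma tail_ratioV i v : (N <= i)%N -> normc v <= r ->
  normc ((1 - q i * v) / (1 + p i * v) - 1) <= 2 * r * scoef i.
Proof.
move=> Ni vr; have q0 := tail_p0 Ni vr; have q1 := tail_p Ni vr.
have -> : (1 - q i * v) / (1 + p i * v) - 1 = - (((p i + q i) * v) / (1 + p i * v)) by field.
rewrite normcN Normc.normcM Normc.normcV ler_pdivrMr; last by rewrite normc_gt0.
have := tail_num i vr; have := mulr_ge0 (scoef_ge0 i) (ltW r0).
move: (normc _) (normc _) q1 => x y; nra.
Qed.

Lemma cvg_tail : cvgn (series (fun i => 2 * r * scoef i)).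
Proof. exact: (is_cvg_seriesZ (k := 2 * r) cvg_scoef). Qed.

Definition tailK : R := expR (limn (series (fun i => 2 * r * scoef i))).

Lemma tail_prod_le (f : nat -> C) m :
  (forall i, (N <= i)%N -> normc (f i - 1) <= 2 * r * scoef i) ->
  normc (\prod_(N <= i < m) f i) <= tailK.
Proof.
move=> hf; have e0 i : 0 <= 2 * r * scoef i by rewrite !mulr_ge0 ?scoef_ge0// ltW.
rewrite (le_trans (normc_prod_le (e := fun i => 2 * r * scoef i) _))//.
  by move=> i; rewrite mem_index_iota => /andP[Ni _]; exact: hf.
rewrite ler_expR; have [Nm|mN] := leqP N m; last first.
  by rewrite big_geq ?(ltnW mN)// (le_trans _ (series_le_lim 0 e0 cvg_tail))// big_nil.
rewrite (le_trans _ (series_le_lim m e0 cvg_tail))// (@big_cat_nat _ _ _ N 0 m)//= lerDr.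
by apply: sumr_ge0.
Qed.

(** This covers poles too: there, division by zero makes a factor, and hence the limit, equal to
    0. *)
Lemma Ex_cvg (u : C) : normc (u - 1) <= r ->
  ccvg (fun n => cexp (g%:C * (u - 1)) *
    \prod_(0 <= i < n) ((1 + p i * (u - 1)) / (1 - q i * (u - 1)))) (Ex a b g u).
Proof.
move=> ur; have [l hl] : exists l, ccvg (fun n =>
    \prod_(0 <= i < n) ((1 + p i * (u - 1)) / (1 - q i * (u - 1)))) l.
  apply: cprod_cvg; apply: (@cvg_series_near R _ (fun i => 2 * r * scoef i) N).
  - by move=> n; exact: normc_ge0.
  - by move=> n; rewrite !mulr_ge0 ?scoef_ge0// ltW.
  - by move=> n Nn; exact: tail_ratio.
  - exact: cvg_tail.
by rewrite Ex_eq (climitE hl); apply: ccvgM => //; exact: ccvg_cst.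
Qed.

(** The inverse factors also have a convergent product, and the two limits multiply to 1, which
    shows [E u != 0]. By [cexp_lim] the approximants are rational in [u]. *)
Lemma ExV_cvg (u : C) : normc (u - 1) <= r ->
  (forall i, 1 + p i * (u - 1) != 0) -> (forall i, 1 - q i * (u - 1) != 0) ->
  Ex a b g u != 0 /\
  ccvg (fun n => (1 - g%:C * (u - 1) / n.+1%:R) ^+ n.+1 *
    \prod_(0 <= i < n) ((1 - q i * (u - 1)) / (1 + p i * (u - 1)))) (Ex a b g u)^-1.
Proof.
move=> ur p0 q0; have [l hl] : exists l, ccvg (fun n =>
    \prod_(0 <= i < n) ((1 - q i * (u - 1)) / (1 + p i * (u - 1)))) l.
  apply: cprod_cvg; apply: (@cvg_series_near R _ (fun i => 2 * r * scoef i) N).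
  - by move=> n; exact: normc_ge0.
  - by move=> n; rewrite !mulr_ge0 ?scoef_ge0// ltW.
  - by move=> n Nn; exact: tail_ratioV.
  - exact: cvg_tail.
have h1 : Ex a b g u * (cexp (- (g%:C * (u - 1))) * l) = 1.
  have c1 := ccvgM (Ex_cvg ur) (ccvgM (ccvg_cst (cexp (- (g%:C * (u - 1))))) hl).
  apply: (ccvg_unique c1); apply: (eq_ccvg _ (ccvg_cst 1)) => n.
  rewrite mulrACA -cexpD subrr cexp0 mul1r -big_split big1//= => i _.
  by have n1 := p0 i; have n2 := q0 i; field; rewrite n1 n2.
have E0 : Ex a b g u != 0.
  by apply: contraPneq h1 => ->; rewrite mul0r => /eqP; rewrite eq_sym oner_eq0.
split=> //; have -> : (Ex a b g u)^-1 = cexp (- (g%:C * (u - 1))) * l.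
  by apply: (mulfI E0); rewrite h1 mulfV.
apply: ccvgM hl; apply: (eq_ccvg _ (cexp_lim (- (g%:C * (u - 1))))) => n.
by rewrite mulNr.
Qed.

End Tail.
End GeneratingFunction.

(** * Cauchy's formula for the inverse of the generating function *)

Section Cauchy.
Variable R : realType.
Local Notation C := R[i].
Local Notation D := (`[0, 1]%classic : set R).
Local Notation normc := Normc.normc.

Lemma poly_lip (p : {poly C}) (w : C) : exists2 K : R, 0 <= K &
  forall u, normc (u - w) <= 1 -> normc (p.[u] - p.[w]) <= K * normc (u - w).
Proof.
elim/poly_ind: p => [|p c [K K0 hK]].
  by exists 0 => // u _; rewrite !horner0 subrr Normc.normc0 mul0r.
exists (K * (normc w + 1) + normc p.[w]) => [|u uw].
  by rewrite addr_ge0 ?mulr_ge0 ?addr_ge0 ?normc_ge0.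
rewrite !hornerMXaddC.
have -> : p.[u] * u + c - (p.[w] * w + c) = (p.[u] - p.[w]) * u + p.[w] * (u - w) by ring.
rewrite (le_trans (normcD _ _))// !Normc.normcM mulrDl lerD2r mulrAC.
rewrite (le_trans (ler_wpM2r (normc_ge0 _) (hK u uw)))// ler_wpM2l ?mulr_ge0 ?normc_ge0//.
by rewrite -[u in normc u](subrK w) addrC (le_trans (normcD _ _))// lerD2l.
Qed.

Variables (a b : nat -> R) (g : R).
Local Notation p i := (pcoef b i)%:C.
Local Notation q i := (qcoef a i)%:C.
Local Notation E := (Ex a b g).
Hypothesis ha0 : forall i, 0 <= a i.
Hypothesis ha1 : forall i, a i.+1 <= a i.
Hypothesis ha2 : cvgn (series a).
Hypothesis hb0 : forall i, 0 <= b i.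
Hypothesis hb1 : forall i, b i.+1 <= b i.
Hypothesis hb2 : cvgn (series b).
Hypothesis hg : 0 <= g.

Section Roots.
Variables (rho : R) (N : nat).
Hypothesis rho_gt0 : 0 < rho.
Hypothesis hN : forall i, (N <= i)%N -> scoef a b i * (rho + 1) <= 1 / 2.

Let r0 : 0 < rho + 1. Proof. by rewrite addr_gt0. Qed.

(** Named after their role in [1/E]: [PN] collects the numerators of its factors and [PD] the
    denominators, so the roots of [PD] are zeros of factors of [E]. *)
Definition PN (m n : nat) : {poly C} := \prod_(m <= i < n) (1 - (q i)%:P * ('X - 1%:P)).
Definition PD (m n : nat) : {poly C} := \prod_(m <= i < n) (1 + (p i)%:P * ('X - 1%:P)).

Lemma horner_PN m n u : (PN m n).[u] = \prod_(m <= i < n) (1 - q i * (u - 1)).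
Proof. by rewrite horner_prod; apply: eq_bigr => i _; rewrite !hornerE. Qed.

Lemma horner_PD m n u : (PD m n).[u] = \prod_(m <= i < n) (1 + p i * (u - 1)).
Proof. by rewrite horner_prod; apply: eq_bigr => i _; rewrite !hornerE. Qed.

Lemma PD_neq0 m n : PD m n != 0.
Proof.
apply/eqP => h; have := horner_PD m n 1; rewrite h horner0 big1; last first.
  by move=> i _; rewrite subrr mulr0 addr0.
by move/eqP; rewrite eq_sym oner_eq0.
Qed.

(* In lowest terms, the roots of the numerator of [E] are zeros of [E], hence have winding number zero. *)
Definition redN := PN 0 N %/ gcdp (PN 0 N) (PD 0 N).
Definition redD := PD 0 N %/ gcdp (PN 0 N) (PD 0 N).
Definition redG := gcdp (PN 0 N) (PD 0 N).

Lemma red_coprime : coprimep redN redD.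
Proof. by apply: coprimep_div_gcd; rewrite PD_neq0 orbT. Qed.

Lemma redNE u : (PN 0 N).[u] = redN.[u] * redG.[u].
Proof. by rewrite -hornerM divpK// dvdp_gcdl. Qed.

Lemma redDE u : (PD 0 N).[u] = redD.[u] * redG.[u].
Proof. by rewrite -hornerM divpK// dvdp_gcdr. Qed.

(** Valid at every point of the disc, including poles and common roots, as the punctured
    neighbourhoods in [zeroE] require. *)
Lemma Ex_bound (u : C) : normc (u - 1) <= rho + 1 ->
  normc (E u) <= expR (g * (rho + 1)) * (normc redD.[u] / normc redN.[u] * tailK a b (rho + 1)).
Proof.
move=> ur; have ecv := Ex_cvg g ha0 ha1 ha2 hb0 hb1 hb2 r0 hN ur.
apply: (ccvg_bound (proj2 (ccvg_shift _ _ N) ecv)) => n.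
rewrite Normc.normcM normc_cexp; apply: ler_pM.
- exact: expR_ge0.
- exact: normc_ge0.
- rewrite ler_expR (le_trans (ler_norm _))// (le_trans (normc_Re _))//.
  by rewrite Normc.normcM normcR ger0_norm// ler_wpM2l.
rewrite (big_cat_nat (n := N))//=; last exact: leq_addl.
rewrite Normc.normcM; apply: ler_pM; rewrite ?normc_ge0//; last first.
  apply: (tail_prod_le ha0 ha1 ha2 hb0 hb1 hb2 r0) => i Ni.
  exact: (tail_ratio r0 hN Ni ur).
rewrite prodf_div -horner_PN -horner_PD redNE redDE Normc.normcM Normc.normcV !Normc.normcM.
(* At a common root of both products the convention for division by zero makes the left-hand side
   0. *)
have [->|G0] := eqVneq (normc redG.[u]) 0.
  by rewrite !mulr0 mul0r mulr_ge0 ?invr_ge0 ?normc_ge0.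
by rewrite invfM mulrACA mulfV// mulr1.
Qed.

Lemma redD_root (w : C) : normc (w - 1) <= rho -> root redD w -> zeroE a b g w.
Proof.
move=> wr rw; have Nw : redN.[w] != 0.
  by apply: (coprimep_root (p := redD)) => //; rewrite coprimep_sym red_coprime.
have [KD KD0 hKD] := poly_lip redD w.
have [KN KN0 hKN] := poly_lip redN w.
move: (rw); rewrite /root => /eqP rw0.
have nw : 0 < normc redN.[w] by rewrite normc_gt0.
pose K := expR (g * (rho + 1)) * tailK a b (rho + 1) * KD * 2 / normc redN.[w].
have K0 : 0 <= K.
  by rewrite !mulr_ge0 ?expR_ge0 ?invr_ge0 ?normc_ge0.
(* The three radii keep [u] in the disc of radius [rho + 1], keep [redN] above half its value at
   [w], and push the bound of [E] below [eps]. *)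
move=> eps eps0; exists (Num.min 1 (Num.min (normc redN.[w] / (2 * (KN + 1))) (eps / (K + 1)))).
  by rewrite !lt_min ltr01 !divr_gt0// ?mulr_gt0// ltr_wpDl.
move=> u; rewrite !normcE !ltcR !lt_min => /andP[u0 /and3P[u1 u2 u3]].
have ur : normc (u - 1) <= rho + 1.
  have -> : u - 1 = (w - 1) + (u - w) by ring.
  by rewrite (le_trans (normcD _ _))// lerD// ltW.
apply: (le_lt_trans (Ex_bound ur)).
have hD : normc redD.[u] <= KD * normc (u - w).
  by have := hKD u (ltW u1); rewrite rw0 subr0.
have hNu : normc redN.[w] / 2 <= normc redN.[u].
  have h1 := hKN u (ltW u1).
  have h2 : KN * normc (u - w) <= normc redN.[w] / 2.
    move: u2; rewrite ltr_pdivlMr; last by rewrite mulr_gt0// ltr_wpDl.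
    have := normc_ge0 (u - w); move: (normc (u - w)) (normc redN.[w]) => x y; nra.
  have := normcB redN.[u] (redN.[u] - redN.[w]).
  by rewrite opprB addrC subrK => h3; lra.
have u3' : K * normc (u - w) < eps.
  move: u3; rewrite ltr_pdivlMr; last by rewrite ltr_wpDl.
  by move: u0 (normc _) => + x; nra.
apply: le_lt_trans u3'.
rewrite /K; set A := expR _; set T := tailK _ _ _.
have A0 : 0 <= A by exact: expR_ge0.
have T0 : 0 <= T by exact: expR_ge0.
have h : normc redD.[u] / normc redN.[u] <= KD * normc (u - w) * (2 / normc redN.[w]).
  apply: ler_pM => //; rewrite ?invr_ge0 ?normc_ge0//.
  rewrite -[leRHS]invrK lef_pV2 ?posrE ?invr_gt0 ?divr_gt0// ?(lt_le_trans _ hNu) ?divr_gt0//.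
  by rewrite invfM invrK mulrC.
rewrite (_ : A * T * KD * 2 / _ * _ = A * (KD * normc (u - w) * (2 / normc redN.[w]) * T)); last by ring.
by rewrite ler_wpM2l// ler_wpM2r.
Qed.

End Roots.

Variables (gx gy : R -> R).
Local Notation gm := (gam gx gy).
Local Notation Ci f := (contour_int gx gy f).
Hypotheses (cgx : {within `[0, 1], continuous gx}) (cgy : {within `[0, 1], continuous gy}).
Hypothesis closed_gam : gam gx gy 0 = gam gx gy 1.
Hypothesis simple_gam : forall s t : R, 0 <= s < 1 -> 0 <= t < 1 -> gm s = gm t -> s = t.
Variables (S : seq R) (M : R).
Hypothesis dgxy : forall t : R, 0 < t < 1 -> t \notin S ->
  derivable gx t 1 /\ derivable gy t 1.
Hypothesis bgxy : forall t : R, 0 < t < 1 -> t \notin S ->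
  `|gx^`() t| <= M /\ `|gy^`() t| <= M.
Hypothesis gam_off : forall t : R, 0 <= t <= 1 -> forall x : R, -1 <= x <= 1 -> gm t <> x%:C.
Hypothesis gam_zero : forall t : R, 0 <= t <= 1 -> ~ zeroE a b g (gm t).
Hypothesis wind1 : forall x : R, -1 <= x <= 1 -> winding gx gy x%:C = 1.
Hypothesis wind0 : forall w : C, zeroE a b g w -> winding gx gy w = 0.

(** A simple loop meets each point for at most one parameter in [[0, 1)], and the parameter 1 is
    excluded by hand. Hence finitely many points cost finitely many parameters. *)
Lemma loop_preimage (ws : seq C) : exists S' : seq R, forall t, D t -> t \notin S' ->
  gm t \notin ws.
Proof.
pose f w := xget 0 [set t : R | 0 <= t < 1 /\ gm t = w].
exists (1 :: map f ws) => t; rewrite /= in_itv/= => /andP[t0 t1].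
rewrite in_cons negb_or => /andP[t1' tS]; apply: contra tS => gw.
apply/mapP; exists (gm t) => //; rewrite /f; case: xgetP => [s _ [s01 sg]|].
  by apply: simple_gam => //; rewrite t0 lt_def eq_sym t1' t1.
by move=> /(_ t) h; exfalso; apply: h; split => //; rewrite t0 lt_neqAle t1' t1.
Qed.

(** With [2 <= rho] the disc about 1 also contains [[-1, 1]]. *)
Lemma loop_radius : exists2 rho : R, 2 <= rho & forall t, 0 <= t <= 1 -> normc (gm t - 1) <= rho.
Proof.
have [K hK] := bmc_bound (cc_bmc (ccD (cc_gam cgx cgy) (cc_cst (- 1)))).
exists (2 + `|K|); first by rewrite lerDl.
move=> t t01; have Dt : D t by rewrite /= in_itv.
rewrite (le_trans (hK t Dt))//.
by rewrite (le_trans (ler_norm K))// lerDr.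
Qed.

Definition twopii : C := (2%:C * pi%:C * 'i)%C.

Lemma twopii_neq0 : twopii != 0.
Proof. by rewrite !mulf_neq0// ?complexiE ?neq0Ci// eq_complex/= eqxx andbT gt_eqF ?pi_gt0. Qed.

Lemma offloop_real x : -1 <= x <= 1 -> offloop gx gy x%:C.
Proof. by move=> hx t t01; apply/eqP; exact: gam_off. Qed.

Let bound01 (f : C -> C) : cont01 (fun t => f (gm t)) -> exists2 B : R, 0 <= B & forall t, D t -> normc (f (gm t)) <= B.
Proof.
move=> /cc_bmc/bmc_bound[B hB]; exists `|B| => // t Dt.
by rewrite (le_trans (hB t Dt))// ler_norm.
Qed.

Theorem Cauchy_formula : bounded_on_loop gx gy (fun u => (E u)^-1) /\
  forall x : R, -1 <= x <= 1 -> E x%:C != 0 /\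
  forall P : {poly C}, Ci (fun u => P.[u] / (u - x%:C) / E u) = twopii * (P.[x%:C] / E x%:C).
Proof.
have [rho rho2 hrho] := loop_radius.
have rho0 : 0 < rho by rewrite (lt_le_trans _ rho2).
have r0 : 0 < rho + 1 by rewrite addr_gt0.
have [N hN] := scoef_small ha0 ha1 ha2 hb0 hb1 hb2 r0.
pose rN := redN N; pose rD := redD N.
have hr1 t : 0 <= t <= 1 -> normc (gm t - 1) <= rho + 1.
  by move=> /hrho h; rewrite (le_trans h)// lerDl.
(* A root inside the disc is a zero of [E] and has winding number 0 by hypothesis; for a root
   outside, [winding_far] gives it. *)
have wzD w : root rD w -> unwound gx gy w.
  move=> rw; have [wr|wr] := leP (normc (w - 1)) rho; last exact: (winding_far cgx cgy closed_gam dgxy bgxy hrho wr).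
  have zw := redD_root rho0 hN wr rw; split; last exact: wind0.
  by move=> t t01; apply/eqP => gw; apply: (gam_zero t01); rewrite gw.
have wzT m w : root (PD N m) w -> unwound gx gy w.
  rewrite /root horner_PD prodf_seq_eq0 => /hasP; case=> i.
  rewrite mem_index_iota => /andP[Ni _] /= p0.
  apply: (winding_far cgx cgy closed_gam dgxy bgxy hrho); rewrite ltNge; apply: contraTN p0 => wr.
  by apply: (tail_p0 hN Ni); rewrite (le_trans wr)// lerDl.
pose xi n : {poly C} := (1 - (g%:C / n.+1%:R)%:P * ('X - 1%:P)) ^+ n.+1.
have xiE n u : (xi n).[u] = (1 - g%:C * (u - 1) / n.+1%:R) ^+ n.+1.
  by rewrite horner_exp !hornerE [_ / _ * _]mulrAC.
pose DD n := rD * PD N n.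
have wzDD n w : root (DD n) w -> unwound gx gy w.
  by rewrite rootM => /orP[/wzD|/wzT].
pose NN n := xi n * (rN * PN N n).
have DD0 n t : 0 <= t <= 1 -> (DD n).[gm t] != 0.
  move=> t01; apply/negP => /(wzDD n)[ow _].
  by have := ow t t01; rewrite eqxx.
have ccDD n : cont01 (fun t => ((DD n).[gm t])^-1).
  by apply: ccV; [exact: DD0|exact: cc_horner (cc_gam cgx cgy)].
pose F n u := (NN n).[u] / (DD n).[u].
have ccF n : cont01 (fun t => F n (gm t)).
  by apply: ccM; [exact: cc_horner (cc_gam cgx cgy)|exact: ccDD].
(* The partial fractions stay bounded on the loop, so limits pass under the integral. *)
have [B0 B00 hB0] : exists2 B : R, 0 <= B & forall t, D t -> normc (rN.[gm t] / rD.[gm t]) <= B.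
  apply: (bound01 (f := fun u => rN.[u] / rD.[u])).
  apply: ccM; first exact: cc_horner (cc_gam cgx cgy).
  have := ccDD N; rewrite /DD /PD big_geq// mulr1//.
pose B := expR (g * rho) * (B0 * tailK a b (rho + 1)).
have FB n t : D t -> normc (F n (gm t)) <= B.
  move=> Dt; have t01 : 0 <= t <= 1 by move: Dt; rewrite /= in_itv.
  have -> : F n (gm t) = (xi n).[gm t] * (rN.[gm t] / rD.[gm t] * ((PN N n).[gm t] / (PD N n).[gm t])).
    by rewrite /F /NN /DD !hornerM invfM; ring.
  rewrite Normc.normcM; apply: ler_pM; rewrite ?normc_ge0//.
    rewrite xiE normcX.
    have h : normc (1 - g%:C * (gm t - 1) / n.+1%:R) <= expR (g * rho / n.+1%:R).
      rewrite (le_trans (normcB _ _))// Normc.normc1 (le_trans _ (expR_ge1Dx _))// lerD2l.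
      rewrite Normc.normcM Normc.normcV normc_nat ler_wpM2r// Normc.normcM normcR ger0_norm//.
      by rewrite ler_wpM2l// hrho.
    rewrite (le_trans (lerXn2r _ _ _ h)) ?nnegrE ?normc_ge0 ?expR_ge0//.
    by rewrite -expRM_natl mulrC divfK// pnatr_eq0.
  rewrite Normc.normcM; apply: ler_pM; rewrite ?normc_ge0 ?hB0//.
  rewrite horner_PN horner_PD -prodf_div.
  apply: (tail_prod_le ha0 ha1 ha2 hb0 hb1 hb2 r0) => i Ni.
  by apply: (tail_ratioV r0 hN Ni); exact: hr1.
have limF u : normc (u - 1) <= rho + 1 -> (PN 0 N).[u] != 0 -> (PD 0 N).[u] != 0 ->
    E u != 0 /\ ccvg (fun n => F n u) (E u)^-1.
  move=> ur n0 d0.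
  have p0 i : 1 + p i * (u - 1) != 0.
    have [iN|Ni] := ltnP i N; last exact: (tail_p0 hN Ni ur).
    apply: contraNneq d0 => e; rewrite horner_PD prodf_seq_eq0; apply/hasP.
    by exists i; rewrite ?mem_index_iota//= e.
  have q0 i : 1 - q i * (u - 1) != 0.
    have [iN|Ni] := ltnP i N; last exact: (tail_q0 hN Ni ur).
    apply: contraNneq n0 => e; rewrite horner_PN prodf_seq_eq0; apply/hasP.
    by exists i; rewrite ?mem_index_iota//= e.
  have [E0 cE] := ExV_cvg g ha0 ha1 ha2 hb0 hb1 hb2 r0 hN ur p0 q0.
  split=> //; apply: (proj1 (ccvg_shift _ _ N)); apply: eq_ccvg (proj2 (ccvg_shift _ _ N) cE) => n.
  rewrite (big_cat_nat (n := N))//=; last exact: leq_addl.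
  rewrite !prodf_div -!horner_PN -!horner_PD redNE redDE /F /NN /DD !hornerM xiE.
  have G0 : (redG N).[u] != 0 by move: n0; rewrite redNE mulf_eq0 negb_or => /andP[].
  have D0 : rD.[u] != 0 by move: d0; rewrite redDE mulf_eq0 negb_or => /andP[].
  have T0 : (PD N (n + N)).[u] != 0.
    by rewrite horner_PD prodf_seq_neq0; apply/allP => i _ /=; exact: p0.
  by rewrite -/rN -/rD; field; rewrite T0 G0 D0.
(* Where the loop meets a root of the first [N] factors, [E] may take a conventional value; these
   parameters are excluded from the limit. *)
have [S' hS'] : exists S' : seq R, forall t, D t -> t \notin S' ->
    (PN 0 N).[gm t] != 0 /\ (PD 0 N).[gm t] != 0.
  have PN0 : PN 0 N != 0.
    apply/eqP => h; have := horner_PN 0 N 1; rewrite h horner0 big1; last first.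
      by move=> i _; rewrite subrr mulr0 subr0.
    by move/eqP; rewrite eq_sym oner_eq0.
  have [rs hrs] := closed_field_poly_normal (PN 0 N).
  have [ss hss] := closed_field_poly_normal (PD 0 N).
  have [S' hS'] := loop_preimage (rs ++ ss).
  have h (P : {poly C}) zs : P != 0 -> P = lead_coef P *: \prod_(z <- zs) ('X - z%:P) ->
      forall u, u \notin zs -> P.[u] != 0.
    move=> P0 -> u uz; rewrite hornerZ mulf_neq0 ?lead_coef_eq0//.
    rewrite -/(root _ _) root_prod_XsubC//.
  exists S' => t Dt /(hS' t Dt); rewrite mem_cat negb_or => /andP[u1 u2].
  by split; [exact: h PN0 hrs _ u1|exact: h (PD_neq0 _ _) hss _ u2].
have limFg t : D t -> t \notin S' -> ccvg (fun n => F n (gm t)) (E (gm t))^-1.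
  move=> Dt tS; have [n0 d0] := hS' t Dt tS.
  have t01 : 0 <= t <= 1 by move: Dt; rewrite /= in_itv.
  by have [_] := limF _ (hr1 t t01) n0 d0.
have blE : bounded_on_loop gx gy (fun u => (E u)^-1).
  have [//|//] := contour_lim cgx cgy dgxy bgxy (f_ := F) (f := fun u => (E u)^-1) _ FB limFg.
  by move=> n; exact: cc_bl.
split=> // x hx.
(* Points of [[-1, 1]] have winding number 1 and roots of [DD n] have 0, so no root lies on the
   segment. *)
have DDx n : (DD n).[x%:C] != 0.
  apply/negP => /(wzDD n)[_]; rewrite wind1// => /eqP.
  by rewrite oner_eq0.
have xr : normc (x%:C - 1) <= rho + 1.
  rewrite -(rmorph1 (real_complex R)) -rmorphB normcR.
  by rewrite ler_norml; move: hx rho2 => /andP[? ?] ?; apply/andP; split; lra.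
have PNx : (PN 0 N).[x%:C] != 0.
  rewrite horner_PN prodf_seq_neq0; apply/allP => i _ /=.
  rewrite -(rmorph1 (real_complex R)) -rmorphB -rmorphM -rmorphB.
  rewrite (_ : 0 = 0%:C)// (inj_eq (@complexI R)) gt_eqF//.
  by have := qcoef_ge0 ha0 i; move: hx => /andP[_ x1]; nra.
have PDx : (PD 0 N).[x%:C] != 0.
  have := DDx N; rewrite /DD [PD N N]/PD big_geq// mulr1 redDE => h.
  by rewrite mulf_neq0//; move: PNx; rewrite redNE mulf_eq0 negb_or => /andP[].
have [Ex0 limFx] := limF _ xr PNx PDx.
split=> // P.
have ox := offloop_real hx.
(* The quotient splits into its simple pole at [x], which has winding number 1, and a rational
   function whose poles are all unwound. *)
have CF n : Ci (fun u => P.[u] / (u - x%:C) * F n u) = twopii * (P.[x%:C] * F n x%:C).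
  pose A := P * NN n.
  have [Q QE] : exists Q, A * (DD n).[x%:C]%:P - A.[x%:C]%:P * DD n = Q * ('X - x%:C%:P).
    by apply/factor_theorem; rewrite /root !hornerE subrr.
  have [ws wsE] := closed_field_poly_normal (DD n).
  have lc0 : lead_coef (DD n) != 0.
    by rewrite lead_coef_eq0; apply: contraNneq (DDx n) => ->; rewrite horner0.
  have wsr w : w \in ws -> unwound gx gy w.
    by move=> ww; apply: (wzDD n); rewrite wsE /root hornerZ mulf_eq0 -!/(root _ _) root_prod_XsubC ww orbT.
  have z0 : Ci (fun u => Q.[u] * (\prod_(w <- ws) (u - w))^-1) = 0.
    exact: (contour_rational cgx cgy closed_gam dgxy bgxy).
  have wx : Ci (fun u => (u - x%:C)^-1) = twopii.
    have := wind1 hx; rewrite /winding => /(congr1 (fun y => twopii * y)).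
    by rewrite mulr1 mulrA mulfV ?mul1r// twopii_neq0.
  have bl1 : bounded_on_loop gx gy (fun u => (u - x%:C)^-1) by exact: bl_subV.
  have bl2 : bounded_on_loop gx gy (fun u => Q.[u] * (\prod_(w <- ws) (u - w))^-1).
    apply: cc_bl; apply: ccM; first exact: cc_horner (cc_gam cgx cgy).
    by apply: (cc_prodV cgx cgy) => w /wsr[].
  have DDu u : (DD n).[u] = lead_coef (DD n) * \prod_(w <- ws) (u - w).
    rewrite {1}wsE hornerZ horner_prod; congr (_ * _); apply: eq_bigr => w _.
    by rewrite !hornerE.
  transitivity (Ci (fun u => A.[x%:C] / (DD n).[x%:C] * (u - x%:C)^-1 +
      ((DD n).[x%:C])^-1 / lead_coef (DD n) * (Q.[u] * (\prod_(w <- ws) (u - w))^-1))).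
    apply: (contour_eq cgx cgy dgxy bgxy).
      exact: (bmcD (bmcM (bmc_cst _ _) bl1) (bmcM (bmc_cst _ _) bl2)).
    move=> t; rewrite /= in_itv/= => t01.
    have ux : gm t - x%:C != 0 by rewrite subr_eq0 ox.
    have Du := DD0 n t t01; have Dx := DDx n.
    have Qu : Q.[gm t] = (A.[gm t] * (DD n).[x%:C] - A.[x%:C] * (DD n).[gm t]) / (gm t - x%:C).
      have := congr1 (fun P : {poly C} => P.[gm t]) QE.
      rewrite hornerD hornerN !hornerM hornerXsubC !hornerC => ->.
      by rewrite mulfK.
    have Pu : (\prod_(w <- ws) (gm t - w))^-1 = lead_coef (DD n) / (DD n).[gm t].
      by rewrite DDu invfM mulrA mulfV// mul1r.
    rewrite Pu Qu /F -/(A) [A.[gm t]]hornerM.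
    by field; rewrite ux Du Dx lc0.
  rewrite (contourD cgx cgy dgxy bgxy); [|exact: bmcM (bmc_cst _ _) bl1|exact: bmcM (bmc_cst _ _) bl2].
  rewrite !(contourZ cgx cgy dgxy bgxy)// z0 wx mulr0 addr0.
  by rewrite /F /A hornerM; ring.
have blP : bounded_on_loop gx gy (fun u => P.[u] / (u - x%:C)).
  by apply: cc_bl; apply: ccM; [exact: cc_horner (cc_gam cgx cgy)|exact: cc_subV].
have [K hK] := bmc_bound blP.
have [n|n t Dt|t Dt tS|_ cont_on_loop] := contour_lim cgx cgy dgxy bgxy (S' := S') (N := K * B)
  (f_ := fun n u => P.[u] / (u - x%:C) * F n u) (f := fun u => P.[u] / (u - x%:C) / E u).
- by apply: bmcM => //; exact: cc_bmc.
- by rewrite Normc.normcM ler_pM ?normc_ge0 ?hK ?FB.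
- by apply: ccvgM; [exact: ccvg_cst|exact: limFg].
apply: (ccvg_unique cont_on_loop).
apply: (eq_ccvg (u := fun n => twopii * (P.[x%:C] * F n x%:C))) => [n|]; first by rewrite CF.
by apply: ccvgM; [exact: ccvg_cst|apply: ccvgM => //; exact: ccvg_cst].
Qed.

End Cauchy.

(** * Moments along the loop *)

Section Moments.
Variable R : realType.
Local Notation C := R[i].
Local Notation D := (`[0, 1]%classic : set R).
Local Notation I := (`[-1, 1]%classic : set R).
Local Notation normc := Normc.normc.

Definition aff (t : R) : R := 2 * t - 1.

Lemma affK (x : R) : aff ((x + 1) / 2) = x.
Proof. by rewrite /aff; field. Qed.

Lemma cc_bmcI (f : R -> C) : cont01 (fun t => f (aff t)) -> bmc I f.
Proof.
move=> cf; have [K hK] := bmc_bound (cc_bmc cf).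
have mem x : I x -> 0 <= (x + 1) / 2 <= 1.
  by rewrite /= in_itv/= => /andP[? ?]; apply/andP; split; lra.
have [f1 f2] := cf.
have H (h : C -> R) : continuous (fun t => h (f (aff (clamp t)))) -> measurable_fun I (fun x => h (f x)).
  move=> ch; suff m : measurable_fun I (fun x => h (f (aff (clamp ((x + 1) / 2))))).
    by apply: eq_measurable_fun m => x; rewrite inE => /mem hx; rewrite clamp_id// affK.
  apply: measurable_funTS; apply: continuous_measurable_fun => x.
  apply: (@continuous_comp _ _ _ (fun x : R => (x + 1) / 2) (fun t : R => h (f (aff (clamp t))))); last exact: ch.
  by apply: cvgM; [apply: cvgD; [exact: cvg_id|exact: cvg_cst]|exact: cvg_cst].
apply: bmcP; [exact: H f1|exact: H f2|].
by exists K => x Ix; rewrite -[x in f x]affK hK//= in_itv/= mem.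
Qed.

Lemma lip_cc (f : R -> C) (L : R) :
  (forall x y, -1 <= x <= 1 -> -1 <= y <= 1 -> normc (f x - f y) <= L * `|x - y|) ->
  cont01 (fun t => f (aff t)).
Proof.
move=> hL.
have mem t : -1 <= aff (clamp t) <= 1 by have := clampP t; rewrite /aff => /andP[? ?]; apply/andP; split; lra.
have dc (t s : R) : `|clamp t - clamp s| <= `|t - s|.
  have [ts|st] := leP t s.
    by have /andP[? ?] := clamp_lip ts; rewrite distrC [leRHS]distrC !ger0_norm// subr_ge0.
  by have /andP[? ?] := clamp_lip (ltW st); rewrite !ger0_norm// subr_ge0 ltW.
have H (h : C -> R) : (forall x y, h (x - y) = h x - h y) -> (forall x, `|h x| <= normc x) ->
    continuous (fun t => h (f (aff (clamp t)))).
  move=> hB hn t; apply/cvgrPdist_lt => e e0.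
  pose K := `|L| * 2 + 1; have K0 : 0 < K by rewrite ltr_wpDl// mulr_ge0.
  near=> s; have ts : `|t - s| < e / K by near: s; apply: cvgr_dist_lt => //; rewrite divr_gt0.
  rewrite -hB (le_lt_trans (hn _))// (le_lt_trans (hL _ _ (mem _) (mem _)))//.
  have -> : aff (clamp t) - aff (clamp s) = 2 * (clamp t - clamp s) by rewrite /aff; ring.
  rewrite normrM (ger0_norm (x := 2))//.
  move: ts; rewrite ltr_pdivlMr// => ts; have := dc t s; have := ler_norm L.
  have := normr_ge0 (clamp t - clamp s); have := normr_ge0 L; move: ts; rewrite /K.
  move: `|clamp t - clamp s| `|t - s| `|L| => x y z; nra.
split.
  by apply: H => [x y|x]; [rewrite ReD ReN|exact: normc_Re].
by apply: H => [x y|x]; [rewrite ImD ImN|exact: normc_Im].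
Unshelve. all: by end_near. Qed.

Variables (E : C -> C) (gx gy : R -> R).
Local Notation gm := (gam gx gy).
Local Notation Ci f := (contour_int gx gy f).
Hypotheses (cgx : {within `[0, 1], continuous gx}) (cgy : {within `[0, 1], continuous gy}).
Variables (S : seq R) (M : R).
Hypothesis dgxy : forall t : R, 0 < t < 1 -> t \notin S ->
  derivable gx t 1 /\ derivable gy t 1.
Hypothesis bgxy : forall t : R, 0 < t < 1 -> t \notin S ->
  `|gx^`() t| <= M /\ `|gy^`() t| <= M.
Hypothesis gam_off : forall t : R, 0 <= t <= 1 -> forall x : R, -1 <= x <= 1 -> gm t <> x%:C.
Hypothesis blE : bounded_on_loop gx gy (fun u => (E u)^-1).
Hypothesis cauchyE : forall x : R, -1 <= x <= 1 -> E x%:C != 0 /\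
  forall P : {poly C}, Ci (fun u => P.[u] / (u - x%:C) / E u) = twopii R * (P.[x%:C] / E x%:C).

Definition Lam (f : C -> C) : C := (twopii R)^-1 * Ci (fun u => f u / E u).

(** The Taylor remainder of order [j] of [1/E] at 1, divided by [(x - 1) ^+ j]. The integral form
    keeps it defined and Lipschitz at [x = 1]. The Taylor coefficients themselves are [epsc]. *)
Definition Wf (j : nat) (x : R) : C := Lam (fun u => ((u - 1) ^+ j * (u - x%:C))^-1).

Definition epsc (l : nat) : C := Lam (fun u => ((u - 1) ^+ l.+1)^-1).

Definition cont_on_loop (f : C -> C) := cont01 (fun t => f (gm t)).

Let blf (f : C -> C) : cont_on_loop f -> bounded_on_loop gx gy (fun u => f u / E u).
Proof. by move=> cf; exact: bmcM (cc_bmc cf) blE. Qed.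

Lemma LamD f h : cont_on_loop f -> cont_on_loop h -> Lam (fun u => f u + h u) = Lam f + Lam h.
Proof.
move=> cf ch; rewrite /Lam -mulrDr -(contourD cgx cgy dgxy bgxy (blf cf) (blf ch)).
by congr (_ * contour_int _ _ _); apply/funext => u; rewrite mulrDl.
Qed.

Lemma LamZ c f : cont_on_loop f -> Lam (fun u => c * f u) = c * Lam f.
Proof.
move=> cf; rewrite /Lam mulrCA -(contourZ cgx cgy dgxy bgxy _ (blf cf)).
by congr (_ * contour_int _ _ _); apply/funext => u; rewrite mulrA.
Qed.

Lemma Lam_eq f h : cont_on_loop h -> (forall t, 0 <= t <= 1 -> f (gm t) = h (gm t)) -> Lam f = Lam h.
Proof.
move=> ch fh; rewrite /Lam; congr (_ * _).
apply: (contour_eq cgx cgy dgxy bgxy (blf ch)) => t; rewrite /= in_itv/= => t01.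
by rewrite fh.
Qed.

Lemma cl_cst c : cont_on_loop (fun=> c). Proof. exact: cc_cst. Qed.

Lemma cl_horner (P : {poly C}) : cont_on_loop (fun u => P.[u]).
Proof. exact: cc_horner (cc_gam cgx cgy). Qed.

Lemma cl_subV x : -1 <= x <= 1 -> cont_on_loop (fun u => (u - x%:C)^-1).
Proof. by move=> hx; apply: (cc_subV cgx cgy) => t t01; apply/eqP; exact: gam_off. Qed.

Lemma cl_W j x : -1 <= x <= 1 -> cont_on_loop (fun u => ((u - 1) ^+ j * (u - x%:C))^-1).
Proof.
move=> hx; have h : cont_on_loop (fun u => (u - 1)^-1).
  by rewrite -(rmorph1 (real_complex R)); apply: cl_subV; rewrite lexx; lra.
apply: (_ : cont_on_loop _).
have := ccM (ccX j h) (cl_subV hx); rewrite /cont_on_loop.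
by under eq_fun do rewrite exprVn -invfM.
Qed.

Let off1 t : 0 <= t <= 1 -> gm t - 1 != 0.
Proof.
move=> t01; rewrite subr_eq0 -(rmorph1 (real_complex R)); apply/eqP; apply: gam_off => //.
by rewrite lexx; lra.
Qed.

Let offx t x : 0 <= t <= 1 -> -1 <= x <= 1 -> gm t - x%:C != 0.
Proof. by move=> t01 hx; rewrite subr_eq0; apply/eqP; exact: gam_off. Qed.

Lemma Lam_cauchy (P : {poly C}) x : -1 <= x <= 1 -> Lam (fun u => P.[u] / (u - x%:C)) = P.[x%:C] / E x%:C.
Proof.
by move=> hx; have [_ h] := cauchyE hx; rewrite /Lam h mulrA mulVf ?mul1r// twopii_neq0.
Qed.

Lemma Wf0 x : -1 <= x <= 1 -> Wf 0 x = (E x%:C)^-1.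
Proof.
move=> hx; have := Lam_cauchy 1 hx; rewrite hornerC mul1r => <-.
by congr Lam; apply/funext => u; rewrite hornerC expr0 !mul1r.
Qed.

Lemma epsc0 : epsc 0 = (E 1)^-1.
Proof.
have h1 : -1 <= (1 : R) <= 1 by rewrite lexx; lra.
have := Wf0 h1; rewrite rmorph1 => <-.
by congr Lam; apply/funext => u; rewrite rmorph1 mul1r expr1.
Qed.

(* Taylor expansion of [1/E] at 1, with remainder, since [Wf 0 = 1/E]. *)
Lemma Wf_rec j x : -1 <= x <= 1 -> Wf j x = epsc j + (x%:C - 1) * Wf j.+1 x.
Proof.
move=> hx; have c1 := cl_W j.+1 hx.
have ce : cont_on_loop (fun u => ((u - 1) ^+ j.+1)^-1).
  have := ccX j.+1 (cl_W 0 (x := 1) ltac:(by rewrite lexx; lra)).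
  by rewrite /cont_on_loop; under eq_fun do rewrite expr0 mul1r rmorph1 exprVn.
rewrite /Wf -LamZ// -LamD//; last exact: ccM (cc_cst _) c1.
apply: Lam_eq; first by apply: ccD => //; exact: ccM (cc_cst _) c1.
move=> t t01; have n1 := off1 t01; have nx := offx t01 hx.
by rewrite !exprS; field; rewrite n1 nx expf_neq0.
Qed.

(** The terms of order below [r] keep a pole at 1 and produce the moments [Wf]; the rest cancels the
    denominator at 1 and is evaluated by Cauchy's formula. *)
Lemma Lam_poly (c : nat -> C) (Q : {poly C}) r x : -1 <= x <= 1 ->
  Lam (fun u => (\sum_(i < r) c i * (u - 1) ^+ i + (u - 1) ^+ r * Q.[u]) / ((u - 1) ^+ r * (u - x%:C))) =
  \sum_(i < r) c i * Wf (r - i) x + Q.[x%:C] / E x%:C.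
Proof.
move=> hx; rewrite -Lam_cauchy//.
have cQ : cont_on_loop (fun u => Q.[u] / (u - x%:C)) by apply: ccM; [exact: cl_horner|exact: cl_subV].
have h (s : nat) : (s <= r)%N ->
    cont_on_loop (fun u => \sum_(i < s) c i * ((u - 1) ^+ (r - i) * (u - x%:C))^-1) /\
    Lam (fun u => \sum_(i < s) c i * ((u - 1) ^+ (r - i) * (u - x%:C))^-1) =
      \sum_(i < s) c i * Wf (r - i) x.
  elim: s => [_|s IH sr].
    have -> : (fun u => \sum_(i < 0) c i * ((u - 1) ^+ (r - i) * (u - x%:C))^-1) = (fun=> 0 * 0).
      by apply/funext => u; rewrite big_ord0 mul0r.
    split; first exact: cl_cst.
    by rewrite LamZ ?mul0r ?big_ord0//; exact: cl_cst.
  have [c1 e1] := IH (ltnW sr); have c2 := ccM (cc_cst (c s)) (cl_W (r - s) hx).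
  split; first by rewrite /cont_on_loop; under eq_fun do rewrite big_ord_recr/=; exact: ccD.
  rewrite big_ord_recr/= -e1 /Wf -LamZ; last exact: cl_W.
  by rewrite -LamD//; congr Lam; apply/funext => u; rewrite big_ord_recr.
have [c1 <-] := h r (leqnn r); rewrite -LamD//; apply: Lam_eq; first exact: ccD.
move=> t t01; have n1 := off1 t01; have nx := offx t01 hx.
rewrite mulrDl mulr_suml; congr (_ + _).
  apply: eq_bigr => i _; have -> : (gm t - 1) ^+ r = (gm t - 1) ^+ i * (gm t - 1) ^+ (r - i).
    by rewrite -exprD subnKC// ltnW.
  by field; rewrite ?nx ?expf_neq0.
by rewrite invfM mulrACA mulfV ?mul1r// expf_neq0.
Qed.

(** The point of [[-1, 1]] nearest to [gm t] is its real part cut off to the segment, hence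
    continuous in [t]. A uniform bound in [x] thus reduces to bounding one continuous function of
    [t]. *)
Lemma dist_bound : exists2 B : R, 0 <= B &
  forall t x, 0 <= t <= 1 -> -1 <= x <= 1 -> normc (gm t - x%:C)^-1 <= B.
Proof.
pose pr (y : R) : R := aff (clamp ((y + 1) / 2)).
have prI y : -1 <= pr y <= 1.
  by have := clampP ((y + 1) / 2); rewrite /pr /aff => /andP[? ?]; apply/andP; split; lra.
have [c1 c2] := cc_gam cgx cgy.
have cpr : cont01 (fun t => (pr (complex.Re (gm t)))%:C).
  split; last by move=> t; exact: cvg_cst.
  move=> t; rewrite /pr /aff/=.
  apply: cvgB; last exact: cvg_cst.
  apply: cvgM; first exact: cvg_cst.
  apply: (@continuous_comp _ _ _ (fun t => (gx (clamp t) + 1) / 2) (@clamp R)); last exact: clamp_continuous.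
  by apply: cvgM; [apply: cvgD; [exact: c1|exact: cvg_cst]|exact: cvg_cst].
have cd : cont01 (fun t => (gm t - (pr (complex.Re (gm t)))%:C)^-1).
  apply: ccV; last exact: ccD (cc_gam cgx cgy) (ccN cpr).
  by move=> t t01; apply: offx.
have [K hK] := bmc_bound (cc_bmc cd).
exists `|K| => // t x t01 hx.
have Dt : D t by rewrite /= in_itv.
apply: le_trans (le_trans (hK t Dt) (ler_norm K)).
rewrite !Normc.normcV lef_pV2 ?posrE ?normc_gt0 ?offx//.
rewrite /gam /= ler_wsqrtr// lerD2r.
rewrite -(real_normK (num_real (gx t - pr _))) -(real_normK (num_real (gx t - x))) lerXn2r ?nnegrE//.
move: hx => /andP[x1 x2]; rewrite /pr /aff /clamp /Order.max /Order.min.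
case: (ltP ((gx t + 1) / 2) 0) => h1; case: ltP => h2; rewrite ler_norml; apply/andP; split;
  case: (ler0P (gx t - x)) => ?; lra.
Qed.

(** [1/(u - x) - 1/(u - y) = (x - y)/((u - x)(u - y))], and [dist_bound] controls the denominators
    along the loop. *)
Lemma Wf_lip j : exists L : R, forall x y, -1 <= x <= 1 -> -1 <= y <= 1 ->
  normc (Wf j x - Wf j y) <= L * `|x - y|.
Proof.
have [B B0 hB] := dist_bound.
have [K K0 hK] := contour_bound cgx cgy dgxy bgxy.
have [BE hBE] := bmc_bound blE.
exists (normc (twopii R)^-1 * (B ^+ j * B * B * `|BE| * K)) => x y hx hy.
have cW : cont_on_loop (fun u => ((u - 1) ^+ j * (u - x%:C))^-1 * (u - y%:C)^-1).
  by apply: ccM; [exact: cl_W|exact: cl_subV].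
have -> : Wf j x - Wf j y = (x - y)%:C * Lam (fun u => ((u - 1) ^+ j * (u - x%:C))^-1 * (u - y%:C)^-1).
  have cx := cl_W j hx; have cy := cl_W j hy.
  rewrite -[Wf j x - Wf j y](_ : Lam (fun u => ((u - 1) ^+ j * (u - x%:C))^-1 +
      -1 * ((u - 1) ^+ j * (u - y%:C))^-1) = _); last first.
    by rewrite LamD ?LamZ ?mulN1r//; exact: ccM (cc_cst _) cy.
  rewrite -LamZ//; apply: Lam_eq; first exact: ccM (cc_cst _) cW.
  move=> t t01; have n1 := off1 t01; have nx := offx t01 hx; have ny := offx t01 hy.
  by rewrite rmorphB/=; field; rewrite nx ny expf_neq0.
rewrite Normc.normcM normcR mulrC ler_wpM2r// /Lam Normc.normcM ler_wpM2l ?normc_ge0//.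
apply: hK; first exact: blf.
move=> t Dt; have t01 : 0 <= t <= 1 by move: Dt; rewrite /= in_itv.
rewrite invfM !Normc.normcM.
have h1 : normc ((gm t - 1) ^+ j)^-1 <= B ^+ j.
  rewrite -exprVn normcX lerXn2r ?nnegrE ?normc_ge0//.
  by rewrite -(rmorph1 (real_complex R)) hB// lexx; lra.
apply: ler_pM; rewrite ?mulr_ge0 ?normc_ge0//; last by rewrite (le_trans (hBE t Dt))// ler_norm.
apply: ler_pM; rewrite ?mulr_ge0 ?normc_ge0//; last exact: hB.
by apply: ler_pM; rewrite ?normc_ge0// hB.
Qed.

Lemma bmc_Wf j : bmc I (Wf j).
Proof. by have [L hL] := Wf_lip j; apply: cc_bmcI; exact: lip_cc hL. Qed.

(** Regularity of [E] on the segment is read off from [1/E = Wf 0], which is Lipschitz without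
    zeros, rather than from the infinite product. *)
Lemma bmc_E : bmc I (fun x => E x%:C).
Proof.
have memI t : 0 <= t <= 1 -> -1 <= aff t <= 1 by rewrite /aff => /andP[? ?]; apply/andP; split; lra.
have [L hL] := Wf_lip 0; have cW := lip_cc hL.
have cV : cont01 (fun t => (Wf 0 (aff t))^-1).
  apply: ccV cW => t t01; rewrite Wf0 ?memI// invr_eq0.
  by have [] := cauchyE (memI t t01).
apply: (eq_bmc _ (cc_bmcI (f := fun x => (Wf 0 x)^-1) cV)) => x; rewrite /= in_itv/= => hx.
by rewrite Wf0// invrK.
Qed.

End Moments.

(** * Chebyshev expansions *)

Section ChebyshevWeight.
Variable R : realType.
Local Notation mu := (@lebesgue_measure R).
Local Notation I := (`[-1, 1]%classic : set R).

Local Notation V s := (Jpoly R 1 s).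
Local Notation U s := (Jpoly R 0 s).

Lemma JpolySS n k : Jpoly R n k.+2 = 2%:P * 'X * Jpoly R n k.+1 - Jpoly R n k.
Proof. by []. Qed.

Lemma Jpoly0 n : Jpoly R n 0 = 1. Proof. by []. Qed.

Lemma V1E : V 1 = 2%:P * 'X - 1. Proof. by []. Qed.

Lemma U1E : U 1 = 2%:P * 'X. Proof. by rewrite /Jpoly /= subr0. Qed.

Lemma odd_even_ind (P : nat -> Prop) : P 0%N -> P 1%N ->
  (forall k, P k -> P k.+1 -> P k.+2) -> forall k, P k.
Proof.
move=> P0 P1 PS k; suff [] : P k /\ P k.+1 by [].
by elim: k => [|k [h1 h2]]; split => //; exact: PS.
Qed.

(** [U] and [V] are the Chebyshev polynomials of the second and third kind. This relation and [U_V]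
    are what make the coefficients of adjacent levels telescope. *)
Lemma V_U k : V k.+1 = U k.+1 - U k.
Proof.
elim/odd_even_ind: k => [||k h1 h2].
- by rewrite V1E U1E Jpoly0.
- by rewrite !JpolySS V1E U1E !Jpoly0; ring.
- by rewrite [LHS]JpolySS h1 h2 !(JpolySS 0); ring.
Qed.

Lemma U_V k : 2%:P * (1 - 'X) * U k = V k - V k.+1.
Proof.
elim/odd_even_ind: k => [||k h1 h2].
- by rewrite V1E !Jpoly0; ring.
- by rewrite !JpolySS V1E U1E !Jpoly0; ring.
- have -> : 2%:P * (1 - 'X) * U k.+2 = 2%:P * 'X * (2%:P * (1 - 'X) * U k.+1) - 2%:P * (1 - 'X) * U k.
    by rewrite JpolySS; ring.
  by rewrite h1 h2 !(JpolySS 1); ring.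
Qed.

(** At [s = 0] the truncated predecessor gives [2 x V_0 = V_1 + V_0], which is right because
    [V_1 = 2 x - 1]. *)
Lemma X_V s : 2%:P * 'X * V s = V s.+1 + V s.-1.
Proof.
case: s => [|s]; first by rewrite V1E Jpoly0; ring.
by rewrite JpolySS subrK.
Qed.

(** [V_s (cos t)] is [cos ((s + 1/2) t) / cos (t/2)]; multiplying by [1 + cos t], twice the square
    of [cos (t/2)], clears the denominator. *)
Lemma V_cos s (t : R) : (V s).[cos t] * (1 + cos t) = cos (s.+1%:R * t) + cos (s%:R * t).
Proof.
have step k : cos (k.+2%:R * t) = 2 * cos t * cos (k.+1%:R * t) - cos (k%:R * t).
  have -> : k.+2%:R * t = k.+1%:R * t + t by rewrite -natr1; ring.
  have -> : k%:R * t = k.+1%:R * t - t by rewrite -natr1; ring.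
  by rewrite cosD cosB; ring.
elim/odd_even_ind: s => [||k h1 h2].
- by rewrite Jpoly0 hornerE mul0r cos0 !mul1r addrC.
- by rewrite V1E !hornerE (step 0%N) !mul1r mul0r cos0; ring.
- rewrite JpolySS !hornerE [k.+3]lock (_ : _ * (1 + cos t) = 2 * cos t * ((V k.+1).[cos t] * (1 + cos t)) - (V k).[cos t] * (1 + cos t)); last by ring.
  by rewrite h1 h2 -lock (step k.+1) (step k); ring.
Qed.

Definition w0 (x : R) : R := (1 - x) `^ (- (1 / 2)) * (1 + x) `^ (1 / 2).

Let w1 (x : R) : R := (1 + x) / Num.sqrt (1 - x ^+ 2).

Let w01 x : -1 < x < 1 -> w0 x = w1 x.
Proof.
move=> /andP[x1 x2]; rewrite /w0 /w1 powRN mul1r !powR12_sqrt; [|lra|lra].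
have h1 : 0 < 1 + x by lra.
have h2 : 0 < 1 - x by lra.
have -> : 1 - x ^+ 2 = (1 - x) * (1 + x) by ring.
rewrite sqrtrM ?ltW// invfM mulrCA; congr (_ * _).
by rewrite -[X in X / _](sqr_sqrtr (ltW h1)) expr2 mulfK// sqrtr_eq0 -ltNge.
Qed.

Lemma w0_ge0 x : 0 <= w0 x.
Proof. by rewrite mulr_ge0 ?powR_ge0. Qed.

Lemma measurable_w0 (D : set R) : measurable_fun D w0.
Proof.
apply: measurable_funTS; apply: measurable_funM.
  have m1 : measurable_fun setT (fun x : R => 1 - x) by exact: measurable_funB.
  by have := measurableT_comp (measurable_powR (- (1 / 2))) m1.
have m1 : measurable_fun setT (fun x : R => 1 + x) by exact: measurable_funD.
by have := measurableT_comp (measurable_powR (1 / 2)) m1.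
Qed.

Let Ck (k : nat) (t : R) : R := if k is 0%N then t else sin (k%:R * t) / k%:R.

Let Ck_derive k (t : R) : is_derive t 1 (Ck k) (cos (k%:R * t)).
Proof.
case: k => [|k]; first by rewrite mul0r cos0; exact: is_derive_id.
have dl : is_derive t 1 (fun t : R => k.+1%:R * t) k.+1%:R.
  have := is_deriveM (is_derive_cst (k.+1%:R : R) t (1 : R)) (is_derive_id t (1 : R)).
  by rewrite /GRing.scale/= mulr0 addr0 mulr1.
have ds := @is_derive1_comp _ sin (fun t : R => k.+1%:R * t) t _ _ (is_derive_sin _) dl.
have := is_deriveM ds (is_derive_cst (k.+1%:R^-1 : R) t (1 : R)).
rewrite /GRing.scale/= mulr0 add0r mulrCA mulVf ?mulr1// pnatr_eq0//.
Qed.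

Let Ck0 k : Ck k 0 = 0.
Proof. by case: k => //= k; rewrite mulr0 sin0 mul0r. Qed.

Let Ckpi k : Ck k pi = if k is 0%N then pi else 0.
Proof.
case: k => //= k; suff -> : sin (k.+1%:R * pi) = 0 :> R by rewrite mul0r.
by elim: k.+1 => [|j IH]; rewrite ?mul0r ?sin0// -natr1 mulrDl mul1r sinD sinpi IH; ring.
Qed.

(** Primitive of [V s] against the weight, from the substitution [x = cos t] and [V_cos]. *)
Let F s x : R := - (Ck s.+1 (acos x) + Ck s (acos x)).

Let F_derive s (x : R) : -1 < x < 1 -> is_derive x 1 (F s) ((V s).[x] * w1 x).
Proof.
move=> hx; have xI : x \in `[-1, 1]%R by rewrite in_itv/=; move: hx => /andP[? ?]; rewrite !ltW.
have da := is_derive1_acos hx.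
have d k := @is_derive1_comp _ (Ck k) acos x _ _ (Ck_derive k _) da.
apply: (is_derive_eq (is_deriveN (is_deriveD (d s.+1) (d s)))).
have := V_cos s (acos x); rewrite acosK// /w1 => h.
by rewrite [RHS]mulrA h; ring.
Qed.

(** The weight is singular at 1, so integrals are first taken between [- cos (th n)] and
    [cos (th n)]. The shift by 2 gives [th n <= 1/2], which keeps the cosine positive. *)
Let th (n : nat) : R := n.+2%:R^-1.
Let cn n := cos (th n).

Let th0 n : 0 < th n. Proof. by rewrite invr_gt0. Qed.

Let th1 n : th n <= 1 / 2.
Proof. by rewrite /th ler_pdivlMr// mulrC ler_pdivrMr// mul1r ler_nat. Qed.

Let th_lim : th @ \oo --> (0 : R).
Proof. by rewrite (cvg_shiftS (@harmonic R)); exact: cvg_harmonic. Qed.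

Let pi2 : 2 <= pi :> R. Proof. exact: pi_ge2. Qed.

Let thI n : th n \in `[0, pi]%R.
Proof. by rewrite in_itv/= ltW//=; have := th1 n; have := pi2; lra. Qed.

Let cn_gt0 n : 0 < cn n.
Proof.
by apply: cos_gt0_pihalf; have := th0 n; have := th1 n; have := pi2; move=> *; apply/andP; split; lra.
Qed.

Let cn_lt1 n : cn n < 1.
Proof. by rewrite -cos0 ltr_cos// in_itv/= lexx pi_ge0. Qed.

Let Fcn s n : F s (cn n) - F s (- cn n) = (Ck s.+1 (pi - th n) + Ck s (pi - th n)) - (Ck s.+1 (th n) + Ck s (th n)).
Proof.
rewrite /F acosN; last by rewrite (ltW (cn_lt1 n)) andbT (le_trans _ (ltW (cn_gt0 n))).
by rewrite /cn cosK ?thI//; ring.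
Qed.

Let Fcn_lim s : (fun n => F s (cn n) - F s (- cn n)) @ \oo --> (if s is 0%N then pi else 0 : R).
Proof.
under eq_fun do rewrite Fcn.
have cC k : continuous (Ck k).
  by move=> t; have [d _] := Ck_derive k t; exact/differentiable_continuous/derivable1_diffP.
have l1 k : (fun n => Ck k (pi - th n)) @ \oo --> Ck k pi.
  apply: (@cvg_comp _ _ _ (fun n => pi - th n) (Ck k)); last exact: cC.
  have h := cvgB (cvg_cst (pi : R)) th_lim; rewrite subr0 in h; exact: h.
have l2 k : (fun n => Ck k (th n)) @ \oo --> 0.
  by rewrite -(Ck0 k); apply: (@cvg_comp _ _ _ th (Ck k)); [exact: th_lim|exact: cC].
have -> : (if s is 0%N then pi else 0 : R) = (Ck s.+1 pi + Ck s pi) - (0 + 0).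
  by rewrite !Ckpi; case: s => [|s]; ring.
by apply: cvgB; apply: cvgD.
Qed.

Let Jn n : set R := `[- cn n, cn n].

Let JnI n x : Jn n x -> -1 < x < 1.
Proof.
by rewrite /Jn /= in_itv/=; have := cn_lt1 n; have := cn_gt0 n => ? ? /andP[? ?]; apply/andP; split; lra.
Qed.

Let FTC_J s n : (\int[mu]_(x in Jn n) ((V s).[x] * w0 x)%:E)%E = (F s (cn n) - F s (- cn n))%:E.
Proof.
have cnn : - cn n < cn n by have := cn_gt0 n; lra.
have inn x : - cn n <= x <= cn n -> -1 < x < 1.
  by move=> h; apply: (@JnI n); rewrite /Jn /= in_itv.
transitivity (\int[mu]_(x in Jn n) ((V s).[x] * w1 x)%:E)%E.
  by apply: eq_integral => x; rewrite inE => /JnI /w01 ->.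
have cF (x : R) : -1 < x < 1 -> {for x, continuous (F s)}.
  by move=> hx; have [d _] := F_derive s hx; exact/differentiable_continuous/derivable1_diffP.
rewrite /Jn (@continuous_FTC2 _ (fun x => (V s).[x] * w1 x) (F s))//.
- apply: continuous_in_subspaceT => x; rewrite inE /= in_itv/= => /inn hx.
  have h0 : 0 < 1 - x ^+ 2 by move: hx => /andP[? ?]; nra.
  apply: cvgM; first exact: continuous_horner.
  apply: cvgM; first by apply: cvgD; [exact: cvg_cst|exact: cvg_id].
  apply: cvgV; first by rewrite sqrtr_eq0 -ltNge.
  apply: (@continuous_comp _ _ _ (fun x : R => 1 - x ^+ 2) Num.sqrt); last exact: sqrt_continuous.
  by apply: cvgB; [exact: cvg_cst|exact: exprn_continuous].
- split.
  + by move=> x; rewrite in_itv/= => /andP[h1 h2]; have [] := @F_derive s x (inn x _); rewrite ?ltW.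
  + by apply: cvg_at_right_filter; apply: cF; apply: inn; rewrite lexx ltW.
  + by apply: cvg_at_left_filter; apply: cF; apply: inn; rewrite lexx ltW.
- move=> x; rewrite in_itv/= => /andP[h1 h2]; rewrite derive1E.
  by have [|_ ->] := @F_derive s x _; [apply: inn; rewrite !ltW|].
Qed.

Let cn_mono n m : (n <= m)%N -> cn n <= cn m.
Proof.
rewrite leq_eqVlt => /predU1P[->//|nm]; apply: ltW; rewrite /cn ltr_cos//.
by rewrite /th ltf_pV2 ?posrE// ltr_nat.
Qed.

Let cn_lim : cn @ \oo --> (1 : R).
Proof.
rewrite -cos0; apply: (@cvg_comp _ _ _ th cos); last exact: continuous_cos.
exact: th_lim.
Qed.

Let cn_near x : -1 < x < 1 -> exists N, forall n, (N <= n)%N -> Jn n x.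
Proof.
move=> /andP[x1 x2].
have : \forall n \near \oo, `|x| < cn n by apply: (cvgr_gt _ cn_lim); rewrite ltr_norml x1.
move=> [N _ hN]; exists N => n Nn; have := hN n Nn.
by rewrite /= ltr_norml /Jn /= in_itv/= => /andP[? ?]; rewrite !ltW.
Qed.

Let mI : measurable I. Proof. by []. Qed.

(** Monotone convergence along the exhausting intervals. The total mass is [pi], whence the factor
    [pi^-1] in [rell]. *)
Lemma integrable_w0 : mu.-integrable I (EFin \o w0).
Proof.
have mE (D : set R) : measurable_fun D (EFin \o w0).
  by apply/measurable_EFinP; exact: measurable_w0.
apply/integrableP; split; first exact: mE.
have -> : (\int[mu]_(x in I) `|(EFin \o w0) x| = \int[mu]_(x in I) (EFin \o w0) x)%E.
  by apply: eq_integral => x _; rewrite gee0_abs// lee_fin w0_ge0.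
rewrite -integral_itv_bndo_bndc// -integral_itv_obnd_cbnd//.
have -> : (`]-1, 1[%classic : set R) = \bigcup_n Jn n.
  apply/seteqP; split => x /=; rewrite in_itv/=.
    by move=> /cn_near[N hN]; exists N => //; exact: hN.
  by move=> [n _ /JnI].
have cJ : (fun i => \int[mu]_(x in Jn i) (EFin \o w0) x)%E @ \oo -->
    (\int[mu]_(x in \bigcup_n Jn n) (EFin \o w0) x)%E.
  apply: ge0_nondecreasing_set_cvg_integral => //.
  - move=> n m nm; apply/subsetPset => x; rewrite /Jn /= !in_itv/= => /andP[h1 h2].
    by have := cn_mono nm; move=> ?; apply/andP; split; lra.
  - by move=> n; exact: measurable_itv.
  - by move=> n; exact: mE.
  - by move=> n x _; rewrite lee_fin w0_ge0.
have eJ : (fun i => \int[mu]_(x in Jn i) (EFin \o w0) x)%E = (fun n => (F 0%N (cn n) - F 0%N (- cn n))%:E).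
  by apply/funext => n; rewrite -FTC_J; apply: eq_integral => x _; rewrite Jpoly0 hornerC mul1r.
have cF : (fun n => (F 0%N (cn n) - F 0%N (- cn n))%:E) @ \oo --> (pi : R)%:E.
  by apply/fine_cvgP; split; [exact: nearW|have h := @Fcn_lim 0%N; exact: h].
by rewrite eJ in cJ; rewrite (cvg_unique _ cJ cF)// ltry.
Qed.

Lemma bmr_horner (p : {poly R}) : bmr I (fun x => p.[x]).
Proof.
split; first by apply: measurable_funTS; apply: continuous_measurable_fun; exact: continuous_horner.
have : compact [set p.[x] | x in I].
  apply: continuous_compact; last exact: segment_compact.
  by apply: continuous_subspaceT; exact: continuous_horner.
move/compact_bounded => [M [_ /(_ (`|M| + 1))]] hM.
exists (`|M| + 1) => x Dx; apply: hM; last by exists x.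
by rewrite ltr_pwDr// ler_norm.
Qed.

Lemma Iw_V s : Iw I w0 (fun x => (V s).[x]) = if s is 0%N then pi else 0.
Proof.
pose f_ n x : R := (V s).[x] * \1_(Jn n) x.
have [K hK] := (bmr_horner (V s)).2.
have ind1 n x : `|\1_(Jn n) x : R| <= 1 by rewrite indicE; case: (_ \in _); rewrite ?normr1 ?normr0.
have [n|n x Ix|x Ix xS|_ cv] := @Iw_lim R I w0 mI integrable_w0 [:: -1; 1] `|K| f_ (fun x => (V s).[x]).
- apply: bmrM; first exact: bmr_horner.
  by split; [apply: measurable_indic; exact: measurable_itv|exists 1 => x _; exact: ind1].
- rewrite normrM -[`|K|]mulr1 ler_pM//.
  by rewrite (le_trans (hK x Ix))// ler_norm.
- have hx : -1 < x < 1.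
    move: Ix xS; rewrite /= in_itv/= !in_cons in_nil orbF negb_or => /andP[h1 h2] /andP[n1 n2].
    by rewrite !lt_neqAle h1 h2 n2 eq_sym n1.
  have [N hN] := cn_near hx.
  rewrite -(cvg_shiftn N); apply: (cvg_trans _ (cvg_cst (V s).[x])).
  apply: near_eq_cvg; apply: nearW => n; rewrite /f_/= indicE mem_set ?mulr1//.
  by apply: hN; exact: leq_addl.
  exact: eventually_filter.
suff e : (fun n => Iw I w0 (f_ n)) = (fun n => F s (cn n) - F s (- cn n)).
  by rewrite e in cv; have h := cvg_unique _ cv (@Fcn_lim s); exact: h.
apply/funext => n.
have -> : F s (cn n) - F s (- cn n) = Rintegral mu (Jn n) (fun x => (V s).[x] * w0 x).
  by rewrite /Rintegral FTC_J.
have -> : Jn n = I `&` Jn n.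
  apply/seteqP; split=> [x Jx|x []//]; split=> //; move/JnI: Jx; rewrite /= in_itv/= => /andP[? ?].
  by rewrite !ltW.
rewrite Rintegral_mkcondr /Iw; apply: eq_Rintegral => x _.
by rewrite /f_ patchE indicE; case: (_ \in _); rewrite ?mulr1// mulr0 mul0r.
Qed.

End ChebyshevWeight.

(** * Orthonormal expansions and the coefficients of each level *)

Section ChebyshevExpansion.
Variable R : realType.
Local Notation mu := (@lebesgue_measure R).
Local Notation I := (`[-1, 1]%classic : set R).
Local Notation C := R[i].
Local Notation V s := (Jpoly R 1 s).
Local Notation U s := (Jpoly R 0 s).

Let mI : measurable I. Proof. by []. Qed.

Definition rell (f : R -> R) : R := pi^-1 * Iw I (@w0 R) f.

Let iw := @integrable_w0 R.

Lemma rellD f h : bmr I f -> bmr I h -> rell (fun x => f x + h x) = rell f + rell h.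
Proof. by move=> bf bh; rewrite /rell (IwD mI iw)// mulrDr. Qed.

Lemma rellB f h : bmr I f -> bmr I h -> rell (fun x => f x - h x) = rell f - rell h.
Proof. by move=> bf bh; rewrite /rell (IwB mI iw)// mulrBr. Qed.

Lemma rellZ c f : bmr I f -> rell (fun x => c * f x) = c * rell f.
Proof. by move=> bf; rewrite /rell (IwZ mI iw)// mulrCA. Qed.

Lemma rell0 : rell (fun=> 0) = 0.
Proof.
have b0 := bmr_cst I 0; have h := rellB b0 b0; rewrite [RHS]subrr in h.
by rewrite -[RHS]h; congr rell; apply/funext => x; rewrite subrr.
Qed.

Lemma rell_ge0 f : (forall x, 0 <= f x) -> 0 <= rell f.
Proof.
move=> f0; rewrite mulr_ge0 ?invr_ge0 ?pi_ge0//; apply: Rintegral_ge0 => x _.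
by rewrite mulr_ge0// w0_ge0.
Qed.

Lemma rell_V s : rell (fun x => (V s).[x]) = (s == 0%N)%:R.
Proof.
by rewrite /rell Iw_V; case: s => [|s]; rewrite ?mulr0// mulVf// gt_eqF// pi_gt0.
Qed.

(** Induction on [t]: the recurrence moves the multiplication by [2 x] from one factor to the other,
    down to integrals of a single [V s]. *)
Lemma rell_VV s t : rell (fun x => (V s).[x] * (V t).[x]) = (s == t)%:R.
Proof.
have bV k := bmr_horner (V k).
move: s; elim/odd_even_ind: t => [s||t h1 h2 s].
- by rewrite -rell_V; congr rell; apply/funext => x; rewrite Jpoly0 hornerC mulr1.
- move=> s; have -> : (fun x => (V s).[x] * (V 1).[x]) = (fun x => ((V s.+1).[x] + (V s.-1).[x]) - (V s).[x]).
    apply/funext => x; rewrite -[X in X - _]hornerD -X_V V1E !hornerE; ring.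
  rewrite rellB; [|exact: bmrD|by []]; rewrite rellD// !rell_V.
  by case: s => [|[|s]] /=; ring.
- have -> : (fun x => (V s).[x] * (V t.+2).[x]) =
      (fun x => ((V s.+1).[x] * (V t.+1).[x] + (V s.-1).[x] * (V t.+1).[x]) - (V s).[x] * (V t).[x]).
    apply/funext => x; rewrite -[X in X - _]mulrDl -hornerD -X_V JpolySS !hornerE; ring.
  rewrite rellB; [|by apply: bmrD; exact: bmrM|exact: bmrM].
  rewrite rellD ?h2 ?h1; [|exact: bmrM|exact: bmrM].
  by rewrite eqSS addrAC subrr add0r; case: s.
Qed.

Lemma bessel f : bmr I f -> (fun s => rell (fun x => (V s).[x] * f x)) @ \oo --> 0.
Proof.
move=> bf; set c := fun s => rell (fun x => (V s).[x] * f x).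
have bV k := bmr_horner (V k).
pose gf n x : R := f x - \sum_(s < n) c s * (V s).[x].
have bg n : bmr I (gf n).
  apply: bmrB => //; elim: n => [|n IH].
    by apply: eq_bmr (bmr_cst I 0) => x _; rewrite big_ord0.
  by apply: eq_bmr (bmrD IH (bmrM (bmr_cst I (c n)) (bV n))) => x _; rewrite big_ord_recr.
have gS n x : gf n.+1 x = gf n x - c n * (V n).[x].
  by rewrite /gf big_ord_recr/= opprD addrA.
have Vg k n : (n <= k)%N -> rell (fun x => (V k).[x] * gf n x) = c k.
  elim: n => [_|n IH nk].
    by congr rell; apply/funext => x; rewrite /gf big_ord0 subr0.
  have -> : (fun x => (V k).[x] * gf n.+1 x) = (fun x => (V k).[x] * gf n x - c n * ((V k).[x] * (V n).[x])).
    by apply/funext => x; rewrite gS; ring.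
  rewrite rellB; [|exact: bmrM|by apply: bmrM; [exact: bmr_cst|exact: bmrM]].
  rewrite rellZ; last exact: bmrM.
  by rewrite IH ?(ltnW nk)// rell_VV gtn_eqF// mulr0 subr0.
have key n : rell (fun x => gf n x ^+ 2) = rell (fun x => f x ^+ 2) - \sum_(0 <= s < n) c s ^+ 2.
  elim: n => [|n IH].
    by rewrite big_nil subr0; congr rell; apply/funext => x; rewrite /gf big_ord0 subr0.
  have -> : (fun x => gf n.+1 x ^+ 2) = (fun x => (gf n x ^+ 2 - (2 * c n) * ((V n).[x] * gf n x)) + c n ^+ 2 * ((V n).[x] * (V n).[x])).
    by apply/funext => x; rewrite gS; ring.
  have b1 : bmr I (fun x => gf n x ^+ 2) by apply: eq_bmr (bmrM (bg n) (bg n)) => x _; rewrite expr2.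
  have b2 := bmrM (bV n) (bg n); have b3 := bmrM (bV n) (bV n).
  have b4 := bmrM (bmr_cst I (2 * c n)) b2; have b5 := bmrM (bmr_cst I (c n ^+ 2)) b3.
  rewrite rellD//; last exact: bmrB.
  by rewrite rellB// !rellZ// Vg// rell_VV eqxx IH big_nat_recr//=; ring.
have cs : cvgn (series (fun s => c s ^+ 2)).
  apply: nondecreasing_is_cvgn; first by apply: nondecreasing_series => n _ _; exact: sqr_ge0.
  exists (rell (fun x => f x ^+ 2)) => _ [n _ <-]; rewrite -subr_ge0 /series/= -key.
  by apply: rell_ge0 => x; exact: sqr_ge0.
have c2 := cvg_series_cvg_0 cs.
apply/norm_cvg0P; rewrite -(@sqrtr0 R).
under eq_fun do rewrite -sqrtr_sqr.
exact: cvg_comp c2 (@sqrt_continuous R _).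
Qed.

Definition ell (f : R -> C) : C := (pi^-1)%:C * Cw I (@w0 R) f.

Lemma ellE f : ell f = rell (fun x => complex.Re (f x)) +i* rell (fun x => complex.Im (f x)).
Proof. by rewrite /ell CwE /rell; simpc. Qed.

Lemma ell0 : ell (fun=> 0) = 0.
Proof. by rewrite ellE /= rell0. Qed.

Lemma ellD f h : bmc I f -> bmc I h -> ell (fun x => f x + h x) = ell f + ell h.
Proof. by move=> bf bh; rewrite /ell (CwD mI iw)// mulrDr. Qed.

Lemma ellB f h : bmc I f -> bmc I h -> ell (fun x => f x - h x) = ell f - ell h.
Proof. by move=> bf bh; rewrite /ell (CwB mI iw)// mulrBr. Qed.

Lemma ellZ c f : bmc I f -> ell (fun x => c * f x) = c * ell f.
Proof. by move=> bf; rewrite /ell (CwZ mI iw)// mulrCA. Qed.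

Lemma ell_sum (J : Type) (r : seq J) (P : pred J) (F : J -> R -> C) :
  (forall i, P i -> bmc I (F i)) ->
  ell (fun x => \sum_(i <- r | P i) F i x) = \sum_(i <- r | P i) ell (F i).
Proof. by move=> bF; rewrite /ell (Cw_sum mI iw)// mulr_sumr. Qed.

Lemma ell_off (S : seq R) f h : bmc I h -> (forall x, I x -> x \notin S -> f x = h x) -> ell f = ell h.
Proof. by move=> bh fh; rewrite /ell (Cw_off mI iw (S := S) bh fh). Qed.

(* For even [n] the factor [2 (1 - x)] turns the weight with exponent [-1/2] into the one with exponent [1/2]. *)
Definition wt (n : nat) (x : R) : R := if odd n then 1 else 2 * (1 - x).

(** All levels are written against the same weight [w0], so that coefficients at adjacent levels can
    be compared under one integral. *)
Definition coefJ (n s : nat) (f : R -> C) : C :=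
  ell (fun x => ((Jpoly R n s).[x])%:C * f x * (wt n x)%:C).

Lemma Jpoly_parity n s : Jpoly R n s = Jpoly R (odd n) s.
Proof. by rewrite /Jpoly oddb. Qed.

Lemma bmc_horner (p : {poly R}) : bmc I (fun x => (p.[x])%:C).
Proof. by apply: bmc_real; exact: bmr_horner. Qed.

Lemma wtE n x : wt n x = (if odd n then 1 else 2%:P * (1 - 'X) : {poly R}).[x].
Proof. by rewrite /wt; case: ifP => _; rewrite !hornerE. Qed.

Lemma bmc_wt n : bmc I (fun x => (wt n x)%:C).
Proof. by apply: eq_bmc (bmc_horner _) => x _; rewrite wtE. Qed.

Lemma bmc_coefJ n s f : bmc I f -> bmc I (fun x => ((Jpoly R n s).[x])%:C * f x * (wt n x)%:C).
Proof. by move=> bf; apply: bmcM; [apply: bmcM => //; exact: bmc_horner|exact: bmc_wt]. Qed.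

Lemma coefJD n s f h : bmc I f -> bmc I h -> coefJ n s (fun x => f x + h x) = coefJ n s f + coefJ n s h.
Proof.
move=> bf bh; rewrite /coefJ -ellD; [|exact: bmc_coefJ|exact: bmc_coefJ].
by congr ell; apply/funext => x; ring.
Qed.

Lemma coefJZ n s c f : bmc I f -> coefJ n s (fun x => c * f x) = c * coefJ n s f.
Proof.
move=> bf; rewrite /coefJ -ellZ; last exact: bmc_coefJ.
by congr ell; apply/funext => x; ring.
Qed.

Lemma coefJ_sum n s (J : Type) (r : seq J) (P : pred J) (F : J -> R -> C) :
  (forall i, P i -> bmc I (F i)) ->
  coefJ n s (fun x => \sum_(i <- r | P i) F i x) = \sum_(i <- r | P i) coefJ n s (F i).
Proof.
move=> bF; rewrite /coefJ -ell_sum; last by move=> i Pi; apply: bmc_coefJ; exact: bF.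
by congr ell; apply/funext => x; rewrite mulr_sumr mulr_suml.
Qed.

Lemma coefJ_off n s (S : seq R) f h : bmc I h -> (forall x, I x -> x \notin S -> f x = h x) ->
  coefJ n s f = coefJ n s h.
Proof.
move=> bh fh; apply: (ell_off (S := S)); first exact: bmc_coefJ.
by move=> x Ix xS; rewrite fh.
Qed.

Lemma coefJ_odd n s f : odd n -> coefJ n s f = ell (fun x => ((V s).[x])%:C * f x).
Proof.
by move=> on; rewrite /coefJ /wt on Jpoly_parity on; congr ell; apply/funext => x; rewrite mulr1.
Qed.

(** By [U_V] the factor that changes the weight also turns the polynomials of even levels into
    differences of those of odd levels. *)
Lemma coefJ_even n s f : ~~ odd n -> bmc I f ->
  coefJ n s f = ell (fun x => ((V s).[x])%:C * f x) - ell (fun x => ((V s.+1).[x])%:C * f x).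
Proof.
move=> /negPf en bf; rewrite -ellB; [|by apply: bmcM => //; exact: bmc_horner|by apply: bmcM => //; exact: bmc_horner].
rewrite /coefJ /wt en Jpoly_parity en; congr ell; apply/funext => x.
rewrite -mulrBl -rmorphB/= -hornerN -hornerD -U_V mulrAC -rmorphM; congr (_ * _).
apply: (congr1 (real_complex R)); rewrite !hornerE /=.
by ring.
Qed.

Lemma ell_V_lim f : bmc I f -> ccvg (fun s => ell (fun x => ((V s).[x])%:C * f x)) 0.
Proof.
move=> [f1 f2]; split => /=.
  have -> : (fun s => complex.Re (ell (fun x => ((V s).[x])%:C * f x))) = (fun s => rell (fun x => (V s).[x] * complex.Re (f x))); last exact: bessel.
  apply/funext => s; rewrite ellE /=; congr rell; apply/funext => x.
  by rewrite ReM /= mul0r subr0.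
have -> : (fun s => complex.Im (ell (fun x => ((V s).[x])%:C * f x))) = (fun s => rell (fun x => (V s).[x] * complex.Im (f x))); last exact: bessel.
apply/funext => s; rewrite ellE /=; congr rell; apply/funext => x.
by rewrite ImM /= mul0r addr0.
Qed.

Lemma coefJ_lim n f : bmc I f -> ccvg (fun s => coefJ n s f) 0.
Proof.
move=> bf; have h := ell_V_lim bf.
have [on|en] := boolP (odd n); first by apply: eq_ccvg h => s; rewrite coefJ_odd.
have h1 := proj2 (ccvg_shift _ _ 1) h.
have := ccvgB h h1; rewrite subrr; apply: eq_ccvg => s.
by rewrite (coefJ_even s en bf) addn1.
Qed.

Lemma ell_VV s t : ell (fun x => ((V s).[x])%:C * ((V t).[x])%:C) = (s == t)%:R.
Proof.
have -> : (fun x => ((V s).[x])%:C * ((V t).[x])%:C) = (fun x => ((V s).[x] * (V t).[x])%:C).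
  by apply/funext => x; rewrite rmorphM.
rewrite ellE /= rell_VV -(rmorph_nat (real_complex R)); congr (_ +i* _).
by rewrite -[RHS]rell0; congr rell; apply/funext => x /=; ring.
Qed.

Lemma coefJ_J n s t : coefJ n s (fun x => ((Jpoly R n t).[x])%:C) = (s == t)%:R.
Proof.
have [on|en] := boolP (odd n).
  by rewrite coefJ_odd// (Jpoly_parity n) on ell_VV.
rewrite coefJ_even//; last exact: bmc_horner.
rewrite (Jpoly_parity n) (negPf en).
(* By [V_U], [U_t] is the sum of [V_0, ..., V_t]. *)
have h k : ell (fun x => ((V k).[x])%:C * ((U t).[x])%:C) = (k <= t)%:R.
  elim: t => [|t IH].
    rewrite leqn0 -ell_VV; congr ell; apply/funext => x.
  have -> : (fun x => ((V k).[x])%:C * ((U t.+1).[x])%:C) =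
      (fun x => ((V k).[x])%:C * ((V t.+1).[x])%:C + ((V k).[x])%:C * ((U t).[x])%:C).
    by apply/funext => x; rewrite -mulrDr -rmorphD/= -hornerD V_U subrK.
  rewrite ellD ?IH ?ell_VV; [|by apply: bmcM; exact: bmc_horner|by apply: bmcM; exact: bmc_horner].
  by rewrite [RHS](_ : _ = (k == t.+1)%:R + (k <= t)%:R)//; rewrite leq_eqVlt ltnS; case: eqP => [->|_]; rewrite ?ltnn ?add0r ?addr0.
by rewrite !h; case: ltngtP; rewrite ?subrr ?subr0.
Qed.

Lemma sum_coefJ_odd n f a L : odd n -> bmc I f -> (a <= L)%N ->
  \sum_(a <= y < L) coefJ n.+1 y f = coefJ n a f - coefJ n L f.
Proof.
move=> on bf aL; under eq_bigr do rewrite coefJ_even//= ?on//.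
rewrite !(coefJ_odd _ _ on) -opprB -(telescope_sumr (fun y => ell (fun x => ((V y).[x])%:C * f x)) aL).
by rewrite -sumrN; apply: eq_bigr => y _; rewrite opprB.
Qed.

(** The constant [v] is seen by [V_0] only, where it takes the place of a coefficient of index -1.
    Up to the boundary term it is the whole sum from [a = 0], and this is how a row turns
    constant. *)
Lemma sum_coefJ_even n f v a L : ~~ odd n -> bmc I f -> (a <= L)%N -> (0 < L)%N ->
  \sum_(a <= y < L) coefJ n.+1 y (fun x => (2 * (x - 1))%:C * f x + v) =
  (if a is a'.+1 then coefJ n a' f else v) - coefJ n L.-1 f.
Proof.
move=> en bf aL L0; pose D y := if y is y'.+1 then coefJ n y' f else v.
have b1 : bmc I (fun x => (2 * (x - 1))%:C * f x).
  apply: bmcM => //; by apply: eq_bmc (bmc_horner (2%:P * ('X - 1))) => x _; rewrite !hornerE.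
have e y : coefJ n.+1 y (fun x => (2 * (x - 1))%:C * f x + v) = D y - D y.+1.
  rewrite coefJD//; last exact: bmc_cst.
  have -> : coefJ n.+1 y (fun=> v) = if y is 0%N then v else 0.
    rewrite -[v]mulr1 coefJZ; last exact: bmc_cst.
    have := coefJ_J n.+1 y 0; rewrite Jpoly0; under eq_fun do rewrite hornerC.
    by move=> ->; case: y => [|y]; rewrite ?mulr1 ?mulr0.
  rewrite coefJ_odd /=; last by rewrite en.
  have -> : (fun x => ((V y).[x])%:C * ((2 * (x - 1))%:C * f x)) =
     (fun x => (if y is y'.+1 then ((U y').[x])%:C * f x * (wt n x)%:C else 0) - ((U y).[x])%:C * f x * (wt n x)%:C).
    apply/funext => x; rewrite /wt (negPf en); case: y => [|y].
      by rewrite !Jpoly0 sub0r !hornerC !mul1r -mulrN -rmorphN mulrC; congr (_ * _%:C); ring.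
    by rewrite V_U !hornerE !rmorphB !rmorphM !rmorphB/=; ring.
  have bU k : bmc I (fun x => ((U k).[x])%:C * f x * (wt n x)%:C).
    by have := bmc_coefJ n k bf; rewrite Jpoly_parity (negPf en).
  have cU k : coefJ n k f = ell (fun x => ((U k).[x])%:C * f x * (wt n x)%:C).
    by rewrite /coefJ Jpoly_parity (negPf en).
  case: y => [|y]; rewrite /D !cU ellB//; [|exact: bmc_cst|by rewrite addr0].
  by rewrite ell0 sub0r addrC.
under eq_bigr do rewrite e.
have -> : coefJ n L.-1 f = D L by case: L aL L0.
rewrite -[RHS]opprB -(telescope_sumr D aL) -sumrN.
by apply: eq_bigr => y _; rewrite opprB.
Qed.

Lemma eq_cint (B : set R) (f h : R -> C) : (forall x, B x -> f x = h x) -> cint B f = cint B h.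
Proof.
by move=> fh; rewrite /cint; congr (_ +i* _); apply: eq_Rintegral => x /set_mem /fh ->.
Qed.

Lemma innerpE n f h : bmc I f -> bmc I h ->
  innerp n f h = ell (fun x => f x * h x * (wt n x)%:C).
Proof.
move=> bf bh; rewrite /innerp /Defs.cst /alph /ell /wt; case: ifP => on.
  have -> : - (1 / 2) + 1 / 2 = 0 :> R by lra.
  rewrite powRr0 mul1r; congr (_ * _); congr (cint _ _).
  by apply/funext => x; rewrite mulr1.
have -> : 1 / 2 + 1 / 2 = 1 :> R by lra.
rewrite (powRr1 (ler0n R 2)) rmorphM /= -mulrA mulrCA; congr (_ * _).
have -> : cint I (fun x => f x * h x * ((1 - x) `^ (1 / 2) * (1 + x) `^ (1 / 2))%:C) =
    Cw I (@w0 R) (fun x => f x * h x * (1 - x)%:C).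
  have e x : I x -> f x * h x * ((1 - x) `^ (1 / 2) * (1 + x) `^ (1 / 2))%:C =
      f x * h x * (1 - x)%:C * (w0 x)%:C.
    rewrite /= in_itv/= => /andP[_ x1]; rewrite -[RHS]mulrA; congr (_ * _).
    rewrite -rmorphM /w0 mulrA /=; congr ((_ * _)%:C).
    (* At [x = 1] the exponents cannot be added, but both sides are 0. *)
    have [->|y0] := eqVneq (1 - x) 0; first by rewrite mul0r powR0//; lra.
    rewrite -{2}(@powRr1 _ (1 - x)) ?subr_ge0// -powRD; last by rewrite y0 implybT.
    by congr (_ `^ _); lra.
  exact: eq_cint.
rewrite -(CwZ mI iw); last first.
  apply: bmcM; first exact: bmcM.
  by apply: eq_bmc (bmc_horner (1 - 'X)) => x _; rewrite !hornerE.
by congr Cw; apply/funext => x; rewrite rmorphM/=; ring.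
Qed.

End ChebyshevExpansion.

(** * Determinants bordered by a point configuration *)

Section DetRows.
Variable K : comNzRingType.

(** Multilinearity: each of the first [s] lower rows depends on its own coordinate of [y] only, and
    independent constraints let the sum distribute over the product of these rows. *)
Lemma sum_det_rows (k r s : nat) (T : finType) (Up : 'M[K]_(k, k + r)) (le_sr : (s <= r)%N)
    (rho : T -> 'I_(k + r) -> K) (virt : 'I_r -> 'I_(k + r) -> K) (F : 'I_s -> pred T) :
  \sum_(y : {ffun 'I_s -> T} | y \in family F)
    \det (col_mx Up (\matrix_(i < r, c < k + r) if insub (val i) is Some i' then rho (y i') c else virt i c)) =
  \det (col_mx Up (\matrix_(i < r, c < k + r) if insub (val i) is Some i' then \sum_(t | F i' t) rho t c else virt i c)).
Proof.
pose e (i : 'I_s) : 'I_(k + r) := rshift k (widen_ord le_sr i).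
have e_inj : injective e by move=> i j /rshift_inj /(congr1 val) /= h; apply: val_inj.
pose P := (e @: [set: 'I_s])%SET.
have Pe i : e i \in P by apply: imset_f; rewrite inE.
have rowP (M : 'I_s -> 'I_(k + r) -> K) (sg : 'I_(k + r) -> 'I_(k + r)) :
    \prod_i (col_mx Up (\matrix_(i < r, c < k + r) if insub (val i) is Some i' then M i' c else virt i c)) i (sg i) =
    \prod_(i' < s) M i' (sg (e i')) *
    \prod_(i | i \notin P) (col_mx Up (\matrix_(i, c) virt i c)) i (sg i).
  rewrite (bigID (mem P))/=; congr (_ * _).
    rewrite (big_imset _ (in2W e_inj))/=; apply: eq_big => [i|i _].
  by rewrite inE.
    rewrite col_mxEd mxE; case: insubP => [u _ /= uE|/=]; last by rewrite ltn_ord.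
    by congr (M _ _); apply: val_inj.
  apply: eq_bigr => i iP; rewrite -(splitK i); case: splitP => j /= jE.
    by rewrite !col_mxEu.
  rewrite !col_mxEd !mxE; case: insubP => //= u us uE.
  case/negP: iP; rewrite (_ : i = e u) ?Pe//; apply: val_inj.
  by rewrite /= jE -uE.
rewrite /determinant.
under eq_bigr => y _ do under eq_bigr => sg _ do rewrite (rowP (fun i' c => rho (y i') c)).
rewrite exchange_big; apply: eq_bigr => sg _ /=.
under eq_bigr do rewrite mulrA.
rewrite -mulr_suml -mulr_sumr rowP mulrA; congr (_ * _ * _).
by rewrite (bigA_distr_big_dep (fun i t => F i t) (fun i t => rho t (sg (e i)))).
Qed.

(** A row summed over its interlacing interval is a difference of two tail sums. Subtracting the
    neighbouring row is a unitriangular operation, so full tail sums may replace the differences. *)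
Lemma det_telescope (k r s : nat) (Up : 'M[K]_(k, k + r)) (Rf : nat -> 'I_(k + r) -> K)
    (virt : 'I_r -> 'I_(k + r) -> K) :
  \det (col_mx Up (\matrix_(i < r, c < k + r) if (i < s)%N then
      Rf i c - (if val i is i'.+1 then Rf i' c else 0) else virt i c)) =
  \det (col_mx Up (\matrix_(i < r, c < k + r) if (i < s)%N then Rf i c else virt i c)).
Proof.
set L := \matrix_(i, c) _; set L' := \matrix_(i, c) if _ then Rf i c else _.
pose D : 'M[K]_r := \matrix_(i, j) ((i == j)%:R - ((i < s)%N && (val i == j.+1))%:R).
have -> : L = D *m L'.
  apply/matrixP => i c; rewrite !mxE.
  under eq_bigr do rewrite !mxE mulrBl.
  rewrite sumrB (bigD1 i)//= eqxx mul1r big1 ?addr0; last first.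
    by move=> j ji; rewrite eq_sym (negPf ji) mul0r.
  case: ifP => is_; last by rewrite big1 ?subr0// => j _; rewrite mul0r.
  congr (_ - _); case: i is_ => [[|i'] hi] /= is_.
    by rewrite big1// => j _; rewrite mul0r.
  have hi' : (i' < r)%N by apply: ltnW.
  rewrite (bigD1 (Ordinal hi'))//= eqxx mul1r big1 ?addr0 ?(ltnW is_)//.
  by move=> j; rewrite eqSS => /negPf; rewrite -val_eqE /= eq_sym => ->; rewrite mul0r.
have -> : col_mx Up (D *m L') = block_mx 1%:M 0 0 D *m col_mx Up L'.
  by rewrite mul_block_col mul1mx !mul0mx addr0 add0r.
rewrite det_mulmx det_ublock det1 mul1r (_ : \det D = 1) ?mul1r//.
rewrite det_trig; last first.
  apply/is_trig_mxP => i j ij; rewrite mxE -val_eqE (ltn_eqF ij) sub0r.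
  by rewrite (ltn_eqF (ltnW (ij : (i < j)%N) : (i < j.+1)%N)) andbF oppr0.
by apply: big1 => i _; rewrite mxE eqxx (ltn_eqF (ltnSn _)) andbF subr0.
Qed.

(** * Descent by one level *)

Section Levels.
Variables (k r : nat) (z : 'I_k -> nat * nat).
Hypothesis z_inj : injective z.
Variables (rk : nat -> nat) (rho : nat -> nat -> 'I_(k + r) -> K) (v : 'I_(k + r) -> nat -> K).
Hypothesis rho_below : forall p m s, ((z p).2 < m)%N -> rho m s (lshift r p) = 0.
Hypothesis rho_level : forall p s, rho (z p).2 s (lshift r p) = (s == (z p).1)%:R.
Hypothesis v_above : forall p i, (rk (z p).2 <= i)%N -> v (lshift r p) i = 0.

(* Columns [lshift r p] stand for the prescribed points [z p], and columns [rshift k j] for the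
   columns of the weight of the last level. *)
Definition rho_above (m s : nat) (c : 'I_(k + r)) : K :=
  if fintype.split c is inl p then (if (m < (z p).2)%N then rho m s c else 0) else rho m s c.

(** For a point above [m] the row carries the condition imposed on the levels already summed. For a
    point at [m] or below it is a unit vector, and [rho_above] clears the column of that point in
    the particle rows. *)
Definition upper (m : nat) : 'M[K]_(k, k + r) :=
  \matrix_(p, c) ((lshift r p == c)%:R - (if (m < (z p).2)%N then rho (z p).2 (z p).1 c else 0)).

Definition lower (h : nat -> 'I_(k + r) -> K) (m : nat) : 'M[K]_(r, k + r) :=
  \matrix_(i, c) if (i < rk m)%N then h i c else v c i.

(* The rows [i >= rk m] are virtual: they hold the constants that appear when summing a row over all
   positions. *)
Definition levdet (m : nat) (x : nat -> nat) : K :=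
  \det (col_mx (upper m) (lower (fun i => rho_above m (x i)) m)).

(* Subtracting from row [p] the row of the particle sitting at [z p] replaces it by a unit vector. *)
Lemma levdet_hit (m : nat) (y : nat -> nat) :
  (forall p, (z p).2 = m.+1 -> exists2 i : 'I_r, (i < rk m.+1)%N & y i = (z p).1) ->
  \det (col_mx (upper m) (lower (fun i => rho m.+1 (y i)) m.+1)) = levdet m.+1 y.
Proof.
move=> hit.
set L := lower _ _.
pose S : 'M[K]_(k, r) := \matrix_(p, i)
  (((z p).2 == m.+1) && ([pick i : 'I_r | (i < rk m.+1)%N && (y i == (z p).1)] == Some i))%:R.
have U1 : upper m.+1 = upper m + S *m L.
  apply/matrixP => p c; rewrite !mxE.
  under eq_bigr do rewrite !mxE.
  have [pm|pm] := eqVneq (z p).2 m.+1; last first.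
    rewrite big1 ?addr0; last by move=> i _; rewrite mul0r.
    by congr (_ - _); rewrite ltn_neqAle eq_sym pm.
  rewrite pm ltnn ltnSn subr0 -addrA -[LHS]addr0; congr (_ + _).
  have [i0 hi0 yi0] := hit p pm.
  case: pickP => [i1 /andP[hi1 /eqP yi1]|/(_ i0)]; last by rewrite hi0 yi0 eqxx.
  rewrite (bigD1 i1)//= eqxx mul1r hi1 yi1 big1 ?addr0 ?addNr// => i ii1.
  by rewrite (_ : (Some i1 == Some i) = false) ?mul0r//; apply/negbTE; apply: contra ii1 => /eqP[->].
(* Clears, in the particle rows, the columns of the points on level [m.+1], whose rows in
   [upper m.+1] are unit vectors. *)
pose B : 'M[K]_(r, k) := \matrix_(i, q)
  (if (i < rk m.+1)%N && ((z q).2 == m.+1) then rho m.+1 (y i) (lshift r q) else 0).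
have L1 : lower (fun i => rho_above m.+1 (y i)) m.+1 = L - B *m upper m.+1.
  apply/matrixP => i c; rewrite !mxE.
  have -> : \sum_j B i j * upper m.+1 j c = \sum_j (if (i < rk m.+1)%N && ((z j).2 == m.+1) then
      rho m.+1 (y i) (lshift r j) else 0) * (lshift r j == c)%:R.
    apply: eq_bigr => j _; rewrite !mxE; case: ifP; last by rewrite !mul0r.
    by move=> /andP[_ /eqP ->]; rewrite ltnn subr0.
  case: ifP => im; last by rewrite big1 ?subr0// => j _; rewrite mul0r.
  rewrite /rho_above; have := splitK c; case: (fintype.split c) => q /= <-.
    rewrite (bigD1 q)//= eqxx mulr1 big1 ?addr0; last first.
      by move=> j jq; rewrite (inj_eq (@lshift_inj _ _)) (negPf jq) mulr0.
    case: ltngtP => h; rewrite ?subr0 ?subrr//.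
    by rewrite rho_below.
  by rewrite big1 ?subr0// => j _; rewrite eq_lrshift mulr0.
have -> : col_mx (upper m) L = block_mx 1%:M (- S) 0 1%:M *m (block_mx 1%:M 0 B 1%:M *m
    col_mx (upper m.+1) (lower (fun i => rho_above m.+1 (y i)) m.+1)).
  rewrite mul_block_col !mul1mx mul0mx addr0 mul_block_col !mul1mx mul0mx add0r L1 (addrC (B *m _)) subrK.
  by rewrite U1 mulNmx addrK.
by rewrite !det_mulmx det_ublock det_lblock !det1 !mul1r.
Qed.

(** Column [p] vanishes: in the particle rows it tests whether a particle sits at [z p], in its own
    row it is [1 - 1], and another point of the same level has a different position by
    injectivity. *)
Lemma levdet_miss (m : nat) (y : nat -> nat) (p : 'I_k) : (z p).2 = m.+1 ->
  (forall i, (i < rk m.+1)%N -> y i != (z p).1) ->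
  \det (col_mx (upper m) (lower (fun i => rho m.+1 (y i)) m.+1)) = 0.
Proof.
move=> pm miss; rewrite (expand_det_col _ (lshift r p)) big1// => i _.
suff -> : col_mx (upper m) (lower (fun i => rho m.+1 (y i)) m.+1) i (lshift r p) = 0 by rewrite mul0r.
rewrite -(splitK i); case: (fintype.split i) => j /=.
  rewrite col_mxEu mxE (inj_eq (@lshift_inj _ _)).
  have [->|jp] := eqVneq j p; first by rewrite pm ltnSn -{1}pm rho_level eqxx subrr.
  case: ifP => jm; last by rewrite subr0.
  have [jm1|jm1] := eqVneq (z j).2 m.+1.
    rewrite jm1 -pm rho_level (_ : (z j).1 == (z p).1 = false) ?subr0//.
    apply/negbTE; apply: contra jp => /eqP h; apply/eqP; apply: z_inj.
    by rewrite [z j]surjective_pairing [z p]surjective_pairing h jm1 pm.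
  by rewrite rho_below ?subr0// pm ltn_neqAle eq_sym jm1.
rewrite col_mxEd mxE; case: ltnP => ji; last by rewrite v_above// pm.
by rewrite -{1}pm rho_level (negPf (miss _ ji)).
Qed.

(** By [levdet_hit] and [levdet_miss] the condition that all points of level [m.+1] are hit is
    absorbed into one determinant, so [sum_det_rows] applies to all positions in the intervals. *)
Lemma sum_levdet (m L : nat) (a : nat -> nat) : (rk m.+1 <= r)%N ->
  (forall i, a i.+1 <= a i)%N -> (a 0%N <= L)%N ->
  \sum_(y : {ffun 'I_(rk m.+1) -> 'I_L} |
      y \in family (fun (i : 'I_(rk m.+1)) (t : 'I_L) => (a i <= val t)%N && (val t < if val i is i'.+1 then a i' else L)%N))
    (if [forall p : 'I_k, ((z p).2 == m.+1) ==> [exists i, val (y i) == (z p).1]]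
     then levdet m.+1 (fun i => if insub i is Some i' then val (y i') else 0%N) else 0) =
  \det (col_mx (upper m)
    (lower (fun i c => \sum_(a i <= t < L) rho m.+1 t c) m.+1)).
Proof.
move=> rkr a_le a0L; pose F (i : 'I_(rk m.+1)) (t : 'I_L) := (a i <= val t)%N && (val t < if val i is i'.+1 then a i' else L)%N; rewrite -/F.
have aL i : (a i <= L)%N.
  by elim: i => // i IH; rewrite (leq_trans (a_le i)).
transitivity (\sum_(y : {ffun 'I_(rk m.+1) -> 'I_L} | y \in family F)
  \det (col_mx (upper m) (\matrix_(i < r, c < k + r) if insub (val i) is Some i' then rho m.+1 (val (y i')) c else v c i))).
  apply: eq_bigr => y _; pose yy (i : nat) : nat := if insub i is Some i' then val (y i') else 0%N; rewrite -/yy.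
  have e : \det (col_mx (upper m) (\matrix_(i < r, c < k + r) if insub (val i) is Some i' then rho m.+1 (val (y i')) c else v c i)) =
     \det (col_mx (upper m) (lower (fun i => rho m.+1 (yy i)) m.+1)).
    congr (\det (col_mx _ _)); apply/matrixP => i c; rewrite !mxE /yy.
    have [im|im] := boolP (i < rk m.+1)%N; last by rewrite insubN.
by rewrite !(insubT (fun x => x < rk m.+1)%N im).
  rewrite e; case: ifP => [/forallP hit|/negbT].
    rewrite levdet_hit// => p pm; have := hit p; rewrite pm eqxx /= => /existsP[i /eqP yi].
    exists (widen_ord rkr i); rewrite /= ?ltn_ord// /yy insubT//= => hi.
    by rewrite -yi; congr (val (y _)); apply: val_inj.
  rewrite negb_forall => /existsP[p]; rewrite negb_imply => /andP[/eqP pm].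
  rewrite negb_exists => /forallP miss; rewrite (@levdet_miss m yy p)// => i hi.
  by rewrite /yy insubT; exact: miss.
rewrite (@sum_det_rows k r _ _ _ rkr (fun t : 'I_L => rho m.+1 (val t)) (fun i c => v c i) F).
rewrite -(det_telescope (rk m.+1) (upper m) (fun i c => \sum_(a i <= t < L) rho m.+1 t c) (fun i c => v c i)).
congr (\det (col_mx _ _)); apply/matrixP => i c; rewrite !mxE.
case: insubP => [i' im i'E|/negPf -> //]; rewrite im.
have sumE (c0 c1 : nat) (f : nat -> K) : (c1 <= L)%N ->
    \sum_(t < L | (c0 <= t)%N && (t < c1)%N) f t = \sum_(c0 <= t < c1) f t.
  move=> c1L; rewrite (big_ord_narrow_cond (P := fun t : 'I_L => (c0 <= t)%N) c1L) /=.
  by rewrite big_geq_mkord.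
transitivity (\sum_(a (val i) <= t < if val i is i0.+1 then a i0 else L) rho m.+1 t c).
  rewrite -(sumE _ _ (fun t => rho m.+1 t c)); last by case: (val i).
  apply: eq_bigl => t; rewrite /F /=; have /= -> := i'E.
  by [].
rewrite -[nat_of_ord i]/(val i); case: (val i) => [|i0]; first by rewrite subr0.
by rewrite (big_cat_nat (a_le i0) (aL i0))/= addrK.
Qed.

End Levels.
End DetRows.

(** * Column functions and their limits *)

Section Columns.
Variable R : realType.
Local Notation C := R[i].
Local Notation I := (`[-1, 1]%classic : set R).
Local Notation w x := (2 * (x - 1))%:C.

Lemma rr_odd m : odd m -> rr m.+1 = rr m.
Proof. by rewrite /rr /= => om; lia. Qed.

Lemma rr_even m : ~~ odd m -> rr m.+1 = (rr m).+1.
Proof. by rewrite /rr /= => om; lia. Qed.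

Lemma leq_rr m n : (m <= n)%N -> (rr m <= rr n)%N.
Proof. by rewrite /rr => mn; apply: half_leq. Qed.

Lemma rev_lt N i : (i < N)%N -> (N - i.+1 < N)%N.
Proof. by lia. Qed.

Lemma subn_rev N i : (i < N)%N -> (N - (N - i.+1).+1 = i)%N.
Proof. by lia. Qed.

(* Going up one level multiplies a column function by [2 (x - 1)] and adds a constant when the number of
   rows grows, and leaves it unchanged otherwise. *)
Definition fcol (v : nat -> C) (phi : R -> C) (m : nat) (x : R) : C :=
  \sum_(i < rr m) v i * w x ^+ (rr m - i.+1) + w x ^+ rr m * phi x.

Lemma fcol_odd v phi m : odd m -> fcol v phi m.+1 = fcol v phi m.
Proof. by move=> om; rewrite /fcol rr_odd. Qed.

Lemma fcol_even v phi m : ~~ odd m ->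
  fcol v phi m.+1 = (fun x => w x * fcol v phi m x + v (rr m)).
Proof.
move=> em; apply/funext => x; rewrite /fcol rr_even// big_ord_recr/= subnn expr0 mulr1.
move: (w x) => y; rewrite addrAC [in RHS]mulrDr mulr_sumr exprS mulrA; congr (_ + _ + _).
apply: eq_bigr => i _; rewrite mulrCA -exprS; congr (_ * _ ^+ _).
by rewrite subSn.
Qed.

Lemma bmc_w : bmc I (fun x => w x).
Proof.
apply: eq_bmc (bmc_horner (2%:P * ('X - 1%:P))) => x _.
by rewrite !hornerE.
Qed.

Lemma bmc_fcol v phi m : bmc I phi -> bmc I (fcol v phi m).
Proof.
move=> bphi; apply: bmcD; last by apply: bmcM => //; apply: bmcX; exact: bmc_w.
apply: bmc_sum => i _; apply: bmcM; first exact: bmc_cst.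
by apply: bmcX; exact: bmc_w.
Qed.

Lemma ccvg_det (N : nat) (A : nat -> 'M[C]_N) (B : 'M[C]_N) :
  (forall i j, ccvg (fun L => A L i j) (B i j)) -> ccvg (fun L => \det (A L)) (\det B).
Proof.
move=> h; apply: ccvg_sum => sg _; apply: ccvgM; first exact: ccvg_cst.
by apply: ccvg_prod => i _; exact: h.
Qed.

(** * Column functions of the prescribed points *)

Section Taylor.
Variables (m t : nat).

Definition Jtay : {poly C} := map_poly (real_complex R) (Jpoly R m t) \Po ('X + 1%:P).

(** Chosen so that [fcol] returns [J_t] at level [m]: [fcol] attaches [v i] to the power
    [rr m - i.+1] of [2 (x - 1)], whence the reversed index and the division by a power of 2. *)
Definition vJ (i : nat) : C :=
  if (i < rr m)%N then Jtay`_(rr m - i.+1) / 2 ^+ (rr m - i.+1) else 0.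

Definition phiJ (x : R) : C := (drop_poly (rr m) Jtay).[x%:C - 1] / 2 ^+ rr m.

Lemma Jc_taylor u : Jc m t u =
  \sum_(i < rr m) Jtay`_i * (u - 1) ^+ i + (u - 1) ^+ rr m * (drop_poly (rr m) Jtay).[u - 1].
Proof.
have -> : Jc m t u = Jtay.[u - 1].
  by rewrite /Jtay horner_comp !hornerE subrK.
rewrite -{1}[Jtay](poly_take_drop (rr m)) hornerD hornerM hornerXn [_ * _ ^+ _]mulrC.
congr (_ + _); rewrite (horner_coef_wide _ (size_take_poly _ _)).
by apply: eq_bigr => i _; rewrite coef_take_poly ltn_ord.
Qed.

Lemma Jc_real x : Jc m t x%:C = ((Jpoly R m t).[x])%:C.
Proof. by rewrite /Jc (horner_map (real_complex R)). Qed.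

Lemma two_neq0 N : 2 ^+ N != 0 :> C.
Proof. by rewrite expf_neq0// pnatr_eq0. Qed.

Lemma fcolJ x : fcol vJ phiJ m x = ((Jpoly R m t).[x])%:C.
Proof.
rewrite -Jc_real Jc_taylor /fcol.
have -> : w x = 2 * (x%:C - 1) by rewrite rmorphM rmorphB/= rmorph1 rmorph_nat.
congr (_ + _); last first.
  by rewrite /phiJ exprMn; field; exact: two_neq0.
rewrite (reindex_inj rev_ord_inj)/=; apply: eq_bigr => i _.
have hi : (rr m - i.+1 < rr m)%N by rewrite ltn_subrL /= (leq_ltn_trans _ (ltn_ord i)).
rewrite /vJ hi (subn_rev (ltn_ord i)).
by rewrite exprMn mulrA divfK// two_neq0.
Qed.

Lemma bmc_phiJ : bmc I phiJ.
Proof.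
have -> : phiJ = fun x => (drop_poly (rr m) Jtay).[x%:C - 1] * (2 ^+ rr m)^-1 by [].
apply: bmcM; last exact: bmc_cst.
pose q := drop_poly (rr m) Jtay.
apply: (@eq_bmc _ _ (fun x => \sum_(i < size q) q`_i * (x%:C - 1) ^+ i)).
  by move=> x _; rewrite horner_coef.
apply: bmc_sum => i _; apply: bmcM; first exact: bmc_cst.
apply: bmcX; apply: bmcB; last exact: bmc_cst.
by apply: eq_bmc (bmc_horner 'X) => x _; rewrite hornerX.
Qed.

End Taylor.

Section Kernel.
Variables (E : R -> C) (W : nat -> R -> C) (eps : nat -> C).
Hypothesis bE : bmc I E.
Hypothesis bW : forall j, bmc I (W j).
Hypothesis EW0 : forall x, -1 <= x <= 1 -> E x * W 0 x = 1.
Hypothesis W_rec : forall j x, -1 <= x <= 1 -> W j x = eps j + (x%:C - 1) * W j.+1 x.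
Hypothesis eps0 : eps 0 = 1.
Variables (k n : nat) (z : 'I_k -> nat * nat).
Hypothesis z_inj : injective z.
Hypothesis z_ge1 : forall p, (1 <= (z p).2)%N.
Hypothesis z_le : forall p, ((z p).2 <= n)%N.

(** With [v] the j-th unit vector and [r = rr n], the column at the top level is
    [(2 (x - 1))^(r - j - 1)] times [1 - (x - 1)^(j + 1) E W_(j+1)]. The second factor is [E] times
    the Taylor polynomial of degree [j] of [1/E]. *)
Definition phiW (j : nat) (x : R) : C := - (E x * W j.+1 x / 2 ^+ j.+1).

Definition vcol (c : 'I_(k + rr n)) (i : nat) : C :=
  match fintype.split c with inl p => vJ (z p).2 (z p).1 i | inr j => (i == j)%:R end.

Definition phicol (c : 'I_(k + rr n)) : R -> C :=
  match fintype.split c with inl p => phiJ (z p).2 (z p).1 | inr j => phiW j end.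

Definition rhoc (m s : nat) (c : 'I_(k + rr n)) : C :=
  if fintype.split c is inl p then
    (if ((z p).2 < m)%N then 0 else coefJ m s (fcol (vcol c) (phicol c) m))
  else coefJ m s (fcol (vcol c) (phicol c) m).

Lemma bmc_phiW j : bmc I (phiW j).
Proof.
apply: bmcN; apply: (@bmcM _ _ (fun x => E x * W j.+1 x) (fun=> (2 ^+ j.+1)^-1)); last exact: bmc_cst.
by apply: bmcM.
Qed.

Lemma bmc_col c m : bmc I (fcol (vcol c) (phicol c) m).
Proof.
apply: bmc_fcol; rewrite /phicol; case: (fintype.split c) => [p|j]; first exact: bmc_phiJ.
exact: bmc_phiW.
Qed.

Lemma splitL (p : 'I_k) : fintype.split (lshift (rr n) p) = inl p.
Proof. exact: (unsplitK (inl p)). Qed.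

Lemma splitR (j : 'I_(rr n)) : fintype.split (rshift k j) = inr j.
Proof. exact: (unsplitK (inr j)). Qed.

Lemma rhoc_below p m s : ((z p).2 < m)%N -> rhoc m s (lshift (rr n) p) = 0.
Proof. by rewrite /rhoc splitL => ->. Qed.

Lemma rhoc_level p s : rhoc (z p).2 s (lshift (rr n) p) = (s == (z p).1)%:R.
Proof.
rewrite /rhoc /vcol /phicol splitL ltnn -(coefJ_J R (z p).2); congr coefJ.
by apply/funext => x; rewrite fcolJ.
Qed.

Lemma vcol_above p i : (rr (z p).2 <= i)%N -> vcol (lshift (rr n) p) i = 0.
Proof. by rewrite /vcol splitL /vJ ltnNge => ->. Qed.

Local Notation lev := (levdet z rr rhoc vcol).
Local Notation upp := (upper z rhoc).
Local Notation low := (lower rr vcol).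

(** The least position that interlacing allows to particle [i] one level up. After an even level the
    offset in [tl] grows by one, which gives the successor, and the additional last particle is
    bounded below only by 0. *)
Definition threshold (m : nat) (x : nat -> nat) (i : nat) : nat :=
  if odd m then x i else if (i < rr m)%N then (x i).+1 else 0%N.

Lemma rowsum_lim (m : nat) (x : nat -> nat) i c : (i < rr m.+1)%N ->
  ccvg (fun L => \sum_(threshold m x i <= t < L) rhoc m.+1 t c)
    (if (i < rr m)%N then rho_above z rhoc m (x i) c else vcol c i).
Proof.
move=> im; set f := fcol (vcol c) (phicol c) m.
have bf : bmc I f by exact: bmc_col.
have main : ccvg (fun L => \sum_(threshold m x i <= t < L) coefJ m.+1 t (fcol (vcol c) (phicol c) m.+1))
    (if (i < rr m)%N then coefJ m (x i) f else vcol c i).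
  have [om|em] := boolP (odd m).
    rewrite /threshold om fcol_odd// -(rr_odd om) im.
    apply/(ccvg_shift _ _ (x i)).
    have h := ccvgB (ccvg_cst (coefJ m (x i) f)) (proj2 (ccvg_shift _ _ (x i)) (coefJ_lim m bf)).
    rewrite subr0 in h; apply: eq_ccvg h => L /=.
    by rewrite sum_coefJ_odd// leq_addl.
  rewrite /threshold (negPf em) fcol_even//; set a := if _ then _ else _.
  apply/(ccvg_shift _ _ a.+1).
  have h := ccvgB (ccvg_cst (if (i < rr m)%N then coefJ m (x i) f else vcol c i))
     (proj2 (ccvg_shift _ _ a) (coefJ_lim m bf)).
  rewrite subr0 in h; apply: eq_ccvg h => L /=.
  rewrite (sum_coefJ_even _ em bf); [|by lia|by lia].
  rewrite addnS /= /a; case: ltnP => //= rmi; congr (vcol _ _ - _).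
  by apply/eqP; rewrite eqn_leq rmi -ltnS -rr_even// im.
rewrite /rho_above; case E1: (fintype.split c) => [p|j]; last first.
  rewrite (_ : rhoc m (x i) c = coefJ m (x i) f) in main *; last by rewrite /rhoc E1.
  by apply: eq_ccvg main => L; apply: eq_bigr => t _; rewrite /rhoc E1.
have [mp|pm] := ltnP m (z p).2.
  rewrite (_ : rhoc m (x i) c = coefJ m (x i) f); last by rewrite /rhoc E1 ltnNge (ltnW mp).
  by apply: eq_ccvg main => L; apply: eq_bigr => t _; rewrite /rhoc E1 ltnNge mp.
(* The column belongs to a point at level [m] or below: every summand is 0, and [vcol] vanishes at
   the index of the new row. *)
have -> : (if (i < rr m)%N then 0 else vcol c i) = 0 :> C.
  case: ltnP => // rmi; rewrite /vcol E1 /vJ ltnNge (leq_trans _ rmi)// leq_rr//.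
apply: eq_ccvg (ccvg_cst 0) => L; rewrite big1// => t _.
by rewrite /rhoc E1 ltnS pm.
Qed.

Lemma levdet_lim (m : nat) (x : nat -> nat) :
  ccvg (fun L => \det (col_mx (upp m)
    (low (fun i c => \sum_(threshold m x i <= t < L) rhoc m.+1 t c) m.+1))) (lev m x).
Proof.
apply: ccvg_det => i c; rewrite -(splitK i); case: (fintype.split i) => j /=.
  rewrite !col_mxEu; apply: eq_ccvg (ccvg_cst _) => L.
  by rewrite !col_mxEu.
rewrite col_mxEd mxE.
have [jm|jm] := ltnP j (rr m.+1).
  by apply: eq_ccvg (rowsum_lim x c jm) => L; rewrite col_mxEd mxE jm.
rewrite ltnNge (leq_trans (leq_rr (leqnSn m)) jm)/=.
by apply: eq_ccvg (ccvg_cst _) => L; rewrite col_mxEd mxE ltnNge jm.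
Qed.

Lemma W_telescope j x : -1 <= x <= 1 ->
  1 - (x%:C - 1) ^+ j * (E x * W j x) = E x * \sum_(l < j) eps l * (x%:C - 1) ^+ l.
Proof.
move=> hx; elim: j => [|j IH]; first by rewrite big_ord0 expr0 mul1r EW0// subrr mulr0.
rewrite big_ord_recr/= mulrDr -IH (@W_rec j)// exprSr; ring.
Qed.

(** No point lies above level [n], so only the block of the weight's own columns remains. It differs
    from the matrix of the weight by the triangular [M], built from the Taylor coefficients of
    [1/E], whose determinant is the normalising power of 2. *)
Lemma levdet_top (x : nat -> nat) : lev n x =
  2 ^+ 'C(rr n, 2) *
  \det (\matrix_(i < rr n, j < rr n) coefJ n (x j) (fun y => (y%:C - 1) ^+ (rr n - i.+1) * E y)).
Proof.
set Psi := \matrix_(i, j) _.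
pose M : 'M[C]_(rr n) := \matrix_(j, i)
  (if (i <= j)%N then 2 ^+ (rr n - j.+1) * eps (j - i) else 0).
have detM : \det M = 2 ^+ 'C(rr n, 2).
  rewrite det_trig; last first.
    by apply/is_trig_mxP => j i ji; rewrite mxE leqNgt ji.
  rewrite (eq_bigr (fun j : 'I_(rr n) => 2 ^+ (rr n - j.+1))); last first.
    by move=> j _; rewrite mxE leqnn subnn eps0 mulr1.
  rewrite (reindex_inj rev_ord_inj)/= -(@big_mkord _ _ _ (rr n) xpredT (fun i => 2 ^+ (rr n - (rr n - i.+1).+1))).
  rewrite big_nat (eq_bigr (fun i => 2 ^+ i)); last by move=> i /andP[_ hi]; congr (_ ^+ _); lia.
  by rewrite -big_nat prodrXr -bin2_sum.
have -> : lev n x = \det (M *m Psi)^T.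
  rewrite /levdet; set A := col_mx _ _.
  have -> : A = block_mx 1%:M 0 (\matrix_(i, p) rho_above z rhoc n (x i) (lshift _ p)) (M *m Psi)^T.
    apply/matrixP => i c; rewrite -(splitK i) -(splitK c) /A.
    case: (fintype.split i) => i'; case: (fintype.split c) => c' /=.
    - rewrite col_mxEu block_mxEul !mxE ltnNge z_le subr0.
      by rewrite (inj_eq (@lshift_inj _ _)).
    - by rewrite col_mxEu block_mxEur !mxE ltnNge z_le subr0 eq_lrshift.
    - by rewrite col_mxEd block_mxEdl !mxE ltn_ord.
    rewrite col_mxEd block_mxEdr !mxE ltn_ord /rho_above splitR /rhoc splitR.
    rewrite (@coefJ_off _ _ _ [::] _ (fun y => \sum_(i < rr n) M c' i * ((y%:C - 1) ^+ (rr n - i.+1) * E y))); first last.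
    - move=> y; rewrite /= in_itv/= => hy _; rewrite /fcol /vcol /phicol splitR (bigD1 c')//= eqxx mul1r.
      rewrite big1 ?addr0; last by move=> i0 /negPf; rewrite -val_eqE /= => ->; rewrite mul0r.
      have -> : w y = 2 * (y%:C - 1) by rewrite rmorphM rmorphB/= rmorph1 rmorph_nat.
      transitivity ((2 * (y%:C - 1)) ^+ (rr n - c'.+1) * (1 - (y%:C - 1) ^+ c'.+1 * (E y * W c'.+1 y))).
        have -> : (2 * (y%:C - 1)) ^+ rr n = (2 * (y%:C - 1)) ^+ (rr n - c'.+1) * (2 * (y%:C - 1)) ^+ c'.+1.
          by rewrite -exprD subnK.
        rewrite /phiW !exprMn.
        field. by rewrite expf_neq0// pnatr_eq0.
      rewrite W_telescope// exprMn.
      rewrite (bigID (fun i0 : 'I_(rr n) => (i0 <= c')%N))/= [X in _ = _ + X]big1 ?addr0; last first.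
        by move=> i0 /negPf h; rewrite mxE h mul0r.
      rewrite (big_ord_narrow_cond (P := xpredT) (ltn_ord c'))/=.
      rewrite (reindex_inj rev_ord_inj)/= !mulr_sumr; apply: eq_bigr => i0 _.
      have h : (i0 <= c')%N by rewrite -ltnS.
      rewrite mxE /= h subSS (_ : (rr n - i0.+1 = (rr n - c'.+1) + (c' - i0))%N) ?exprD; first ring.
      by have := ltn_ord c'; lia.
    - apply: bmc_sum => i0 _; apply: bmcM; first exact: bmc_cst.
      apply: bmcM => //; apply: bmcX; apply: bmcB; last exact: bmc_cst.
      by apply: eq_bmc (bmc_horner 'X) => y _; rewrite hornerX.
    have bb i0 : bmc I (fun y => (y%:C - 1) ^+ (rr n - i0) * E y).
      apply: bmcM => //; apply: bmcX; apply: bmcB; last exact: bmc_cst.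
      by apply: eq_bmc (bmc_horner 'X) => y _; rewrite hornerX.
    rewrite coefJ_sum; last by move=> i0 _; apply: bmcM => //; exact: bmc_cst.
    by apply: eq_bigr => i0 _; rewrite coefJZ// !mxE.
  by rewrite det_lblock det1 mul1r.
by rewrite det_tr det_mulmx detM.
Qed.

(** The function whose coefficient is the kernel up to conjugation: the first term gives the single
    integral, the second the double integral once its contour part is evaluated. *)
Definition theta (p q : 'I_k) (x : R) : C :=
  (if ((z q).2 <= (z p).2)%N then w x ^+ (rr (z p).2 - rr (z q).2) * ((Jpoly R (z q).2 (z q).1).[x])%:C
   else 0) -
  w x ^+ rr (z p).2 / 2 ^+ rr (z q).2 *
  (\sum_(i < rr (z q).2) (Jtay (z q).2 (z q).1)`_i * (E x * W (rr (z q).2 - i) x) +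
   (drop_poly (rr (z q).2) (Jtay (z q).2 (z q).1)).[x%:C - 1]).

Lemma sum_ord_support (F : nat -> C) N N' : (N' <= N)%N ->
  (forall j, (N' <= j)%N -> F j = 0) -> \sum_(j < N) F j = \sum_(j < N') F j.
Proof.
move=> NN F0; rewrite (big_ord_widen N F NN) [LHS](bigID (fun j : 'I_N => (j < N')%N))/=.
by rewrite [X in _ + X]big1 ?addr0// => j; rewrite -leqNgt => /F0.
Qed.

Lemma theta_eq p q x : theta p q x =
  (if ((z p).2 < (z q).2)%N then - fcol (vJ (z q).2 (z q).1) (phiJ (z q).2 (z q).1) (z p).2 x else 0) +
  \sum_(j < rr n) vJ (z q).2 (z q).1 j * fcol (fun i => (i == j)%:R) (phiW j) (z p).2 x.
Proof.
rewrite /theta; set m0 := (z q).2; set n0 := (z p).2; set t := (z q).1; set v := vJ m0 t.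
have v0 j : (rr m0 <= j)%N -> v j = 0 by rewrite /v /vJ ltnNge => ->.
pose G (j : nat) : C := if (j < rr n0)%N then w x ^+ (rr n0 - j.+1) else 0.
have colE j : fcol (fun i => (i == j)%:R) (phiW j) n0 x =
    G j - w x ^+ rr n0 * (E x * W j.+1 x / 2 ^+ j.+1).
  rewrite /fcol /phiW mulrN; congr (_ - _); rewrite /G.
  case: ltnP => jn.
    rewrite (bigD1 (Ordinal jn))//= eqxx mul1r big1 ?addr0// => i.
    by rewrite -val_eqE /= => /negPf ->; rewrite mul0r.
  rewrite big1// => i _; rewrite (_ : (val i == j) = false) ?mul0r//.
  by apply: ltn_eqF; exact: leq_trans (ltn_ord i) jn.
under [in RHS]eq_bigr do rewrite colE mulrBr.
rewrite sumrB.
have S2 : \sum_(j < rr n) v j * (w x ^+ rr n0 * (E x * W j.+1 x / 2 ^+ j.+1)) =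
    w x ^+ rr n0 / 2 ^+ rr m0 * \sum_(i < rr m0) (Jtay m0 t)`_i * (E x * W (rr m0 - i) x).
  rewrite (@sum_ord_support (fun j => v j * (w x ^+ rr n0 * (E x * W j.+1 x / 2 ^+ j.+1))) _ (rr m0)); first last.
  - by move=> j /v0 ->; rewrite mul0r.
  - exact: leq_rr (z_le q).
  rewrite mulr_sumr (reindex_inj rev_ord_inj)/=; apply: eq_bigr => i _.
  have hi := ltn_ord i.
  have -> : (rr m0 - i.+1).+1 = (rr m0 - i)%N by exact: subnSK.
  rewrite /v /vJ (rev_lt hi).
  rewrite (subn_rev hi).
  have -> : (2 : C) ^+ rr m0 = 2 ^+ i * 2 ^+ (rr m0 - i) by rewrite -exprD subnKC// ltnW.
  by field; rewrite !two_neq0.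
rewrite S2 [_ / _ * (_ + _)]mulrDr.
set S2' := _ * \sum_(i < rr m0) _.
(* The terms with [W] match; what remains is a polynomial identity, obtained by splitting [J_t]
   around 1 at order [rr m0]. *)
suff S1 : (if (m0 <= n0)%N then w x ^+ (rr n0 - rr m0) * ((Jpoly R m0 t).[x])%:C else 0) -
    w x ^+ rr n0 / 2 ^+ rr m0 * (drop_poly (rr m0) (Jtay m0 t)).[x%:C - 1] =
    (if (n0 < m0)%N then - fcol v (phiJ m0 t) n0 x else 0) + \sum_(j < rr n) v j * G j.
  by rewrite addrA -S1 opprD addrA addrAC.
have phE : w x ^+ rr n0 / 2 ^+ rr m0 * (drop_poly (rr m0) (Jtay m0 t)).[x%:C - 1] = w x ^+ rr n0 * phiJ m0 t x.
  by rewrite /phiJ; ring.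
rewrite phE leqNgt; case: ltnP => /= nm.
  rewrite (@sum_ord_support (fun j => v j * G j) _ (rr n0)); first last.
  - by move=> j jn; rewrite /G ltnNge jn mulr0.
  - exact: leq_rr (z_le p).
  rewrite /fcol opprD addrAC; congr (_ - _); rewrite addrC; apply/esym/eqP; rewrite subr_eq0; apply/eqP.
  by apply: eq_bigr => j _; rewrite /G ltn_ord.
rewrite (@sum_ord_support (fun j => v j * G j) _ (rr m0)); first last.
- by move=> j /v0 ->; rewrite mul0r.
- exact: leq_rr (z_le q).
have rle := leq_rr nm.
have aux A B i : (i < A)%N -> (A <= B)%N -> (B - A + (A - i.+1) = B - i.+1)%N by lia.
rewrite -fcolJ /fcol -/v mulrDr [w x ^+ (_ - _) * (_ * _)]mulrA -exprD subnK// addrK add0r mulr_sumr.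
apply: eq_bigr => j _; have hj := ltn_ord j.
rewrite /G (leq_trans hj rle) mulrCA -exprD; congr (_ * _ ^+ _); by rewrite aux.
Qed.

Lemma coefJ_theta p q : coefJ (z p).2 (z p).1 (theta p q) =
  (p == q)%:R - rhoc (z p).2 (z p).1 (lshift (rr n) q) +
  \sum_(j < rr n) vcol (lshift (rr n) q) j * rhoc (z p).2 (z p).1 (rshift k j).
Proof.
set v := vJ (z q).2 (z q).1.
set fq := fcol v (phiJ (z q).2 (z q).1) (z p).2.
have bq : bmc I fq by apply: bmc_fcol; exact: bmc_phiJ.
pose fj (j : 'I_(rr n)) := fcol (fun i => (i == j)%:R) (phiW j) (z p).2.
have bj j : bmc I (fj j) by apply: bmc_fcol; exact: bmc_phiW.
have bvj (j : 'I_(rr n)) : bmc I (fun x => v j * fj j x) by apply: bmcM => //; exact: bmc_cst.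
have -> : theta p q = (fun x => (if ((z p).2 < (z q).2)%N then -1 else 0) * fq x + \sum_(j < rr n) v j * fj j x).
  by apply/funext => x; rewrite theta_eq; case: ifP => _; rewrite ?mulN1r ?mul0r.
rewrite coefJD; last 2 first.
- by apply: bmcM => //; exact: bmc_cst.
- by apply: bmc_sum => j _; exact: bvj.
rewrite coefJZ// coefJ_sum//; congr (_ + _); last first.
  apply: eq_bigr => j _; rewrite coefJZ// /vcol /rhoc /phicol splitL splitR; congr (_ * _).
  by rewrite /vcol splitR.
have [pq|qp|pq] := ltngtP (z p).2 (z q).2.
- rewrite (_ : (p == q) = false); last by apply: contraTF pq => /eqP ->; rewrite ltnn.
  rewrite /rhoc splitL ltnNge (ltnW pq) /= sub0r mulN1r /vcol /phicol splitL.
  by [].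
- rewrite (_ : (p == q) = false); last by apply: contraTF qp => /eqP ->; rewrite ltnn.
  by rewrite /rhoc splitL qp mul0r subrr.
rewrite pq rhoc_level mul0r.
suff -> : ((z p).1 == (z q).1) = (p == q) by rewrite subrr.
apply/eqP/eqP => [h|-> //]; apply: z_inj.
by rewrite [z p]surjective_pairing [z q]surjective_pairing h pq.
Qed.

(* A Schur complement eliminates the virtual rows. *)
Lemma levdet_bottom (x : nat -> nat) : lev 0 x =
  \det (\matrix_(p < k, q < k) coefJ (z p).2 (z p).1 (theta p q)).
Proof.
pose h : 'M[C]_(k, rr n) := \matrix_(p, j) rhoc (z p).2 (z p).1 (rshift k j).
pose V : 'M[C]_(rr n, k) := \matrix_(j, q) vcol (lshift (rr n) q) j.
set K := \matrix_(p, q) _.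
rewrite /levdet; set A := col_mx _ _.
(* Since [rr 0 = 0], all lower rows are virtual, and on the columns of the weight they form the
   identity. *)
have -> : A = block_mx 1%:M (- h) 0 1%:M *m block_mx K 0 V 1%:M.
  rewrite mulmx_block !mul1mx !mulmx1 !mul0mx !add0r.
  apply/matrixP => i c; rewrite -(splitK i) -(splitK c) /A.
  case: (fintype.split i) => i'; case: (fintype.split c) => c' /=; last 2 first.
  - by rewrite col_mxEd block_mxEdl !mxE.
  - by rewrite col_mxEd block_mxEdr !mxE /vcol splitR.
  - rewrite col_mxEu block_mxEul !mxE z_ge1 (inj_eq (@lshift_inj _ _)).
    rewrite coefJ_theta [X in _ = _ + X](eq_bigr (fun j : 'I_(rr n) => - (vcol (lshift (rr n) c') j *
      rhoc (z i').2 (z i').1 (rshift k j)))).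
      by rewrite sumrN addrK.
    by move=> j _; rewrite !mxE mulNr mulrC.
  rewrite col_mxEu block_mxEur !mxE z_ge1 eq_lrshift.
  by rewrite sub0r.
by rewrite det_mulmx det_ublock det_lblock !det1 !mul1r mulr1.
Qed.

End Kernel.
End Columns.

(** * Identification of the kernel *)

Section KernelIdentity.
Variable R : realType.
Local Notation C := R[i].
Local Notation D := (`[0, 1]%classic : set R).
Local Notation I := (`[-1, 1]%classic : set R).
Local Notation w x := (2 * (x - 1))%:C.

(** [alph n] is a half-integer, so neither real exponent is 0 and both sides vanish at [y = 0]. *)
Lemma powR_alph (r n : nat) (y : R) : 0 <= y ->
  y `^ (r%:R + alph R n) = y ^+ r * y `^ alph R n.
Proof.
have a0 : alph R n != 0 by apply/eqP; rewrite /alph; case: ifP => _; lra.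
have ra0 : r%:R + alph R n != 0.
  rewrite /alph; case: r => [|r]; first by move: a0; rewrite /alph add0r.
  by rewrite gt_eqF//; case: ifP => _; have := ler0n R r; rewrite -natr1; lra.
rewrite le_eqVlt => /predU1P[<-|y0]; first by rewrite !powR0// mulr0.
by rewrite powRD ?powR_mulrn ?ltW// (gt_eqF y0) implybT.
Qed.

Lemma coefJ0 n s : coefJ n s (fun=> 0) = 0 :> C.
Proof.
transitivity (ell (fun=> 0 : C)); last exact: ell0.
by congr ell; apply/funext => x; rewrite mulr0 mul0r.
Qed.

Section Loop.
Variables (a b : nat -> R) (g : R) (gx gy : R -> R).
Local Notation E := (Ex a b g).
Local Notation gm := (gam gx gy).
Local Notation Ci f := (contour_int gx gy f).
Hypotheses (cgx : {within `[0, 1], continuous gx}) (cgy : {within `[0, 1], continuous gy}).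
Variables (S : seq R) (M : R).
Hypothesis dgxy : forall t : R, 0 < t < 1 -> t \notin S ->
  derivable gx t 1 /\ derivable gy t 1.
Hypothesis bgxy : forall t : R, 0 < t < 1 -> t \notin S ->
  `|gx^`() t| <= M /\ `|gy^`() t| <= M.
Hypothesis gam_off : forall t : R, 0 <= t <= 1 -> forall x : R, -1 <= x <= 1 -> gm t <> x%:C.
Hypothesis blE : bounded_on_loop gx gy (fun u => (E u)^-1).
Hypothesis cauchyE : forall x : R, -1 <= x <= 1 -> E x%:C != 0 /\
  forall P : {poly C}, Ci (fun u => P.[u] / (u - x%:C) / E u) = twopii R * (P.[x%:C] / E x%:C).

Local Notation W := (Wf E gx gy).

Let bW j : bmc I (W j).
Proof. exact: (bmc_Wf cgx cgy dgxy bgxy gam_off blE j). Qed.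

Let bE : bmc I (fun x => E x%:C).
Proof. exact: (bmc_E cgx cgy dgxy bgxy gam_off blE cauchyE). Qed.

Definition residue (n m t : nat) (x : R) : C :=
  w x ^+ rr n / 2 ^+ rr m *
  (\sum_(i < rr m) (Jtay R m t)`_i * (E x%:C * W (rr m - i) x) + (drop_poly (rr m) (Jtay R m t)).[x%:C - 1]).

Lemma bmc_residue n m t : bmc I (residue n m t).
Proof.
apply: (@eq_bmc _ _ (fun x => w x ^+ rr n * ((2 ^+ rr m)^-1 * (\sum_(i < rr m) (Jtay R m t)`_i * (E x%:C * W (rr m - i) x)) + phiJ m t x))).
  by move=> x _; rewrite /residue /phiJ; field; exact: two_neq0.
apply: bmcM; first by apply: bmcX; exact: bmc_w.
apply: bmcD; last exact: bmc_phiJ.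
apply: bmcM; first exact: bmc_cst.
apply: bmc_sum => i _; apply: bmcM; first exact: bmc_cst.
by apply: bmcM.
Qed.

(** [J_t] is split by its Taylor expansion at 1 and [Lam_poly] applies. The powers of -2 come from
    writing [2 (x - 1)] as -2 times [1 - x], the signs from reversing [1 - u] and [x - u]. *)
Lemma inner_contour n m s t x : -1 <= x <= 1 ->
  Ci (fun u : C => E x%:C / E u * ((Jpoly R n s).[x])%:C * Jc m t u *
        ((1 - x) `^ ((rr n)%:R + alph R n) * (1 + x) `^ (1/2))%:C /
        ((1 - u) ^+ rr m * (x%:C - u))) =
  ((Jpoly R n s).[x])%:C * (- (twopii R * (-2) ^+ rr m / (-2) ^+ rr n) * residue n m t x) *
  ((1 - x) `^ alph R n * (1 + x) `^ (1/2))%:C.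
Proof.
move=> hx; set r := rr m; set Js := ((Jpoly R n s).[x])%:C; set K := (_ * _)%:C.
set Q := drop_poly r (Jtay R m t) \Po ('X - 1%:P).
pose F u := (\sum_(i < r) (Jtay R m t)`_i * (u - 1) ^+ i + (u - 1) ^+ r * Q.[u]) / ((u - 1) ^+ r * (u - x%:C)).
have JE u : Jc m t u = \sum_(i < r) (Jtay R m t)`_i * (u - 1) ^+ i + (u - 1) ^+ r * Q.[u].
  by rewrite Jc_taylor /Q horner_comp !hornerE.
have -> : (fun u : C => E x%:C / E u * Js * Jc m t u * K / ((1 - u) ^+ r * (x%:C - u))) =
    (fun u => ((-1) ^+ r.+1 * E x%:C * Js * K) * (F u / E u)).
  apply/funext => u; rewrite JE /F.
  have -> : (1 - u) ^+ r * (x%:C - u) = (-1) ^+ r.+1 * ((u - 1) ^+ r * (u - x%:C)).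
    have flip (A B : C) : (- A) ^+ r * - B = (-1) ^+ r.+1 * (A ^+ r * B).
      by rewrite (exprNn A) (exprS (-1) r) mulN1r mulNr mulrA mulrN.
    by rewrite -(opprB u 1) -(opprB u x%:C) flip.
  rewrite [((-1) ^+ r.+1 * _)^-1]invfM invr_sign.
  move: (_ + _) (_ * _)^-1 => A B; ring.
have clF : cont_on_loop gx gy F.
  have -> : F = fun u => Jc m t u * ((u - 1) ^+ r * (u - x%:C))^-1 by apply/funext => u; rewrite /F JE.
  by apply: ccM (cl_horner cgx cgy _) (cl_W cgx cgy gam_off r hx).
have blF : bounded_on_loop gx gy (fun u => F u / E u) by exact: bmcM (cc_bmc clF) blE.
rewrite (contourZ cgx cgy dgxy bgxy _ blF).
have -> : Ci (fun u => F u / E u) = twopii R * Lam E gx gy F.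
  by rewrite /Lam mulrA mulfV ?mul1r// twopii_neq0.
rewrite (Lam_poly cgx cgy dgxy bgxy gam_off blE cauchyE (fun i => (Jtay R m t)`_i) Q r hx).
have [E0 _] := cauchyE hx.
rewrite /residue -/r.
have -> : \sum_(i < r) (Jtay R m t)`_i * (E x%:C * W (r - i) x) = E x%:C * \sum_(i < r) (Jtay R m t)`_i * W (r - i) x.
  by rewrite mulr_sumr; apply: eq_bigr => i _; rewrite mulrCA.
have -> : (drop_poly r (Jtay R m t)).[x%:C - 1] = Q.[x%:C] by rewrite /Q horner_comp !hornerE.
have -> : K = (1 - x)%:C ^+ rr n * ((1 - x) `^ alph R n * (1 + x) `^ (1/2))%:C.
  by rewrite /K powR_alph; [rewrite -mulrA rmorphM rmorphXn|move: hx => /andP[_]; lra].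
have -> : w x = (-2) * (1 - x)%:C by rewrite -(opprB 1 x) mulrN rmorphN rmorphM/= rmorph_nat mulNr.
rewrite exprMn (exprNn 2 r) exprS.
set S0 := \sum_(i < r) _; set Q0 := Q.[_]; move: S0 Q0 E0 => S0 Q0; set K0 := (_ * _)%:C; move: K0 (E x%:C) ((1 - x)%:C) Js (twopii R) => K0 e y J tw e0.

field; rewrite ?E0 ?expf_neq0 ?oppr_eq0 ?pnatr_eq0//.
Qed.

(** The kernel has powers of [1 - x] and [theta] powers of [2 (x - 1)]; the discrepancy is a factor
    of the row times a factor of the column. *)
Lemma Kern_theta (k : nat) (z : 'I_k -> nat * nat) (p q : 'I_k) :
  (-2) ^+ rr (z p).2 * Kern a b g gx gy (z p) (z q) =
  coefJ (z p).2 (z p).1 (theta (fun x => E x%:C) W z p q) * (-2) ^+ rr (z q).2.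
Proof.
set n := (z p).2; set m := (z q).2; set s := (z p).1; set t := (z q).1.
pose T (x : R) : C := (if (m <= n)%N then w x ^+ (rr n - rr m) * ((Jpoly R m t).[x])%:C else 0).
have bT : bmc I T.
  rewrite /T; have [_|_] := leqP m n; last exact: bmc_cst.
  by apply: bmcM; [apply: bmcX; exact: bmc_w|exact: bmc_horner].
have bres := bmc_residue n m t.
have n2 r : (-2) ^+ r != 0 :> C by rewrite expf_neq0// oppr_eq0 pnatr_eq0.
have K1 c (h : R -> C) : bmc I h -> coefJ n s (fun x => c * h x) = c * coefJ n s h by exact: coefJZ.
rewrite /Kern -/n -/m -/s -/t.
rewrite (eq_cint (h := fun x => ((Jpoly R n s).[x])%:C * (- (twopii R * (-2) ^+ rr m / (-2) ^+ rr n) * residue n m t x) *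
  ((1 - x) `^ alph R n * (1 + x) `^ (1/2))%:C)); last first.
  by move=> x; rewrite /= in_itv/= => hx; exact: inner_contour.
set T2 := (if _ then _ else _).
have -> : T2 = (-2) ^+ rr m / (-2) ^+ rr n * coefJ n s T.
  rewrite /T2 /T; case: ifP => mn; last first.
 by rewrite coefJ0 mulr0.
  have rmn := leq_rr mn.
  have bT' : bmc I (fun x => (-2) ^+ rr m / (-2) ^+ rr n * T x) by apply: bmcM => //; exact: bmc_cst.
  rewrite -K1; last by move: bT; rewrite /T mn.
  rewrite -[RHS](innerpE n (bmc_horner _)); last by move: bT'; rewrite /T mn.
  rewrite /innerp; congr (_ * _); apply: eq_cint => x; rewrite /= in_itv/= => /andP[hx1 hx2].
  rewrite -natrB// powR_alph; last lra.
  have -> : w x = (-2) * (1 - x)%:C by rewrite -(opprB 1 x) mulrN rmorphN rmorphM/= rmorph_nat mulNr.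
  have -> : (-2) ^+ rr n = (-2) ^+ (rr n - rr m) * (-2) ^+ rr m :> C by rewrite -exprD subnK.
  rewrite !rmorphM rmorphXn/= exprMn.
  by field; rewrite !n2.
have -> : (2%:C * pi%:C * 'i)^-1 = (twopii R)^-1 by [].
rewrite mulrAC -[_ * cint _ _]/(innerp n (fun x => ((Jpoly R n s).[x])%:C)
  (fun x => - (twopii R * (-2) ^+ rr m / (-2) ^+ rr n) * residue n m t x)).
rewrite (innerpE n (bmc_horner _)); last by apply: bmcM => //; exact: bmc_cst.
rewrite -[ell _]/(coefJ n s (fun x => - (twopii R * (-2) ^+ rr m / (-2) ^+ rr n) * residue n m t x)) K1//.
have -> : coefJ n s (theta (fun x => E x%:C) W z p q) = coefJ n s T - coefJ n s (residue n m t).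
  have h := coefJD n s bT (bmcN bres).
  have := K1 (-1) _ bres; rewrite mulN1r => <-.
  transitivity (coefJ n s (fun x => T x + - residue n m t x)); first by [].
  rewrite h; congr (_ + coefJ _ _ _); apply/funext => x; rewrite mulN1r//.
by field; rewrite n2 twopii_neq0.
Qed.

(* The two matrices are conjugate by the diagonal matrix with entries [(-2) ^+ rr]. *)
Lemma det_Kern (k : nat) (z : 'I_k -> nat * nat) :
  \det (\matrix_(p < k, q < k) Kern a b g gx gy (z p) (z q)) =
  \det (\matrix_(p < k, q < k) coefJ (z p).2 (z p).1 (theta (fun x => E x%:C) W z p q)).
Proof.
pose d : 'rV[C]_k := \row_p (-2) ^+ rr (z p).2.
have dd : \det (diag_mx d) != 0.
  rewrite det_diag; apply/prodf_neq0 => p _.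
  by rewrite mxE expf_neq0// oppr_eq0 pnatr_eq0.
apply: (mulfI dd); rewrite -det_mulmx [RHS]mulrC -det_mulmx; congr (\det _).
apply/matrixP => p q; rewrite mul_diag_mx mul_mx_diag !mxE.
exact: Kern_theta.
Qed.

End Loop.
End KernelIdentity.

(** * Summation over the levels *)

Lemma interlaceP (l mu : seq nat) :
  reflect (forall j, (j < size l)%N -> (nth 0 l j <= nth 0 mu j)%N && (nth 0 mu j.+1 <= nth 0 l j)%N)
    (interlace l mu).
Proof.
apply: (iffP allP) => h j hj; first by apply: h; rewrite mem_iota add0n.
by apply: h; move: hj; rewrite mem_iota add0n.
Qed.

Lemma tl_over n l j : size l = rr n -> (rr n <= j)%N -> tl n l j = 0%N.
Proof. by move=> sl nj; rewrite /tl nth_default ?sl//; lia. Qed.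

Lemma partJ_nth n l j : partJ n l -> (nth 0 l j.+1 <= nth 0 l j)%N.
Proof.
move=> /andP[_ sl]; have [jl|jl] := ltnP j.+1 (size l); last by rewrite nth_default.
have tr : transitive geq by move=> a b c /= h1 h2; exact: leq_trans h2 h1.
have := sorted_ltn_nth tr 0%N sl.
by move=> /(_ j j.+1); rewrite !inE (ltnW jl) jl ltnSn; exact.
Qed.

Lemma tl_dec n l j : partJ n l -> (j.+1 < rr n)%N -> (tl n l j.+1 < tl n l j)%N.
Proof. by move=> pl jn; have := partJ_nth j pl; rewrite /tl; lia. Qed.

Lemma tl_le n l j : partJ n l -> (tl n l j.+1 <= tl n l j)%N.
Proof. by move=> pl; have := partJ_nth j pl; rewrite /tl; lia. Qed.

Lemma tl_inj n l mu : partJ n l -> partJ n mu ->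
  (forall i, (i < rr n)%N -> tl n l i = tl n mu i) -> l = mu.
Proof.
move=> /andP[/eqP sl _] /andP[/eqP sm _] h; apply: (@eq_from_nth _ 0%N); first by rewrite sl sm.
by move=> i; rewrite sl => hi; have := h i hi; rewrite /tl; lia.
Qed.

Lemma threshold_le m l : partJ m l -> forall i,
  (threshold m (tl m l) i.+1 <= threshold m (tl m l) i)%N.
Proof.
move=> pl i; rewrite /threshold; case: ifP => _; first exact: tl_le.
case: (ltnP i.+1 (rr m)) => h1; last by [].
by rewrite (ltnW h1) ltnS tl_le.
Qed.

(** The conditions separate into one interval per particle with ends fixed by [l], the form that
    row-wise summation needs. The first particle is bounded above by [L] only. *)
Lemma interlace_threshold m l mu L : partJ m l -> partJ m.+1 mu ->
  (forall i, (i < rr m.+1)%N -> (tl m.+1 mu i < L)%N) ->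
  interlace l mu = [forall i : 'I_(rr m.+1), (threshold m (tl m l) i <= tl m.+1 mu i)%N &&
    (tl m.+1 mu i < if val i is i'.+1 then threshold m (tl m l) i' else L)%N].
Proof.
move=> /andP[/eqP sl ol] /andP[/eqP sm om] hL.
apply/interlaceP/forallP => [h [i hi] /=|h j].
  rewrite /threshold; have [odm|evm] := boolP (odd m).
    have rE := rr_odd odm; rewrite rE in hi.
    have h1 := h i; rewrite sl hi in h1; have /andP[h2 h3] := h1 isT.
    apply/andP; split; first by rewrite /tl rE; lia.
    case: i hi {h1 h2 h3} => [|i] hi /=; first by apply: hL; rewrite rE.
    have := h i; rewrite sl (ltnW hi) => /(_ isT) /andP[_]; rewrite /tl rE; lia.
  have rE := rr_even evm; rewrite rE in hi.
  apply/andP; split.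
    case: ltnP => // ir; have := h i; rewrite sl ir => /(_ isT) /andP[h1 _].
    by rewrite /tl rE; lia.
  case: i hi => [|i] hi /=; first by apply: hL; rewrite rE.
  have ir : (i < rr m)%N by [].
  by rewrite ir; have := h i; rewrite sl ir => /(_ isT) /andP[_]; rewrite /tl rE; lia.
rewrite sl => hj; have [odm|evm] := boolP (odd m).
  have rE := rr_odd odm; have hj1 : (j < rr m.+1)%N by rewrite rE.
  have /= := h (Ordinal hj1); rewrite /threshold odm => /andP[h1 _].
  apply/andP; split; first by move: h1; rewrite /tl rE; lia.
  have [j1|j1] := ltnP j.+1 (rr m.+1); last by rewrite nth_default// sm.
  by have /= := h (Ordinal j1); rewrite /threshold odm => /andP[_]; rewrite /tl rE; move: j1; rewrite rE; lia.
have rE := rr_even evm; have hj1 : (j < rr m.+1)%N by rewrite rE ltnW.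
have /= := h (Ordinal hj1); rewrite /threshold (negPf evm) hj => /andP[h1 _].
apply/andP; split; first by move: h1; rewrite /tl rE; lia.
have j1 : (j.+1 < rr m.+1)%N by rewrite rE.
by have /= := h (Ordinal j1); rewrite /threshold (negPf evm) hj => /andP[_]; rewrite /tl rE; lia.
Qed.

Lemma partition_of_tl m (y : nat -> nat) : (forall i, (i.+1 < rr m)%N -> (y i.+1 < y i)%N) ->
  let mu := mkseq (fun i => y i - (rr m - i.+1))%N (rr m) in
  partJ m mu /\ forall i, (i < rr m)%N -> tl m mu i = y i.
Proof.
move=> dec mu.
(* Strict decrease forces [y i >= rr m - i.+1], so the subtractions that define [mu] are not
   truncated. *)
have yge e i : (rr m - i.+1)%N = e -> (i < rr m)%N -> (e <= y i)%N.
  elim: e i => [|e IH] i // eE hi; have hi1 : (i.+1 < rr m)%N by rewrite -subn_gt0 eE.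
  have e1 : (rr m - i.+2)%N = e by rewrite subnS eE.
  by have h1 := dec i hi1; have h2 := IH _ e1 hi1; apply: leq_ltn_trans h1.
split; last by move=> i hi; rewrite /tl nth_mkseq//; have := yge _ i erefl hi; lia.
rewrite /partJ size_mkseq eqxx /=.
apply/(sortedP 0%N) => i; rewrite size_mkseq => hi; rewrite !nth_mkseq//; last exact: ltnW.
by have := dec i hi; rewrite /geq/=; lia.
Qed.

(** * Probabilities of events, from the top level down *)

Section Process.
Variables (R : realType) (d : measure_display) (T : measurableType d) (P : probability T R).
Local Notation C := R[i].

Lemma prob_bigsetU (J : choiceType) (s : seq J) (B : J -> set T) : uniq s ->
  (forall j, measurable (B j)) -> (forall i j w, B i w -> B j w -> i = j) ->
  fine (P (\big[setU/set0]_(j <- s) B j)) = \sum_(j <- s) fine (P (B j)).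
Proof.
move=> us mB dB; elim: s us => [_|j s IH /= /andP[js us]].
  by rewrite !big_nil measure0.
have mU : measurable (\big[setU/set0]_(j <- s) B j) by apply: bigsetU_measurable.
rewrite !big_cons measureU//; first by rewrite fineD ?fin_num_measure// IH.
apply/seteqP; split => // w [/= Bj]; rewrite -bigcup_seq => -[i /= si Bi].
by move: js; rewrite (dB _ _ _ Bj Bi) si.
Qed.

Lemma prob_cvg (F : nat -> set T) (A : set T) : (forall i, measurable (F i)) ->
  nondecreasing_seq F -> \bigcup_i F i = A ->
  measurable A /\ (fun i => fine (P (F i))) @ \oo --> fine (P A).
Proof.
move=> mF ndF <-; have mU : measurable (\bigcup_i F i) by exact: bigcup_measurable.
split => //; have h := nondecreasing_cvg_mu mF mU ndF.
by apply: fine_cvg; rewrite fineK ?fin_num_measure//; exact: h.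
Qed.

Variable U : nat -> T -> seq nat.
Hypothesis hUJ : forall m w, (1 <= m)%N -> partJ m (U m w).
Variables (k r : nat) (z : 'I_k -> nat * nat).
Hypothesis z_inj : injective z.
Hypothesis z_ge1 : forall p, (1 <= (z p).2)%N.
Variables (rho : nat -> nat -> 'I_(k + r) -> C) (v : 'I_(k + r) -> nat -> C).
Hypothesis rho_below : forall p m s, ((z p).2 < m)%N -> rho m s (lshift r p) = 0.
Hypothesis rho_level : forall p s, rho (z p).2 s (lshift r p) = (s == (z p).1)%:R.
Hypothesis v_above : forall p i, (rr (z p).2 <= i)%N -> v (lshift r p) i = 0.
Local Notation lev := (levdet z rr rho v).
Variable n : nat.
Hypothesis rr_n : rr n = r.
Hypothesis lev_lim : forall m x, ccvg (fun L => \det (col_mx (upper z rho m)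
    (lower rr v (fun i c => \sum_(threshold m x i <= t < L) rho m.+1 t c) m.+1))) (lev m x).

(** Interpolates between a cylinder, when [m] is at least the level of every point, and the event of
    the theorem, at [m = 0]. *)
Definition event (m : nat) (u : nat -> seq nat) : set T :=
  cyl U m u `&` [set w | forall p, (m < (z p).2)%N -> inX (fun m => U m w) (z p)].

(** Level 0 is not part of the process. The empty sequence placed there interlaces with everything,
    so products of interlacing factors may start at 0. *)
Definition admissible (m : nat) (u : nat -> seq nat) :=
  u 0%N = [::] /\ forall j, (1 <= j <= m)%N -> partJ j (u j).

Definition event_formula (m : nat) : Prop := forall u, admissible m u ->
  measurable (event m u) /\
  (fine (P (event m u)))%:C = (\prod_(0 <= l < m) (interlace (u l) (u l.+1))%:R) * lev m (tl m (u m)).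

Section Step.
Variable m : nat.
Hypothesis mn : (m < n)%N.
Hypothesis IH : event_formula m.+1.
Variable u : nat -> seq nat.
Hypothesis adm : admissible m u.
Local Notation x := (tl m (u m)).
Local Notation r' := (rr m.+1).

Let part_um : partJ m (u m).
Proof. by case: adm => u0 up; case: (m) up => [|j] up; [rewrite u0|apply: up; rewrite /= leqnn]. Qed.

Definition box (L : nat) : set T := event m u `&` [set w | forall i, (i < r')%N -> (tl m.+1 (U m.+1 w) i < L)%N].

Definition cell (L : nat) (y : {ffun 'I_r' -> 'I_L}) : set T :=
  event m u `&` [set w | forall i : 'I_r', tl m.+1 (U m.+1 w) i = y i].

Definition in_cell (L : nat) (y : {ffun 'I_r' -> 'I_L}) : bool :=
  y \in family (fun (i : 'I_r') (t : 'I_L) => (threshold m x i <= val t)%N &&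
    (val t < if val i is i'.+1 then threshold m x i' else L)%N).

(** Positions that are not strictly decreasing come from no partition and violate [in_cell];
    positions that miss a point give an empty cell; any others determine a partition, and the cell
    is an event one level up. *)
Lemma cell_prob (L : nat) (y : {ffun 'I_r' -> 'I_L}) :
  measurable (cell y) /\ (fine (P (cell y)))%:C =
    (\prod_(0 <= l < m) (interlace (u l) (u l.+1))%:R) *
    (if in_cell y then
      (if [forall p : 'I_k, ((z p).2 == m.+1) ==> [exists i, val (y i) == (z p).1]]
       then lev m.+1 (fun i => if insub i is Some i' then val (y i') else 0%N) else 0) else 0).
Proof.
pose yy (i : nat) : nat := if insub i is Some i' then val (y i') else 0%N; rewrite -/yy.
have yyE (i : 'I_r') : yy i = y i by rewrite /yy valK.
have empty : (forall w, ~ cell y w) -> measurable (cell y) /\ fine (P (cell y)) = 0.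
  move=> h; have -> : cell y = set0 by apply/seteqP; split => // w /h.
  by rewrite measure0.
have [/forallP dec|] := boolP [forall i : 'I_r', (i.+1 < r')%N ==> (yy i.+1 < yy i)%N]; last first.
  rewrite negb_forall => /existsP; case=> i; rewrite negb_imply => /andP[i1 ndec].
  have [|mc ->] := empty.
    move=> w [_ /= h]; move: ndec; rewrite (yyE i) -h -[(i.+1)]/(val (Ordinal i1)) yyE -h /=.
    by rewrite tl_dec// hUJ.
  split => //; suff /negPf -> : ~~ in_cell y by rewrite mulr0.
  apply: contra ndec => /familyP inF; have /andP[_ h2] := inF (Ordinal i1).
  have /andP[h1 _] := inF i; rewrite (yyE i) -[(i.+1)]/(val (Ordinal i1)) yyE.
  by rewrite /= in h2; exact: leq_trans h2 h1.
have {}dec i : (i.+1 < r')%N -> (yy i.+1 < yy i)%N.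
  by move=> h; have := dec (Ordinal (ltnW h)); rewrite /= h.
have [pmu tmu] := partition_of_tl dec; set mu := mkseq _ _ in pmu tmu.
have Umu w : (forall i : 'I_r', tl m.+1 (U m.+1 w) i = y i) <-> U m.+1 w = mu.
  split => [h|-> i]; last by rewrite tmu.
  apply: (tl_inj (n := m.+1)) => //; first exact: hUJ.
  by move=> i hi; rewrite tmu// (h (Ordinal hi)) -yyE.
pose u' j := if j == m.+1 then mu else u j.
have u'm : u' m.+1 = mu by rewrite /u' eqxx.
have u'E j : (j <= m)%N -> u' j = u j by move=> jm; rewrite /u' ltn_eqF.
have adm' : admissible m.+1 u'.
  case: adm => u0 up; split; first by rewrite u'E.
  move=> j /andP[j1 jm]; rewrite /u'; case: eqP => [->//|/eqP jm1].
  by apply: up; rewrite j1 /= -ltnS ltn_neqAle jm1.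
have tyy : tl m.+1 mu = yy.
  apply/funext => i; have [im|im] := ltnP i r'; first exact: tmu.
  rewrite tl_over//; first by rewrite /yy insubN// -leqNgt.
  by case/andP: pmu => /eqP.
have int_mu : interlace (u m) mu = in_cell y.
  rewrite (interlace_threshold (L := L) part_um pmu); last first.
    by move=> i hi; rewrite tmu// (yyE (Ordinal hi)).
  apply/forallP/familyP => h i; have := h i; rewrite /in_mem /= tyy yyE; exact.
have hitP : [forall p : 'I_k, ((z p).2 == m.+1) ==> [exists i, val (y i) == (z p).1]] <->
    forall p, (z p).2 = m.+1 -> exists i, val (y i) = (z p).1.
  split => [/forallP h p pm|h].
    by have := h p; rewrite pm eqxx /= => /existsP; case=> i /eqP; exists i.
  apply/forallP => p; apply/implyP => /eqP /h[i hi]; apply/existsP; exists i; exact/eqP.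
set hb := [forall p : 'I_k, _] in hitP *; have [hit|nohit] := boolP hb.
  have hit' := proj1 hitP hit.
  have -> : cell y = event m.+1 u'.
    apply/seteqP; split => w /=.
      move=> [[cw pw] /= yw]; split => /=.
        move=> j /andP[j1 jm]; rewrite /u'; case: eqP => [->|/eqP jm1]; first exact/Umu.
        by apply: cw; rewrite j1 /= -ltnS ltn_neqAle jm1.
      by move=> p pm; apply: pw; exact: ltnW.
    move=> [cw pw]; have Uw : U m.+1 w = mu by rewrite cw ?u'm//= leqnn.
    have yw := proj2 (Umu w) Uw; split; last exact: yw.
    split => [j /andP[j1 jm]|p pm]; first by rewrite cw ?u'E// j1 /= leqW.
    have [pm1|pm1] := eqVneq (z p).2 m.+1; last by apply: pw; rewrite ltn_neqAle eq_sym pm1.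
    split; first by rewrite pm1.
    have [i yi] := hit' p pm1; exists i; first by rewrite pm1.
    by rewrite pm1 yw yi.
  have [mE ->] := IH adm'; split => //.
  rewrite big_nat_recr//= u'm u'E// int_mu tyy.
  have -> : \prod_(0 <= l < m) (interlace (u' l) (u' l.+1))%:R = \prod_(0 <= l < m) (interlace (u l) (u l.+1))%:R :> C.
    by apply: eq_big_nat => l /andP[_ lm]; rewrite !u'E// ltnW.
  by case: ifP => _; rewrite ?mulr1// !mulr0 mul0r.
rewrite if_same mulr0; have [|mc ->] := empty; last by [].
move=> w [[_ pw] /= yw]; case/negP: nohit; apply/hitP => p pm.
have [_ [i hi ti]] := pw p (ltac:(by rewrite pm)).
rewrite pm in hi ti; exists (Ordinal hi); rewrite -ti.
by have := yw (Ordinal hi).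
Qed.

Lemma box_prob (L : nat) : measurable (box L) /\ ((threshold m x 0 <= L)%N ->
  (fine (P (box L)))%:C = (\prod_(0 <= l < m) (interlace (u l) (u l.+1))%:R) *
    \det (col_mx (upper z rho m) (lower rr v (fun i c => \sum_(threshold m x i <= t < L) rho m.+1 t c) m.+1))).
Proof.
have boxE : box L = \big[setU/set0]_(y : {ffun 'I_r' -> 'I_L}) cell y.
  rewrite -bigcup_seq; apply/seteqP; split => w /=.
    move=> [ew /= bw]; exists [ffun i : 'I_r' => Ordinal (bw i (ltn_ord i))] => /=.
      by rewrite mem_index_enum.
    by split => // i; rewrite ffunE.
  move=> [y _ [ew yw]]; split => // i hi.
  by rewrite (yw (Ordinal hi)).
have mcell y := proj1 (@cell_prob L y).
rewrite boxE; split; first by apply: bigsetU_measurable => y _; exact: mcell.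
move=> thr; rewrite prob_bigsetU//; last 2 first.
- exact: index_enum_uniq.
- move=> y1 y2 w [_ h1] [_ h2]; apply/ffunP => i; apply: val_inj.
  by rewrite /= -h1 -h2.
rewrite rmorph_sum/= (eq_bigr _ (fun y _ => proj2 (@cell_prob L y))) -mulr_sumr -big_mkcond/=.
rewrite sum_levdet//; first by rewrite -rr_n leq_rr.
exact: threshold_le.
Qed.

(** The boxes increase to the event, and as [L] grows their probabilities and the truncated
    determinants converge to the two sides. *)
Lemma event_formula_step : measurable (event m u) /\
  (fine (P (event m u)))%:C = (\prod_(0 <= l < m) (interlace (u l) (u l.+1))%:R) * lev m x.
Proof.
have [||me cP] := @prob_cvg box (event m u) (fun L => proj1 (box_prob L)).
- apply/nondecreasing_seqP => L; apply/subsetPset => w [ew /= bw]; split => //= i hi.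
  by rewrite ltnS ltnW// bw.
- apply/seteqP; split => w; first by move=> [L _ []].
  (* The first particle has the largest position, so it alone determines a sufficient box. *)
  move=> ew; exists (tl m.+1 (U m.+1 w) 0).+1 => //; split => //= i hi.
  rewrite ltnS; elim: i hi => [|i IHi] hi //.
  by apply: leq_trans (IHi (ltnW hi)); apply: tl_le; exact: hUJ.
split => //.
have h1 := proj2 (ccvg_shift _ _ (threshold m x 0)) (ccvgR cP).
have h2 := proj2 (ccvg_shift _ _ (threshold m x 0)) (ccvgM (ccvg_cst (\prod_(0 <= l < m) (interlace (u l) (u l.+1))%:R)) (lev_lim m x)).
apply: (ccvg_unique h1); apply: eq_ccvg h2 => L /=.
by rewrite (proj2 (box_prob _))// leq_addl.
Qed.

End Step.
Lemma event_formula_descent : event_formula n -> forall m, (m <= n)%N -> event_formula m.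
Proof.
move=> top; suff h e : (e <= n)%N -> event_formula (n - e).
  by move=> m mn; rewrite -(subKn mn); apply: h; exact: leq_subr.
elim: e => [|e IH] en; first by rewrite subn0.
have ee : (n - e.+1).+1 = (n - e)%N by rewrite subnSK.
move=> u adm; apply: event_formula_step => //; first by rewrite ltn_subrL /= (leq_ltn_trans _ en).
by rewrite ee; apply: IH; exact: ltnW.
Qed.

End Process.

(** This makes the zeroth Taylor coefficient of [1/E] equal to 1, and the diagonal of the triangular
    matrix at the top level a pure power of 2. *)
Lemma Ex1 (R : realType) (a b : nat -> R) (g : R) : Ex a b g 1 = 1.
Proof.
rewrite Ex_eq subrr mulr0 cexp0 mul1r; apply: climitE.
apply: eq_ccvg (ccvg_cst 1) => n; rewrite big1// => i _.
by rewrite !mulr0 addr0 subr0 divr1.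
Qed.

Theorem theorem4p1 (R : realType) (a b : nat -> R) (g : R)
  (ha0 : forall i, 0 <= a i) (ha1 : forall i, a i.+1 <= a i)
  (ha2 : cvgn (series a))
  (hb0 : forall i, 0 <= b i) (hb1 : forall i, b i.+1 <= b i)
  (hb2 : cvgn (series b))
  (hg : 0 <= g)
  (gx gy : R -> R) (hloop : admissible_loop a b g gx gy)
  (d : measure_display) (T : measurableType d) (P : probability T R)
  (U : nat -> T -> seq nat)
  (hUJ : forall (m : nat) (w : T), (1 <= m)%N -> partJ m (U m w))
  (hcyl : forall (n : nat) (u : nat -> seq nat), (1 <= n)%N ->
     (forall m, (1 <= m <= n)%N -> partJ m (u m)) ->
     measurable (cyl U n u) /\ (fine (P (cyl U n u)))%:C = cylw a b g n u)
  (k : nat) (hk : (1 <= k)%N) (z : 'I_k -> nat * nat) (hzinj : injective z)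
  (hz : forall i, (1 <= (z i).2)%N) :
  (fine (P [set w | forall i, inX (fun m => U m w) (z i)]))%:C =
  \det (\matrix_(i < k, j < k) Kern a b g gx gy (z i) (z j)).
Proof.
case: hloop => -[cgx cgy] closed_gam simple_gam [S [dgxy [M bgxy]]] [off wind1 wind0].
have gam_off t : 0 <= t <= 1 -> forall x : R, -1 <= x <= 1 -> gam gx gy t <> x%:C.
  by move=> /off[].
have gam_zero t : 0 <= t <= 1 -> ~ zeroE a b g (gam gx gy t) by move=> /off[].
have [blE cauchyE] := Cauchy_formula ha0 ha1 ha2 hb0 hb1 hb2 hg cgx cgy closed_gam simple_gam
  dgxy bgxy gam_off gam_zero wind1 wind0.
pose E (x : R) := Ex a b g x%:C.
pose W := Wf (Ex a b g) gx gy.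
have bE : bmc `[-1, 1] E := bmc_E cgx cgy dgxy bgxy gam_off blE cauchyE.
have bW j : bmc `[-1, 1] (W j) := bmc_Wf cgx cgy dgxy bgxy gam_off blE j.
have EW0 x : -1 <= x <= 1 -> E x * W 0 x = 1.
  by move=> hx; rewrite /W (Wf0 cauchyE hx) mulfV//; case: (cauchyE x hx).
pose eps := epsc (Ex a b g) gx gy.
have W_rec j x : -1 <= x <= 1 -> W j x = eps j + (x%:C - 1) * W j.+1 x.
  exact: (Wf_rec cgx cgy dgxy bgxy gam_off blE).
have eps0 : eps 0 = 1 by rewrite /eps (epsc0 cauchyE) Ex1 invr1.
(* No point lies above the highest level of the points, so the event there is a cylinder, whose
   probability is given. *)
pose n := \max_(p < k) (z p).2.
have z_le p : ((z p).2 <= n)%N by rewrite /n leq_bigmax.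
have n1 : (1 <= n)%N by exact: leq_trans (hz (Ordinal hk)) (z_le _).
have top : event_formula P U z (@rhoc R E W k n z) (@vcol R k n z) n.
  move=> u [u0 up]; have [mc pc] := hcyl n u n1 up.
  have -> : event U z n u = cyl U n u.
    apply/seteqP; split => w; first by move=> [].
    by move=> cw; split => //= p; rewrite ltnNge z_le.
  split => //; rewrite pc /cylw (levdet_top bE EW0 W_rec eps0 z_le).
  rewrite (big_ltn n1) u0 /= mul1r -mulrA.
  do 2! apply: (congr1 ( *%R _)).
  apply: (congr1 determinant); apply/matrixP => i j; rewrite [LHS]mxE [RHS]mxE.
  rewrite (innerpE n (bmc_horner _)); last first.
    apply: bmcM => //; have -> : (fun x : R => ((x - 1) ^+ (rr n - i.+1))%:C) = (fun x : R => ((('X - 1) ^+ (rr n - i.+1) : {poly R}).[x])%:C).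
      by apply/funext => x; rewrite !hornerE.
    exact: bmc_horner.
  rewrite /coefJ; congr ell; apply/funext => x.
  by rewrite rmorphXn rmorphB rmorph1.
have adm0 : admissible 0 (fun=> [::]) by split => // j; lia.
have [_] := event_formula_descent hUJ hzinj (@rhoc_below R E W k n z) (@rhoc_level R E W k n z)
  (@vcol_above R k n z)
  (erefl (rr n)) (levdet_lim bE bW n z) top (leq0n n) adm0.
have -> : event U z 0 (fun=> [::]) = [set w | forall i, inX (fun m => U m w) (z i)].
  apply/seteqP; split => w /=; first by move=> [_ h] i; apply: h; exact: hz.
  by move=> h; split => [j|p _]; [lia|exact: h].
move=> ->; rewrite big_nil mul1r (levdet_bottom bE bW hzinj hz z_le).
by rewrite (det_Kern cgx cgy dgxy bgxy gam_off blE cauchyE).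
Qed.
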